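(* Let $k\geq 4$. Every $k$-oriented Spherical Diagram with alignment $(2,2,\dots,2,k-1)$ has at least six swirls and at least nine arcs; if it is moreover a Spherical Occlusion Diagram, it has at least $11$ arcs. These bounds are tight: for every $k\ge 4$ there exist $k$-oriented SDs with this alignment having exactly six swirls and nine arcs, and $k$-oriented SODs with this alignment having exactly six swirls and $11$ arcs.
   Context: A geodesic arc on the unit sphere in $\mathbb R^3$ is the unique shortest curve joining two non-antipodal points. An arc $a$ blocks an arc $b$ (equivalently, $b$ hits $a$) if an endpoint of $b$ lies in the relative interior of $a$. A Spherical Diagram (SD) is a finite non-empty collection $\mathcal D$ of pairwise interior-disjoint geodesic arcs on the unit sphere such that each arc of $\mathcal D$ is blocked by arcs of $\mathcal D$ at each of its endpoints. A Spherical Occlusion Diagram (SOD) is an SD such that all arcs of $\mathcal D$ that hit the same arc of $\mathcal D$ reach it from the same side. A swirl of an SD is a cycle of arcs, each of which hits the next (and the last hits the first), going either all clockwise or all counterclockwise. An SD $\mathcal D$ is $k$-oriented if there exist a set $P$ of $k$ points on the unit sphere (poles), no two antipodal, and a function $f\colon\mathcal D\to P$ such that each arc $a\in\mathcal D$ lies on a great circle through $f(a)$ but contains neither $f(a)$ nor its antipode $-f(a)$. A $k$-oriented SD with poles $p_1,\dots,p_k$ has alignment $(d_1,\dots,d_k)$ (listed in nondecreasing order) if, for each $i$, there are exactly $d_i$ distinct great circles containing $p_i$ and at least one other pole. Thus alignment $(2,\dots,2,k-1)$ means that all poles but one lie on a common great circle. *)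

(* Defs.v *)
From HB Require Import structures.
From mathcomp Require Import all_boot all_order all_algebra.
From mathcomp Require Import reals.
Set Implicit Arguments. Unset Strict Implicit. Unset Printing Implicit Defensive.
Import Order.TTheory GRing.Theory Num.Theory.
Local Open Scope ring_scope.

Section Sphere.
Variable R : realType.

Definition vec := 'rV[R]_3.

Definition dot (u v : vec) : R := (u *m v^T) 0 0.
Definition det3 (u v w : vec) : R := \det (col_mx u (col_mx v w) : 'M[R]_3).

Definition onSphere (u : vec) : Prop := dot u u = 1.

(* A (candidate) geodesic arc is given by its two endpoints. *)
Definition garc := (vec * vec)%type.

Definition validArc (a : garc) : Prop :=
  onSphere a.1 /\ onSphere a.2 /\ a.1 <> a.2 /\ a.1 <> - a.2.

(* The (closed) shortest geodesic garc joining a.1 and a.2: the unit vectors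
   in the closed cone spanned by a.1 and a.2. *)
Definition arcContains (a : garc) (x : vec) : Prop :=
  onSphere x /\ exists alpha beta : R,
    0 <= alpha /\ 0 <= beta /\ x = alpha *: a.1 + beta *: a.2.

Definition relInt (a : garc) (x : vec) : Prop :=
  onSphere x /\ exists alpha beta : R,
    0 < alpha /\ 0 < beta /\ x = alpha *: a.1 + beta *: a.2.

Definition endpts (a : garc) (e w : vec) : Prop := (e, w) = a \/ (w, e) = a.

Definition greatCircle (nv : vec) (x : vec) : Prop := onSphere x /\ dot nv x = 0.

Definition sameSet (A B : vec -> Prop) : Prop := forall x, A x <-> B x.

(* A diagram with n arcs, indexed by 'I_n (distinct indices = distinct arcs,
   which is forced by interior-disjointness). *)

Definition hits n (D : 'I_n -> garc) (b a : 'I_n) : Prop :=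
  exists e w, endpts (D b) e w /\ relInt (D a) e.

Definition isSD n (D : 'I_n -> garc) : Prop :=
  (0 < n)%N /\
  (forall a, validArc (D a)) /\
  (forall a b, a != b -> forall x, ~ (relInt (D a) x /\ relInt (D b) x)) /\
  (forall b, (exists a, relInt (D a) (D b).1) /\ (exists a, relInt (D a) (D b).2)).

(* Spherical occlusion diagram: all arcs hitting the same garc a reach it from
   the same side of the great circle of a (the side of an garc b hitting a at
   its endpoint e is the side containing its other endpoint w). *)
Definition isSOD n (D : 'I_n -> garc) : Prop :=
  isSD D /\
  forall a b b' e w e' w',
    endpts (D b) e w -> relInt (D a) e ->
    endpts (D b') e' w' -> relInt (D a) e' ->
    0 < det3 (D a).1 (D a).2 w * det3 (D a).1 (D a).2 w'.

(* Turning direction when going along garc a (from its endpoint w to its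
   endpoint e, which lies in the interior of b) and then along b towards its
   endpoint f (which lies in the interior of c): the sign of det(w, e, f)
   (positive = counterclockwise = left turn, seen from outside the sphere). *)
Definition turnSign n (D : 'I_n -> garc) (a b c : 'I_n) (pos : bool) : Prop :=
  exists e w f w',
    endpts (D a) e w /\ relInt (D b) e /\
    endpts (D b) f w' /\ relInt (D c) f /\
    (if pos then 0 < det3 w e f else det3 w e f < 0).

Definition isSwirl n (D : 'I_n -> garc) (s : seq 'I_n) : Prop :=
  s <> [::] /\ uniq s /\
  exists pos : bool, forall a, a \in s ->
    turnSign D a (next s a) (next s (next s a)) pos.

Definition sameCycle n (s t : seq 'I_n) : Prop := exists r, t = rot r s.

Definition atLeastSwirls n (D : 'I_n -> garc) (N : nat) : Prop :=
  exists sw : 'I_N -> seq 'I_n,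
    (forall i, isSwirl D (sw i)) /\
    (forall i j, i != j -> ~ sameCycle (sw i) (sw j)).

Definition exactlySwirls n (D : 'I_n -> garc) (N : nat) : Prop :=
  exists sw : 'I_N -> seq 'I_n,
    (forall i, isSwirl D (sw i)) /\
    (forall i j, i != j -> ~ sameCycle (sw i) (sw j)) /\
    (forall s, isSwirl D s -> exists i, sameCycle s (sw i)).

Definition numCircles k (p : 'I_k -> vec) (i : 'I_k) (d : nat) : Prop :=
  exists ns : 'I_d -> vec,
    (forall t, ns t != 0) /\
    (forall t t', t != t' -> ~ sameSet (greatCircle (ns t)) (greatCircle (ns t'))) /\
    (forall t, greatCircle (ns t) (p i) /\
               exists j, j != i /\ greatCircle (ns t) (p j)) /\
    (forall nv, nv != 0 -> greatCircle nv (p i) ->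
       (exists j, j != i /\ greatCircle nv (p j)) ->
       exists t, sameSet (greatCircle nv) (greatCircle (ns t))).

Definition arcOnCircleThrough (a : garc) (q : vec) : Prop :=
  exists nv, nv != 0 /\ (forall x, arcContains a x -> greatCircle nv x) /\
             greatCircle nv q.

(* D is k-oriented, witnessed by k distinct poles p (no two antipodal) and an
   assignment f, and this pole set has alignment (2,...,2,k-1): the sorted
   list of the d_i is (2,...,2,k-1), i.e. one pole has d_i = k-1 and all
   others have d_j = 2 (recall k >= 4 so k-1 <> 2). *)
Definition kOrientedAlign2 (k : nat) n (D : 'I_n -> garc) : Prop :=
  exists p : 'I_k -> vec,
    (forall i, onSphere (p i)) /\ injective p /\
    (forall i j, p i <> - p j) /\
    (exists f : 'I_n -> 'I_k, forall a,
        arcOnCircleThrough (D a) (p (f a)) /\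
        ~ arcContains (D a) (p (f a)) /\ ~ arcContains (D a) (- p (f a))) /\
    (exists i0, numCircles p i0 (k.-1) /\ forall j, j != i0 -> numCircles p j 2).

End Sphere.

(* Main.v *)
(* All poles but one, P, lie on a great circle, the equator. An arc is then vertical (on a meridian, away from P and
   -P), slanted (strictly on one side of the equator), or equatorial. Let h vanish at P but at no other pole, and z on
   the equator. In the wedge h, z > 0, the chart h + z = 1 turns the arcs into graphs of affine functions over
   subintervals of an interval, none of which is the whole interval. Ascending from arc to arc to the top of this
   strip and descending again is a monotone map, so some walk with one ascent and one descent is closed; an innermost
   such walk is a swirl. The wedges of h and -h, and a third one which misses a vertex of both swirls found there,
   give three swirls on each side of the equator.

   As extreme points show, every open half-space bounded by a plane through P contains a vertical arc: there are at
   least three. From the counterclockwise end of a slanted arc one is led, directly or along a vertical arc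
   towards P, to another slanted arc crossing its meridian; no cycle of this map is shorter than 3, so there are at
   least three slanted arcs on each side. If there are only three, the ends of consecutive ones make one of them
   receive a hit from the inside and the other a hit from the outside; all hits of an arc of an SOD being on
   the same side, inside and outside would alternate along a cycle of length 3. *)

Require Import Defs.
From mathcomp Require Import all_boot all_order all_algebra.
From mathcomp Require Import reals boolp.
From mathcomp Require Import ring lra zify.
Set Implicit Arguments. Unset Strict Implicit. Unset Printing Implicit Defensive.
Import Order.TTheory GRing.Theory Num.Theory.
Local Open Scope ring_scope.

(** * Swirls of arcs in a strip *)

(** A walk that always turns the same way may leave the wedge, so a swirl is not found by following
    turns. Ascending and descending walks can leave the strip only through its two edges, and since
    no arc joins these edges, a closed walk made of an ascent and a descent has hits on both sides.
    Its corners are controlled by minimality: walks that meet merge, so a corner turning the wrong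
    way starts a walk that is caught inside and closes a smaller trap.

    Points are treated as directions: an arc is the open cone over its two ends, and unit length
    matters only in the passage to and from the given diagram. Most contradictions are of three
    kinds: two open cones meet, an arc ends inside an arc of its own plane, or a point inside an arc
    is extreme in a chart.

    The bounds on arcs are 3 + 3 + 3 and 3 + 4 + 4. Vertical arcs may cross the equator, so they are
    counted once for both sides. *)

(* Arcs [T = icp + slp * x] over subintervals of [0 < x < 1]. The ends with [hi < 1] or [0 < lo] are blocked by
   [up] or [dn], which have junk values otherwise; the other arcs leave the strip. *)
Record strip (R : realFieldType) (I : finType) := Strip {
  lo : I -> R; hi : I -> R; icp : I -> R; slp : I -> R; up : I -> I; dn : I -> I;
  lo_ge0 : forall a, 0 <= lo a;
  hi_le1 : forall a, hi a <= 1;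
  lo_lt_hi : forall a, lo a < hi a;
  upP : forall a, hi a < 1 ->
    lo (up a) < hi a < hi (up a) /\ icp (up a) + slp (up a) * hi a = icp a + slp a * hi a;
  dnP : forall a, 0 < lo a ->
    lo (dn a) < lo a < hi (dn a) /\ icp (dn a) + slp (dn a) * lo a = icp a + slp a * lo a;
  noncross : forall a b x, a != b -> lo a < x < hi a -> lo b < x < hi b ->
    icp a + slp a * x <> icp b + slp b * x;
  nospan : forall a, 0 < lo a \/ hi a < 1 }.

(** * Walks in the strip and their order from left to right *)

Section Strip.
Variables (R : realFieldType) (I : finType) (S : strip R I).
Implicit Types a b c d : I.
Local Notation lo := (lo S). Local Notation hi := (hi S).
Local Notation slp := (slp S).
Local Notation up := (up S). Local Notation dn := (dn S).
(** The variable [x] is the height in the strip; smaller [pos] means further left. *)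
Definition pos a x := icp S a + slp a * x.
Definition alive a x := lo a < x < hi a.

(** Otherwise the two lines would cross at the height [w], strictly between [y] and [x], against
    [noncross]. Equality is possible at [y], where one arc may end on the other. *)
Lemma keep_order a b x y : a != b -> y <= x ->
  lo a <= y -> x <= hi a -> lo b <= y -> x <= hi b ->
  pos a x < pos b x -> pos a y <= pos b y.
Proof.
move=> ab yx la ha lb hb lt; case: lerP => // gt; exfalso.
have yx' : y < x.
  by rewrite lt_neqAle yx andbT; apply/negP => /eqP E; move: gt lt; rewrite E; lra.
set u := pos b x - pos a x; set v := pos a y - pos b y.
have u0 : 0 < u by rewrite /u subr_gt0.
have v0 : 0 < v by rewrite /v subr_gt0.
pose w := (u * y + v * x) / (u + v).
have uv : u + v != 0 by rewrite gt_eqF // addr_gt0.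
have wy : y < w by rewrite /w ltr_pdivlMr; nra.
have wx : w < x by rewrite /w ltr_pdivrMr; nra.
apply: (noncross (s:=S) (a:=a) (b:=b) (x:=w)) => //; try lra.
by rewrite /w; move: uv; rewrite /u /v /pos => uv; field.
Qed.

Lemma alive_neq a b x : a != b -> alive a x -> alive b x -> pos a x <> pos b x.
Proof. exact: noncross. Qed.

Lemma keep_order_strict a b x y : a != b -> y <= x -> alive a y -> alive b y ->
  x <= hi a -> x <= hi b -> pos a x < pos b x -> pos a y < pos b y.
Proof.
move=> ab yx Aa Ab ha hb lt; rewrite lt_neqAle; apply/andP; split.
  by apply/eqP; apply: alive_neq.
by move: Aa Ab; rewrite /alive => Aa Ab; apply: (keep_order (x:=x)) => //; lra.
Qed.

Definition desc b k y := forall i, (i < k)%N -> y <= lo (iter i dn b).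
(** Heights are elements of a field; counting the arcs with a lower bottom makes descents
    well-founded. *)
Definition lo_rank b := #|[set c | lo c < lo b]|.

Lemma lo_rank_dn b : 0 < lo b -> (lo_rank (dn b) < lo_rank b)%N.
Proof.
move=> /dnP[/andP[l1 _] _]; apply: proper_card; apply/properP; split.
  by apply/subsetP => c; rewrite !inE => /lt_trans; apply.
by exists (dn b); rewrite !inE // ltxx.
Qed.

Lemma desc0 b y : desc b 0 y. Proof. by []. Qed.
Lemma descS b k y : y <= lo b -> desc (dn b) k y -> desc b k.+1 y.
Proof. by move=> l H [|i] //=; rewrite ltnS -iterS iterSr => /H. Qed.

Lemma alive_dn b : 0 < lo b -> alive (dn b) (lo b) /\ pos (dn b) (lo b) = pos b (lo b).
Proof. exact: dnP. Qed.

(** Descending walks cannot cross: once they are on a common arc they stay together. The induction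
    replaces the arc whose lower end is higher, or both arcs when these ends are level. *)
Lemma dn_dn_order b d x y : alive b x -> alive d x -> pos d x < pos b x -> 0 < y -> y <= x ->
  exists k l, [/\ desc b k y, desc d l y &
    iter k dn b = iter l dn d \/
    [/\ alive (iter k dn b) y, alive (iter l dn d) y & pos (iter l dn d) y < pos (iter k dn b) y]].
Proof.
move: {2}(lo_rank b + lo_rank d).+1 (ltnSn (lo_rank b + lo_rank d)) => N.
elim: N b d x => // N IH b d x rkN Ab Ad lt y0 yx.
have bd : d != b by apply/eqP => E; move: lt; rewrite E ltxx.
move: (Ab) (Ad) => /andP[Ab1 Ab2] /andP[Ad1 Ad2].
have [lbd ldb] := (ltW Ab1, ltW Ad1).
have [/andP[lby ldy]|/negP yb] := boolP ((lo b < y) && (lo d < y)).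
  exists 0%N, 0%N; split; [exact: desc0|exact: desc0|right].
  have Aby : alive b y by rewrite /alive lby (le_lt_trans yx).
  have Ady : alive d y by rewrite /alive ldy (le_lt_trans yx).
  by split => //=; apply: (keep_order_strict bd yx Ady Aby _ _ lt); apply: ltW.
have {}yb : y <= lo b \/ y <= lo d.
  by case: (lerP y (lo b)) => yb'; [left|right; rewrite leNgt; apply/negP => yd; apply: yb; rewrite yb'].
have [db|db|db] := ltgtP (lo d) (lo b).
- have yb' : y <= lo b by case: yb => // /le_trans; apply; apply: ltW.
  have b0 : 0 < lo b by apply: lt_le_trans yb'.
  have [Abd bT] := alive_dn b0; have rb := lo_rank_dn b0.
  have H : pos d (lo b) <= pos b (lo b) by apply: (keep_order bd lbd _ _ _ _ lt) => //; apply: ltW.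
  have [E|E] := eqVneq (dn b) d.
    by exists 1%N, 0%N; split; [apply: descS|exact: desc0|left].
  have Ad' : alive d (lo b) by rewrite /alive db (lt_trans Ab1).
  have H' : pos d (lo b) < pos (dn b) (lo b).
    by rewrite lt_neqAle bT H andbT -bT; apply/eqP; apply: alive_neq; rewrite 1?eq_sym.
  have rN : (lo_rank (dn b) + lo_rank d < N)%N by clear -rb rkN; lia.
  have [k [l [K1 K2 K3]]] := IH _ _ _ rN Abd Ad' H' y0 yb'.
  by exists k.+1, l; rewrite iterSr; split => //; apply: descS.
- have yd' : y <= lo d by case: yb => // /le_trans; apply; apply: ltW.
  have d0 : 0 < lo d by apply: lt_le_trans yd'.
  have [Add dT] := alive_dn d0; have rd := lo_rank_dn d0.
  have H : pos d (lo d) <= pos b (lo d) by apply: (keep_order bd ldb _ _ _ _ lt) => //; apply: ltW.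
  have [E|E] := eqVneq (dn d) b.
    by exists 0%N, 1%N; split; [exact: desc0|apply: descS|left].
  have Ab' : alive b (lo d) by rewrite /alive db (lt_trans Ad1).
  have H' : pos (dn d) (lo d) < pos b (lo d).
    by rewrite lt_neqAle dT H andbT -dT; apply/eqP; apply: alive_neq.
  have rN : (lo_rank b + lo_rank (dn d) < N)%N by clear -rd rkN; lia.
  have [k [l [K1 K2 K3]]] := IH _ _ _ rN Ab' Add H' y0 yd'.
  by exists k, l.+1; rewrite iterSr; split => //; apply: descS.
- have yd' : y <= lo d by case: yb; rewrite db.
  have d0 : 0 < lo d by apply: lt_le_trans yd'.
  have [Add dT] := alive_dn d0; have rd := lo_rank_dn d0.
  have b0 : 0 < lo b by rewrite -db.
  have [Abd bT] := alive_dn b0; have rb := lo_rank_dn b0.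
  rewrite -db in bT Abd.
  have H : pos d (lo d) <= pos b (lo d) by apply: (keep_order bd ldb _ _ _ _ lt) => //; rewrite -?db ?lexx //; apply: ltW.
  have [E|E] := eqVneq (dn d) (dn b).
    by exists 1%N, 1%N; split; [apply: descS; rewrite -?db|apply: descS|left].
  have H' : pos (dn d) (lo d) < pos (dn b) (lo d).
    by rewrite lt_neqAle dT bT H andbT -bT -dT; apply/eqP; apply: alive_neq.
  have rN : (lo_rank (dn b) + lo_rank (dn d) < N)%N by clear -rb rd rkN; lia.
  have [k [l [K1 K2 K3]]] := IH _ _ _ rN Abd Add H' y0 yd'.
  by exists k.+1, l.+1; rewrite !iterSr; split => //; apply: descS; rewrite -?db.
Qed.

Lemma alive_up b : hi b < 1 -> alive (up b) (hi b) /\ pos (up b) (hi b) = pos b (hi b).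
Proof. exact: upP. Qed.

Lemma hi_gt0 a : 0 < hi a. Proof. exact: le_lt_trans (lo_ge0 _ _) (lo_lt_hi _ _). Qed.

Definition chain a m := forall i, (i < m)%N -> hi (iter i up a) < 1.
(** Height at which the walk ascending from [a] enters its arc [m]; for [m = 0] just the edge of the
    strip. *)
Definition floor_of a m := if m is i.+1 then hi (iter i up a) else 0.

Lemma floor_lt a m : chain a m -> floor_of a m < hi (iter m up a).
Proof.
case: m => [|m] ch /=; first exact: hi_gt0.
by have [/andP[]] := alive_up (ch m (ltnSn m)).
Qed.

Lemma floor_lo a m : chain a m -> (0 < m)%N -> lo (iter m up a) < floor_of a m.
Proof. by case: m => // m ch _; have [/andP[]] := alive_up (ch m (ltnSn m)). Qed.

(** The analogue of [dn_dn_order] for a descending walk and an ascending walk that is retraced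
    downwards. At [floor_of a m] the retraced walk drops from its arc [m] to the previous one,
    although the arc [m] itself goes on below; this step decreases [m]. *)
Lemma dn_up_order a m b x y : chain a m -> alive b x ->
  floor_of a m < x -> lo (iter m up a) < x -> x <= hi (iter m up a) ->
  pos b x < pos (iter m up a) x -> lo a < y -> y <= x ->
  exists k j, [/\ (j <= m)%N, desc b k y &
    iter k dn b = iter j up a \/
    [/\ alive (iter k dn b) y, floor_of a j < y, y <= hi (iter j up a) &
       pos (iter k dn b) y < pos (iter j up a) y]].
Proof.
move: {2}(lo_rank b + m).+1 (ltnSn (lo_rank b + m)) => N.
elim: N b m x => // N IH b m x rkN Ch Ab fx lx xh lt ya yx.
set e := iter m up a in lx xh lt.
have y0 : 0 < y by apply: le_lt_trans ya; apply: lo_ge0.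
have be : b != e by apply/eqP => E; move: lt; rewrite E ltxx.
have eb : e != b by rewrite eq_sym.
move: (Ab) => /andP[Ab1 Ab2].
have le t : y <= t -> floor_of a m <= t -> lo e < t.
  move=> yt ft; have [E|m0] := posnP m; first by rewrite /e E; apply: lt_le_trans yt.
  by apply: lt_le_trans ft; apply: floor_lo.
have [/andP[lby ldy]|/negP yb] := boolP ((lo b < y) && (floor_of a m < y)).
  exists 0%N, m; split => //; right; split => //=.
  - by rewrite /alive lby (le_lt_trans yx).
  - exact: le_trans xh.
  have [E|E] := eqVneq x y; first by rewrite -E.
  have yx' : y < x by rewrite lt_neqAle eq_sym E.
  have Aby : alive b y by rewrite /alive lby (lt_trans yx').
  have Aey : alive e y by rewrite /alive (le _ (lexx y) (ltW ldy)) (lt_le_trans yx').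
  by apply: (keep_order_strict be yx Aby Aey _ _ lt) => //; apply: ltW.
have {}yb : y <= lo b \/ y <= floor_of a m.
  by case: (lerP y (lo b)) => yb'; [left|right; rewrite leNgt; apply/negP => yd; apply: yb; rewrite yb'].
have [db|db|db] := ltgtP (floor_of a m) (lo b).
- have yb' : y <= lo b by case: yb => // /le_trans; apply; apply: ltW.
  have b0 : 0 < lo b by apply: lt_le_trans yb'.
  have [Abd bT] := alive_dn b0; have rb := lo_rank_dn b0.
  have leb : lo e < lo b by apply: le => //; apply: ltW.
  have H : pos b (lo b) <= pos e (lo b) by apply: (keep_order be _ _ _ _ xh lt) => //; apply: ltW.
  have [E|E] := eqVneq (dn b) e.
    by exists 1%N, m; split; [|apply: descS|left].
  have bx := lt_le_trans Ab1 xh.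
  have H' : pos (dn b) (lo b) < pos e (lo b).
    by rewrite lt_neqAle bT H andbT -bT; apply/eqP; apply: alive_neq; rewrite // /alive leb.
  have rN : (lo_rank (dn b) + m < N)%N by clear -rb rkN; lia.
  have [k [j [K1 K2 K3]]] := IH _ _ _ rN Ch Abd db leb (ltW bx) H' ya yb'.
  by exists k.+1, j; rewrite iterSr; split => //; apply: descS.
- have yd' : y <= floor_of a m by case: yb => // /le_trans; apply; apply: ltW.
  have m0 : (0 < m)%N by case: (m) db => //=; rewrite ltNge lo_ge0.
  have lef := floor_lo Ch m0; have fe := floor_lt Ch.
  case: m @e m0 Ch rkN fx lx xh lt be eb le db yb yd' lef fe => // m e _ Ch rkN fx lx xh lt be eb le db yb yd' lef fe.
  rewrite /= in db fx yb lef fe yd'.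
  have [_ uT] := alive_up (Ch m (ltnSn m)).
  set t := hi (iter m up a) in db fx yb uT lef fe yd' *.
  have Ab' : alive b t by rewrite /alive db (lt_trans fx).
  have H : pos b t < pos e t.
    by apply: (keep_order_strict be _ Ab' _ _ xh lt) => //; [apply: ltW|rewrite /alive lef|apply: ltW].
  have Ch' : chain a m by move=> i im; apply: Ch; apply: ltnW.
  rewrite /e /= uT in H.
  have rN : (lo_rank b + m < N)%N by clear -rkN; lia.
  have [k [j [K1 K2 K3]]] := IH _ _ _ rN Ch' Ab' (floor_lt Ch') (lo_lt_hi _ _) (lexx _) H ya yd'.
  by exists k, j; split => //; apply: ltnW.
- have yd' : y <= floor_of a m by case: yb; rewrite db.
  have b0 : 0 < lo b by rewrite -db; apply: lt_le_trans yd'.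
  have m0 : (0 < m)%N by case: (m) db b0 => //= <-; rewrite ltxx.
  have lef := floor_lo Ch m0; have fe := floor_lt Ch.
  case: m @e m0 Ch rkN fx lx xh lt be eb le db yb yd' lef fe => // m e _ Ch rkN fx lx xh lt be eb le db yb yd' lef fe.
  rewrite /= in db fx yb lef fe yd'.
  have [_ uT] := alive_up (Ch m (ltnSn m)).
  have [Abd bT] := alive_dn b0; have rb := lo_rank_dn b0.
  rewrite -db in Abd bT.
  set t := hi (iter m up a) in db fx yb uT lef fe yd' Abd bT *.
  have H : pos b t <= pos e t.
    by apply: (keep_order be _ _ _ _ xh lt) => //; rewrite -?db ?lexx //; apply: ltW.
  have [E|E] := eqVneq (dn b) e.
    by exists 1%N, m.+1; split; [|apply: descS => //; rewrite -db|left].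
  have H' : pos (dn b) t < pos e t.
    by rewrite lt_neqAle bT H andbT -bT; apply/eqP; apply: alive_neq; rewrite // /alive lef.
  have Ch' : chain a m by move=> i im; apply: Ch; apply: ltnW.
  rewrite /e /= uT in H'.
  have rN : (lo_rank (dn b) + m < N)%N by clear -rkN rb; lia.
  have [k [j [K1 K2 K3]]] := IH _ _ _ rN Ch' Abd (floor_lt Ch') (lo_lt_hi _ _) (lexx _) H' ya yd'.
  exists k.+1, j; rewrite iterSr; split => //; first exact: ltnW.
  by apply: descS => //; rewrite -db.
Qed.

Definition dchain c q := forall j, (j < q)%N -> 0 < lo (iter j dn c).

Lemma chain_lt a m i j : chain a m -> (i < j)%N -> (j <= m)%N ->
  hi (iter i up a) < hi (iter j up a).
Proof.
move=> ch ij; elim: j ij => // j IH; rewrite ltnS leq_eqVlt => /predU1P[->|ij] jm.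
  exact: floor_lt (fun k kj => ch k (leq_trans kj (jm : (j.+1 <= m)%N))) => //.
apply: lt_trans (IH ij (ltnW jm)) _.
by apply: (@floor_lt a j.+1) => k kj; apply: ch; apply: leq_trans kj _.
Qed.

Lemma dchain_lt c q i j : dchain c q -> (i < j)%N -> (j <= q)%N ->
  lo (iter j dn c) < lo (iter i dn c).
Proof.
move=> ch ij; elim: j ij => // j IH; rewrite ltnS => ij jq.
have [/andP[l1 _] _] := alive_dn (ch j jq).
move: ij; rewrite leq_eqVlt => /predU1P[->//|ij].
by apply: lt_trans l1 (IH ij (ltnW jq)).
Qed.

Lemma chain_neq a m i j : chain a m -> (i < j)%N -> (j <= m)%N -> iter j up a <> iter i up a.
Proof. by move=> ch ij jm E; have := chain_lt ch ij jm; rewrite E ltxx. Qed.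

(* A closed walk with a single ascent, made of [p] hits, and a single descent, made of [q] hits. *)
Definition trap a p q := [/\ (0 < p)%N, (0 < q)%N, chain a p, dchain (iter p up a) q
  & iter q dn (iter p up a) = a].
Definition top a p := hi (iter p.-1 up a).
Definition bot a p q := lo (iter q.-1 dn (iter p up a)).
(** An integer substitute for the height [t - b] of a trap. It drops strictly when the top is
    lowered to another upper end or the bottom is raised to another lower end. *)
Definition gauge (t b : R) : nat := (#|[set c | (hi c < t)%R]| + #|[set c | (b < lo c)%R]|)%N.
Definition mintrap a p q := trap a p q /\ forall a' p' q', trap a' p' q' ->
  (gauge (top a p) (bot a p q) <= gauge (top a' p') (bot a' p' q'))%N.

Lemma gauge_le (t t' b b' : R) : t' <= t -> b <= b' ->
  (#|[set c | (hi c < t')%R]| <= #|[set c | (hi c < t)%R]|)%N /\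
  (#|[set c | (b' < lo c)%R]| <= #|[set c | (b < lo c)%R]|)%N.
Proof.
move=> tt bb; split; apply: subset_leq_card; apply/subsetP => c; rewrite !inE => h.
  exact: lt_le_trans tt.
exact: le_lt_trans h.
Qed.

(** If the top or the bottom changed, the arc that ends there in the new trap would be counted by
    the gauge of the old trap only. *)
Lemma mintrap_tight a p q a' p' q' : mintrap a p q -> trap a' p' q' ->
  top a' p' <= top a p -> bot a p q <= bot a' p' q' ->
  top a' p' = top a p /\ bot a' p' q' = bot a p q.
Proof.
move=> [_ mn] /mn g tt bb; have [g1 g2] := gauge_le tt bb; rewrite /gauge in g.
move: tt; rewrite le_eqVlt => /predU1P[E1|tt].
  split => //; move: bb; rewrite le_eqVlt => /predU1P[//|bb].
  suff : (#|[set c | (bot a' p' q' < lo c)%R]| < #|[set c | (bot a p q < lo c)%R]|)%N by clear -g g1; lia.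
  apply: proper_card; apply/properP; split.
    by apply/subsetP => c; rewrite !inE; apply: lt_trans.
  by exists (iter q'.-1 dn (iter p' up a')); rewrite !inE // ltxx.
suff : (#|[set c | (hi c < top a' p')%R]| < #|[set c | (hi c < top a p)%R]|)%N by clear -g g2; lia.
apply: proper_card; apply/properP; split.
  by apply/subsetP => c; rewrite !inE => h; apply: lt_trans tt.
by exists (iter p'.-1 up a'); rewrite !inE // ltxx.
Qed.

Lemma desc_lo c k y i : desc c k y -> lo (iter i dn c) < y -> (k <= i)%N.
Proof. by move=> dk ly; rewrite leqNgt; apply/negP => /dk; rewrite leNgt ly. Qed.

Lemma pos_slope a b x y : pos a x = pos b x -> y < x ->
  (pos b y < pos a y) = (slp a < slp b).
Proof.
rewrite /pos => E yx.
have -> : icp S a = icp S b + slp b * x - slp a * x by rewrite -E addrK.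
rewrite -subr_gt0 -[RHS]subr_gt0.
have -> : icp S b + slp b * x - slp a * x + slp a * y - (icp S b + slp b * y) = (slp b - slp a) * (x - y) by ring.
by rewrite pmulr_lgt0 // subr_gt0.
Qed.

Lemma pos_slope_up a b x y : pos a x = pos b x -> x < y ->
  (pos a y < pos b y) = (slp a < slp b).
Proof.
rewrite /pos => E yx.
have -> : icp S a = icp S b + slp b * x - slp a * x by rewrite -E addrK.
rewrite -subr_gt0 -[RHS]subr_gt0.
have -> : (icp S b + slp b * y) - (icp S b + slp b * x - slp a * x + slp a * y) = (slp b - slp a) * (y - x) by ring.
by rewrite pmulr_lgt0 // subr_gt0.
Qed.

Lemma between2 (u v w : R) : u < w -> v < w -> exists x, [/\ u < x, v < x & x < w].
Proof.
move=> uw vw; exists ((Num.max u v + w) / 2).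
have m : Num.max u v < w by rewrite gt_max uw vw.
have [m1 m2] : u <= Num.max u v /\ v <= Num.max u v by rewrite !le_max !lexx orbT.
by clear -m m1 m2; split; lra.
Qed.

(** * The corners of an innermost closed walk *)

Section Minimal.
Variables (a : I) (p q : nat).
Hypothesis mt : mintrap a p q.
Local Notation c := (iter p up a).
Local Notation u i := (iter i up a).
Local Notation d j := (iter j dn c).
Local Notation tp := (top a p). Local Notation bt := (bot a p q).

Let tr : trap a p q. Proof. by case: mt. Qed.
Let p0 : (0 < p)%N. Proof. by case: tr. Qed.
Let q0 : (0 < q)%N. Proof. by case: tr. Qed.
Let ch : chain a p. Proof. by case: tr. Qed.
Let dch : dchain c q. Proof. by case: tr. Qed.
Let dq : d q = a. Proof. by case: tr. Qed.
Let upp : u p = up (u p.-1). Proof. by rewrite -iterS prednK. Qed.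
Let dnq : a = dn (d q.-1). Proof. by rewrite -iterS prednK // dq. Qed.
Let bt_pos : 0 < bt. Proof. by apply: dch; rewrite prednK. Qed.
Let lo_a : lo a < bt /\ bt < hi a.
Proof. by have [/andP[]] := alive_dn bt_pos; rewrite -dnq. Qed.
Let chp i : (i <= p)%N -> chain a i. Proof. by move=> ip j ji; apply: ch; apply: leq_trans ip. Qed.
Let hi_ge i : (i <= p)%N -> hi a <= hi (u i).
Proof. by case: i => [//|i] ip; apply: ltW; apply: (chain_lt ch (ltn0Sn i) ip). Qed.

(** A descent from the arc [m.+1] of the ascent back to an earlier arc [j] is a shortcut: it closes
    a trap whose top is the hit that ends the arc [m]. *)
Lemma subtrap j m k y : (j <= m)%N -> (m < p)%N -> 0 < y ->
  desc (u m.+1) k y -> iter k dn (u m.+1) = u j ->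
  [/\ trap (u j) (m.+1 - j) k, top (u j) (m.+1 - j) = hi (u m) & y <= bot (u j) (m.+1 - j) k].
Proof.
move=> jm mp y0 dk E.
have k0 : (0 < k)%N.
  by case: k E {dk} => //= E; case: (@chain_neq _ p j m.+1 ch).
have E1 : iter (m.+1 - j) up (u j) = u m.+1 by rewrite -iterD subnK // ltnW.
have E2 : iter (m.+1 - j).-1 up (u j) = u m by rewrite -iterD subSn //= subnK.
split.
- split; rewrite ?E1 ?subn_gt0 ?ltnS //.
    move=> i; rewrite ltn_subRL -iterD addnC => im; apply: ch.
    by apply: leq_trans im _.
  by move=> i ik; apply: lt_le_trans (dk _ ik).
- by rewrite /top E2.
- by rewrite /bot E1; apply: dk; rewrite prednK.
Qed.

(** The walk turns left at its top: just below it, the descending arc is to the left of the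
    ascending one. *)
Hypothesis top_left : slp (u p.-1) < slp c.

(** The descending side starts on the left at the top. If it met the ascending side above the
    bottom, it would close a trap with the same top and a higher bottom. *)
Lemma down_left_of_up y : bt < y -> y < tp ->
  exists k j, [/\ (k < q)%N, (j < p)%N, alive (d k) y, floor_of a j < y <= hi (u j)
    & pos (d k) y < pos (u j) y].
Proof.
move=> yb yt.
have pp : (p.-1 < p)%N by rewrite prednK.
have [Atop Etop] := alive_up (ch pp); rewrite -upp in Atop Etop.
have [x1 [x1a x1b x1t]] := between2 (floor_lt (chp (ltnW pp))) (lo_lt_hi S (u p.-1)).
have [x [xa xb xt]] := between2 x1t yt.
have [x' [x'a x'b x't]] := between2 xt (andP Atop).1.
have Ac : alive c x' by rewrite /alive x'b; case/andP: Atop => _; apply: lt_trans.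
have lt : pos c x' < pos (u p.-1) x' by rewrite (pos_slope (esym Etop)).
have yx : y <= x' by apply: ltW; apply: lt_trans x'a.
have x1x : x1 < x' by apply: lt_trans x'a.
have ya : lo a < y by apply: lt_trans yb; case: lo_a.
have [k [j [jp dk H]]] := dn_up_order (chp (ltnW pp)) Ac (lt_trans x1a x1x) (lt_trans x1b x1x) (ltW x't) lt ya yx.
have kq : (k < q)%N.
  rewrite ltnNge; apply/negP => qk; have := dk q.-1; rewrite prednK // => /(_ qk).
  by rewrite leNgt yb.
have jp' : (j < p)%N by rewrite -(prednK p0).
case: H => [E|[Ak j1 j2 lt']]; last first.
  by exists k, j; split => //; rewrite j1.
have y0 : 0 < y by apply: lt_trans yb.
rewrite -{1 2}(prednK p0) in dk E.
have [T1 T2 T3] := subtrap jp pp y0 dk E.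
have := mintrap_tight mt T1; rewrite T2 lexx => /(_ isT) [|_ E'].
  by apply: le_trans T3; apply: ltW.
by move: T3; rewrite E' leNgt yb.
Qed.

Lemma bottom_left : slp (d q.-1) < slp a.
Proof.
have [la ha] := lo_a.
have [Ea Eb] := alive_dn bt_pos; rewrite -dnq in Ea Eb.
have tph : hi a <= tp by apply: hi_ge; apply: leq_pred.
(* Between the bottom and [cap] the descending side is on its last arc, and below [hi a] the
   ascending side is on its first; comparing these two arcs just above the bottom gives the
   slopes. *)
pose cap := if (1 < q)%N then lo (d q.-2) else hi a.
have bcap : bt < cap.
  by rewrite /cap; case: ifP => // q1; apply: (dchain_lt dch); clear -q1; lia.
have [y [y1 _ y2]] := between2 bcap bcap.
have [y' [y'1 _ y'2]] := between2 ha ha.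
pose z := Num.min y y'.
have zb : bt < z by rewrite lt_min y1 y'1.
have zy' : z <= y' by rewrite ge_min lexx orbT.
have zy : z <= y by rewrite ge_min lexx.
have zh : z < hi a by apply: le_lt_trans y'2.
have [k [j [kq jp /andP[Ak _] /andP[j1 _] lt]]] := down_left_of_up zb (lt_le_trans zh tph).
have j0 : j = 0%N.
  case: j j1 {lt} jp => [//|j] /= j1 jp.
  by have := lt_trans j1 zh; rewrite ltNge hi_ge // ltnW // ltnW.
have kq' : k = q.-1.
  apply/eqP; rewrite eqn_leq -ltnS prednK // kq /= leqNgt; apply/negP => kq'.
  have q1 : (1 < q)%N by clear -kq'; lia.
  move: y2; rewrite /cap q1 => y2.
  have lk : lo (d k) < lo (d q.-2) by apply: lt_trans Ak (le_lt_trans zy y2).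
  have : (k <= q.-2)%N by clear -kq'; lia.
  rewrite leq_eqVlt => /predU1P[E|kq2]; first by move: lk; rewrite E ltxx.
  by move: lk; rewrite ltNge ltW // (dchain_lt dch kq2) //; clear; lia.
by move: lt; rewrite j0 kq' /= (pos_slope_up (esym Eb)).
Qed.

(* At a right turn, the descending path of the next arc is caught between the two sides of the trap, hence closes
   a trap with a lower top. *)
Lemma up_corner_left i : (i.+1 < p)%N -> slp (u i.+1) < slp (u i).
Proof.
move=> ip; rewrite ltNge; apply/negP => wrong.
have ip' := ltnW ip.
have [Ab Eb] := alive_up (ch ip'); rewrite -iterS in Ab Eb.
set b := u i.+1 in Ab Eb wrong; set t := hi (u i) in Ab Eb.
have [la ha] := lo_a.
have bt_t : bt < t by apply: lt_le_trans (hi_ge (ltnW ip')).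
have ttop : t < tp.
  by apply: (chain_lt ch); rewrite ?leq_pred // -ltnS prednK.
have [x1 [x1a x1b x1t]] := between2 (floor_lt (chp (ltnW ip'))) (lo_lt_hi S (u i)).
have [x2 [x2a x2b x2t]] := between2 x1t (andP Ab).1.
have [x [xa xb xt]] := between2 x2t bt_t.
have x1x := lt_trans x2a xa.
have Ai : alive (u i) x by rewrite /alive (lt_trans x1b x1x).
have Abx : alive b x.
  by rewrite /alive (lt_trans x2b xa); case/andP: Ab => _; apply: lt_trans.
have bi : b != u i by apply/eqP; apply: (chain_neq ch).
have {}wrong : slp (u i) < slp b.
  rewrite lt_neqAle wrong andbT; apply/eqP => E.
  case: (alive_neq bi Abx Ai).
  by move: Eb; rewrite /pos E => /addIr ->.
have lt : pos b x < pos (u i) x by rewrite (pos_slope (esym Eb)).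
(* The walk descending from [b] starts on the left of the ascending side. If it meets that side, the
   trap so closed has the lower top [t]. *)
have [k' [j [ji dk' H]]] := dn_up_order (chp (ltnW ip')) Abx (lt_trans x1a x1x) (lt_trans x1b x1x) (ltW xt) lt la (ltW xb).
case: H => [E|[Ak' j1 _ lt']].
  have [T1 T2 T3] := subtrap ji ip' bt_pos dk' E.
  have := mintrap_tight mt T1; rewrite T2 => /(_ (ltW ttop) T3)[E' _].
  by move: ttop; rewrite -E' ltxx.
have j0 : j = 0%N.
  case: j ji j1 {lt'} => [//|j] ji /= j1.
  by have := lt_trans j1 ha; rewrite ltNge hi_ge // ltnW // (leq_trans ji) // ltnW.
rewrite {}j0 /= in lt'.
(* It also starts on the right of the descending side, which is on the arc [d k0] at the height
   [t]. *)
have [k0 [j0 [k0q j0p Ad /andP[j01 j02] lt0]]] := down_left_of_up bt_t ttop.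
have j0i : j0 = i.
  apply/eqP; rewrite eqn_leq; apply/andP; split; rewrite leqNgt; apply/negP => h.
    have : t <= floor_of a j0.
      case: j0 h j0p {j01 j02 lt0} => // j0; rewrite ltnS leq_eqVlt => /predU1P[<- //|h] jp /=.
      by apply: ltW; apply: (chain_lt ch h); apply: ltnW; apply: ltnW.
    by rewrite leNgt j01.
  by have := chain_lt ch h (ltnW ip'); rewrite ltNge j02.
rewrite {}j0i -Eb in lt0.
have [k [l [dk dl H]]] := dn_dn_order Ab Ad lt0 bt_pos (ltW bt_t).
rewrite -iterD in H.
have lq : (l + k0 <= q)%N.
  rewrite leqNgt; apply/negP => h; have := dl (q - k0)%N.
  rewrite -iterD subnK ?(ltnW k0q) // dq leNgt la => H'.
  suff : false by []. apply: H'; clear -h k0q; lia.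
(* If it joins the descending side, it follows it to [a] and again closes a trap with the lower top
   [t]. *)
case: H => [E|[Ak Al lt2]].
  have k1 : iter (q - (l + k0) + k) dn b = u 0.
    by rewrite iterD E -iterD subnK.
  have dk1 : desc b (q - (l + k0) + k) bt.
    move=> r lo_rank; have [h|h] := ltnP r k; first exact: dk.
    have -> : r = (r - k + k)%N by rewrite subnK.
    rewrite iterD E -iterD.
    have : (r - k + (l + k0) <= q.-1)%N by clear -h lo_rank lq k0q; lia.
    rewrite leq_eqVlt => /predU1P[-> //|h2].
    by apply: ltW; apply: (dchain_lt dch h2); apply: leq_pred.
  have [T1 T2 T3] := subtrap (leq0n i) ip' bt_pos dk1 k1.
  have := mintrap_tight mt T1; rewrite T2 => /(_ (ltW ttop) T3)[E' _].
  by move: ttop; rewrite -E' ltxx.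
(* Otherwise it reaches the height of the bottom, where the descending side has arrived at [a], and
   would be both left and right of [a] there. *)
have lk : (l + k0)%N = q.
  apply/eqP; rewrite eqn_leq lq /= leqNgt; apply/negP => h.
  have h' : (l + k0 <= q.-1)%N by rewrite -ltnS prednK.
  case/andP: Al; rewrite ltNge; move: h'; rewrite leq_eqVlt => /predU1P[-> |h2].
    by rewrite lexx.
  by rewrite ltW // (dchain_lt dch h2) // leq_pred.
have kk : k' = k.
  by apply/eqP; rewrite eqn_leq (desc_lo dk' (andP Ak).1) (desc_lo dk (andP Ak').1).
by rewrite kk in lt'; have := lt_trans lt2 lt'; rewrite lk dq ltxx.
Qed.

(** At a common arc the descent could stop early, closing a trap with the same top and a higher
    bottom. *)
Lemma up_down_disjoint i j : (i < p)%N -> (j < q)%N -> u i <> d j.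
Proof.
move=> ip jq E.
have pp : (p.-1 < p)%N by rewrite prednK.
have i1 : (i <= p.-1)%N by rewrite -ltnS prednK.
have ljq : lo (d j) < lo (d j.-1) \/ j = 0%N.
  by case: j jq {E} => [|j] jq; [right|left; apply: (dchain_lt dch) => //; apply: ltnW].
case: ljq => [ljq|j0]; last first.
  by rewrite j0 /= in E; case: (chain_neq ch ip (leqnn p)).
have j0 : (0 < j)%N by case: (j) ljq => //=; rewrite ltxx.
have dk : desc (u p.-1.+1) j (lo (d j.-1)).
  rewrite prednK // => r rj; have : (r <= j.-1)%N by rewrite -ltnS prednK.
  rewrite leq_eqVlt => /predU1P[-> //|h].
  by apply: ltW; apply: (dchain_lt dch h); apply: leq_trans (leq_pred _) (ltnW jq).
have y0 : 0 < lo (d j.-1) by apply: le_lt_trans ljq; apply: lo_ge0.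
rewrite -{1}(prednK p0) in E.
have [T1 T2 T3] := subtrap i1 pp y0 dk (esym E).
have blt : bt < lo (d j.-1).
  by apply: (dchain_lt dch); rewrite ?leq_pred //; clear -jq j0; lia.
have := mintrap_tight mt T1; rewrite T2 lexx => /(_ isT (ltW (lt_le_trans blt T3)))[_ E'].
by move: T3; rewrite E' leNgt blt.
Qed.
End Minimal.
End Strip.

(** * Symmetries of the strip, and the swirl along an innermost closed walk *)

Section Symmetries.
Variables (R : realFieldType) (I : finType) (S : strip R I).

(** It exchanges ascents and descents but preserves slopes and the sense of turns, so results on the
    ascending side carry over to the descending one. *)
Program Definition half_turn : strip R I :=
  @Strip R I (fun a => 1 - hi S a) (fun a => 1 - lo S a) (fun a => - (icp S a + slp S a))
    (slp S) (dn S) (up S) _ _ _ _ _ _ _.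
Next Obligation. by rewrite subr_ge0 hi_le1. Qed.
Next Obligation. by rewrite lerBlDr lerDl lo_ge0. Qed.
Next Obligation. by rewrite ltrD2l ltrN2 lo_lt_hi. Qed.
Next Obligation.
have [|/andP[h1 h2] E] := @dnP R I S a; first by move: H; clear; lra.
split; first by apply/andP; split; clear -h1 h2; lra.
by move: E; clear; lra.
Qed.
Next Obligation.
have [|/andP[h1 h2] E] := @upP R I S a; first by move: H; clear; lra.
split; first by apply/andP; split; clear -h1 h2; lra.
by move: E; clear; lra.
Qed.
Next Obligation.
move=> E; apply: (@noncross R I S a b (1 - x) H).
- by move: H0; clear; lra.
- by move: H1; clear; lra.
- by move: E; clear; lra.
Qed.
Next Obligation.
by case: (nospan S a) => h; [right|left]; move: h; clear; lra.
Qed.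

(** It keeps heights and exchanges left and right turns. *)
Program Definition reflection : strip R I :=
  @Strip R I (lo S) (hi S) (fun a => - icp S a) (fun a => - slp S a) (up S) (dn S) _ _ _ _ _ _ _.
Next Obligation. exact: lo_ge0. Qed.
Next Obligation. exact: hi_le1. Qed.
Next Obligation. exact: lo_lt_hi. Qed.
Next Obligation.
have [h E] := upP H; split => //.
by move: E; clear; lra.
Qed.
Next Obligation.
have [h E] := dnP H; split => //.
by move: E; clear; lra.
Qed.
Next Obligation.
move=> E; apply: (@noncross R I S a b x H) => //.
by move: E; clear; lra.
Qed.
Next Obligation. exact: nospan. Qed.

Lemma pos_half_turn a x : pos half_turn a x = - pos S a (1 - x).
Proof. by rewrite /pos /=; ring. Qed.

Lemma half_turn_chain a m : chain half_turn a m <-> dchain S a m.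
Proof.
by split=> H i im; have := H i im; rewrite /= ?gtrBl // => ?; rewrite gtrBl.
Qed.

Lemma half_turn_dchain a m : dchain half_turn a m <-> chain S a m.
Proof. by split=> H i im; have := H i im; rewrite /= subr_gt0. Qed.

Lemma half_turn_trap a p q : trap S a p q -> trap half_turn (iter p (up S) a) q p.
Proof.
move=> [p0 q0 c d E]; split => //=; rewrite ?E //.
  exact/half_turn_chain.
exact/half_turn_dchain.
Qed.

Lemma trap_half_turn a p q : trap half_turn a p q -> trap S (iter p (dn S) a) q p.
Proof.
move=> [p0 q0 c d E]; split => //=; move: E => /= E; rewrite ?E //.
  exact/half_turn_dchain.
exact/half_turn_chain.
Qed.

Lemma gauge_half_turn t b : gauge half_turn (1 - b) (1 - t) = gauge S t b.
Proof.
rewrite /gauge addnC; congr addn; apply: eq_card => x; rewrite !inE /=.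
  by rewrite ltrD2l ltrN2.
by rewrite ltrD2l ltrN2.
Qed.

Lemma half_turn_mintrap a p q : mintrap S a p q -> mintrap half_turn (iter p (up S) a) q p.
Proof.
move=> [tr mn]; split; first exact: half_turn_trap.
move=> a' p' q' tr'; have := mn _ _ _ (trap_half_turn tr').
have E : iter q (dn S) (iter p (up S) a) = a by case: tr.
have E' : iter q' (up S) (iter p' (dn S) a') = a' by case: tr'.
rewrite -gauge_half_turn -[X in (_ <= X)%N]gauge_half_turn.
by rewrite /top /bot /= E E'.
Qed.

(* As [slp] is dT/dx, going upwards a left turn decreases it; it increases if the direction is reversed. *)
Definition swirl_step (dir : I -> bool) (ps : bool) x y :=
  (if dir x then (hi S x < 1) && (y == up S x) else (0 < lo S x) && (y == dn S x)) &&
  (if (dir x == dir y) (+) ~~ ps then slp S y < slp S x else slp S x < slp S y).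

Lemma cycle_mkseq (T : eqType) (e : rel T) (w : nat -> T) n :
  (forall i, (i.+1 < n)%N -> e (w i) (w i.+1)) -> e (w n.-1) (w 0%N) -> cycle e (mkseq w n).
Proof.
case: n => // n H1 H2.
have N k : (k <= n)%N -> nth (w 0%N) (mkseq w n.+1) k = w k by move=> kn; rewrite nth_mkseq.
rewrite (_ : mkseq w n.+1 = w 0%N :: behead (mkseq w n.+1)) // /cycle rcons_path; apply/andP; split.
  apply/(pathP (w 0%N)) => i; rewrite size_behead size_mkseq => ni.
  by rewrite nth_behead !N ?(ltnW ni) //; apply: H1.
rewrite (last_nth (w 0%N)) size_behead size_mkseq -[_ :: _]/(mkseq w n.+1) N //.
Qed.

(** The top is a left turn by assumption, the bottom by [bottom_left], the corners of the ascent by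
    [up_corner_left], and those of the descent by the same lemma after a half turn. *)
Lemma mintrap_left_swirl a p q : mintrap S a p q ->
  slp S (iter p.-1 (up S) a) < slp S (iter p (up S) a) ->
  exists dir s, [/\ s <> [::], uniq s & cycle (swirl_step dir true) s].
Proof.
move=> mt tl; have [p0 q0 ch dch dq] := mt.1.
have bl := bottom_left mt tl; have rl := half_turn_mintrap mt.
set c := iter p (up S) a in dch dq bl rl tl *.
have dl j : (j.+1 < q)%N -> slp S (iter j.+1 (dn S) c) < slp S (iter j (dn S) c).
  by apply: (up_corner_left rl); rewrite /= dq.
have dis := up_down_disjoint mt.
pose dir x := [exists i : 'I_p, x == iter i (up S) a].
(* The top arc [c] is listed as the first arc of the descent. *)
pose w i := if (i < p)%N then iter i (up S) a else iter (i - p) (dn S) c.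
have wu i : (i < p)%N -> w i = iter i (up S) a by move=> ip; rewrite /w ip.
have wd i : (p <= i)%N -> w i = iter (i - p) (dn S) c by move=> ip; rewrite /w ltnNge ip.
have du i : (i < p)%N -> dir (w i).
  by move=> ip; apply/fintype.existsP; exists (Ordinal ip); rewrite wu.
have dd i : (p <= i)%N -> (i < p + q)%N -> dir (w i) = false.
  move=> pi iq; apply/negbTE/negP; rewrite /dir => /fintype.existsP [[r rp] /eqP]; rewrite wd //= => /esym; apply: dis => //.
  by rewrite ltn_subLR.
have lst : w (p + q).-1 = iter q.-1 (dn S) c.
  rewrite wd; last by clear -q0; lia.
  by congr iter; clear -q0; lia.
exists dir, (mkseq w (p + q)); split.
- by move/(congr1 size); rewrite size_mkseq; clear -p0; case: p p0.
- apply/mkseq_uniqP => i j.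
  wlog ij : i j / (i < j)%N.
    move=> H; case: (ltngtP i j) => [ij|ij|//]; first exact: H.
    by move=> iq jq E; apply/esym; apply: H => //; apply/esym.
  rewrite !inE => iq jq E; exfalso.
  have [jp|pj] := ltnP j p.
    move: E; rewrite !wu //; last exact: ltn_trans jp.
    by move/esym; apply: (chain_neq ch ij); apply: ltnW.
  have [ip|pi] := ltnP i p.
    move: E; rewrite wu // wd //; apply: dis => //; by rewrite ltn_subLR.
  move: E; rewrite !wd // => /(congr1 (lo S)) E.
  have : lo S (iter (j - p) (dn S) c) < lo S (iter (i - p) (dn S) c).
    by apply: (dchain_lt dch); rewrite ?ltn_sub2r // ?(leq_ltn_trans pi) // leq_subLR ltnW.
  by rewrite E ltxx.
- apply: cycle_mkseq => [i ipq|].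
    have [ip1|pi1] := ltnP i.+1 p.
      have ip := ltnW ip1.
      by rewrite /swirl_step !du //= !wu // ch //= (up_corner_left mt tl ip1) eqxx.
    have [ip|pi] := ltnP i p.
      have E : i.+1 = p by apply/eqP; rewrite eqn_leq ip pi1.
      rewrite /swirl_step du // dd // wu // wd //= ch // E subnn /= /c -[in iter p _ _]E /= eqxx /=.
      by move: tl; rewrite /c -E.
    have ij : (i - p < q)%N by rewrite ltn_subLR // ltnW.
    rewrite /swirl_step !dd // ?(ltnW ipq) // !wd // subSn //= dch //= eqxx /=.
    by apply: dl; rewrite -subSn // ltn_subLR.
  have pq : ((p + q).-1 < p + q)%N by clear -q0; lia.
  rewrite /swirl_step dd //; last by clear -q0; lia.
  rewrite du // lst wu //= dch ?prednK //= bl andbT.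
  by apply/eqP; rewrite -[in LHS]dq -{1}(prednK q0).
Qed.
End Symmetries.

Section StripSwirl.
Variables (R : realFieldType) (I : finType).
Implicit Types S : strip R I.

Lemma mintrap_swirl S a p q : mintrap S a p q ->
  exists dir ps s, [/\ s <> [::], uniq s & cycle (swirl_step S dir ps) s].
Proof.
move=> mt; have [p0 q0 ch dch dq] := mt.1.
have pp : (p.-1 < p)%N by rewrite prednK.
have [Ac Ec] := alive_up (ch _ pp).
have upp : up S (iter p.-1 (up S) a) = iter p (up S) a by rewrite -iterS prednK.
rewrite upp in Ac Ec.
have [tl|tl|E] := ltgtP (slp S (iter p.-1 (up S) a)) (slp S (iter p (up S) a)).
- by have [dir [s H]] := mintrap_left_swirl mt tl; exists dir, true, s.
- have mt' : mintrap (reflection S) a p q by [].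
  have [|dir [s [H1 H2 H3]]] := mintrap_left_swirl mt'; first by rewrite /= ltrN2.
  exists dir, false, s; split => //.
  apply: sub_cycle H3 => x y; rewrite /swirl_step /= !ltrN2 addbF addbT.
  by case: (dir x); case: (dir y).
- exfalso; have /andP[l1 l2] := Ac.
  have [x [x1 x2 x3]] := between2 l1 (lo_lt_hi S (iter p.-1 (up S) a)).
  apply: (@noncross R I S (iter p.-1 (up S) a) (iter p (up S) a) x).
  + by apply/eqP => /esym; apply: (chain_neq ch pp).
  + by rewrite x2 x3.
  + by rewrite x1 (lt_trans x3).
  by move: Ec; rewrite /pos E => /addIr ->.
Qed.

Lemma exists_mintrap S : (exists a p q, trap S a p q) -> exists a p q, mintrap S a p q.
Proof.
move=> [a [p [q]]]; move En: (gauge S (top S a p) (bot S a p q)) => n.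
elim/ltn_ind: n a p q En => n IH a p q En tr.
have [[a' [p' [q' [tr' lt]]]]|no] := EM (exists a' p' q', trap S a' p' q' /\
  (gauge S (top S a' p') (bot S a' p' q') < n)%N).
  exact: (IH _ lt a' p' q').
exists a, p, q; split => // a' p' q' tr'; rewrite En leqNgt; apply/negP => lt.
by apply: no; exists a', p', q'.
Qed.

Lemma small_pos (s : seq R) : all (fun x => 0 < x) s -> exists2 e : R, 0 < e & all (fun x => e < x) s.
Proof.
elim: s => [|x s IH] /=; first by exists 1.
move=> /andP[x0 /IH[e e0 es]]; exists (Num.min (x / 2) e).
  by rewrite lt_min e0 divr_gt0.
apply/andP; split; first by rewrite gt_min ltr_pdivrMr // mulr_natr mulr2n ltrDl x0.
by apply/allP => y /(allP es) ey; rewrite gt_min ey orbT.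
Qed.

Lemma floor_reached S c : exists k, dchain S c k /\ lo S (iter k (dn S) c) = 0.
Proof.
move: {2}(lo_rank S c).+1 (ltnSn (lo_rank S c)) => n; elim: n c => // n IH c rn.
have := lo_ge0 S c; rewrite le_eqVlt => /predU1P[E|l0]; first by exists 0%N.
have [|k [k1 k2]] := IH (dn S c); first by apply: leq_trans (lo_rank_dn l0) _.
exists k.+1; rewrite iterSr; split => // -[|i] // ik; rewrite iterSr; exact: k1.
Qed.

Lemma floor_time_uniq S c i j : dchain S c i -> lo S (iter i (dn S) c) = 0 ->
  dchain S c j -> lo S (iter j (dn S) c) = 0 -> i = j.
Proof.
move=> di li dj lj; apply/eqP; rewrite eqn_leq; apply/andP; split; rewrite leqNgt; apply/negP => h.
  by have := di _ h; rewrite lj ltxx.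
by have := dj _ h; rewrite li ltxx.
Qed.

(** At the height [e] the arcs present are exactly those that reach the floor, and at [1 - e] those
    that reach the ceiling; [pos] orders each of these families strictly. *)
Definition near_edge S (e : R) := [/\ 0 < e, e <= 1 - e & forall a,
  [/\ 0 < lo S a -> e < lo S a, hi S a < 1 -> e < 1 - hi S a, e < hi S a & e < 1 - lo S a]].

(** Descending walks keep their order until they merge, and after merging they arrive at the same
    arc on the floor. *)
Lemma floor_monotone S (K : I -> nat) e :
  near_edge S e ->
  (forall c, dchain S c (K c) /\ lo S (iter (K c) (dn S) c) = 0) ->
  forall c c', hi S c = 1 -> hi S c' = 1 -> pos S c (1 - e) < pos S c' (1 - e) ->
  pos S (iter (K c) (dn S) c) e <= pos S (iter (K c') (dn S) c') e.
Proof.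
move=> [e0 ee ne] HK c c' hc hc' lt.
have Ac b : hi S b = 1 -> alive S b (1 - e).
  by move=> hb; have [_ _ h1 h2] := ne b; rewrite /alive hb; clear -h1 h2 e0; lra.
have [k [l [dk dl H]]] := dn_dn_order (Ac _ hc') (Ac _ hc) lt e0 ee.
have le b m : desc S b m e -> (m <= K b)%N.
  by move=> dm; have [_ lK] := HK b; apply: (desc_lo dm); rewrite lK.
have tail b m : desc S b m e -> iter (K b - m) (dn S) (iter m (dn S) b) = iter (K b) (dn S) b.
  by move=> dm; rewrite -iterD subnK // le.
case: H => [E|[A1 A2 lt2]].
  rewrite -(tail _ _ dk) -(tail _ _ dl) E.
  suff -> : (K c' - k)%N = (K c - l)%N by [].
  apply: (@floor_time_uniq S (iter l (dn S) c)).
  - by rewrite -E => i ik; rewrite -iterD; apply: (HK c').1; rewrite addnC -ltn_subRL.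
  - by rewrite -E -iterD subnK ?le //; case: (HK c').
  - by move=> i ik; rewrite -iterD; apply: (HK c).1; rewrite addnC -ltn_subRL.
  - by rewrite -iterD subnK ?le //; case: (HK c).
have fl b m : desc S b m e -> alive S (iter m (dn S) b) e -> m = K b.
  move=> dm /andP[lm _]; have lo0 : lo S (iter m (dn S) b) = 0.
    apply/eqP; rewrite eq_le lo_ge0 andbT leNgt; apply/negP => l0.
    by have [/(_ l0)] := ne (iter m (dn S) b); rewrite ltNge ltW.
  apply: (floor_time_uniq _ lo0 (HK b).1 (HK b).2).
  by move=> i im; apply: lt_le_trans (dm _ im).
by rewrite -(fl _ _ dk A1) -(fl _ _ dl A2) ltW.
Qed.
End StripSwirl.

(** * Existence of a closed walk *)

Section Existence.
Variables (R : realFieldType) (I : finType) (S : strip R I).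

Lemma exists_near_edge : exists e : R, near_edge S e.
Proof.
pose t (a : I) : seq R := [:: (if 0 < lo S a then lo S a else 1);
  (if hi S a < 1 then 1 - hi S a else 1); hi S a; 1 - lo S a].
have [|e e0 /= /andP[e2 es]] := @small_pos R (2^-1 :: flatten [seq t a | a <- enum I]).
  rewrite /= invr_gt0 ltr0n /=; apply/allP => x /flatten_mapP[a _].
  rewrite !inE => /or4P[] /eqP ->.
  - by case: ifP.
  - by case: ifP => // h; rewrite subr_gt0.
  - exact: le_lt_trans (lo_ge0 _ _) (lo_lt_hi _ _).
  - by rewrite subr_gt0; apply: lt_le_trans (lo_lt_hi _ _) (hi_le1 _ _).
exists e; split => //.
  by move: e2; clear; lra.
move=> a; have H x : x \in t a -> e < x.
  by move=> xa; apply: (allP es); apply/flatten_mapP; exists a => //; rewrite mem_enum.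
split.
- by move=> l0; have := H (lo S a); rewrite /t l0; apply; rewrite inE eqxx.
- by move=> h0; have := H (1 - hi S a); rewrite /t h0; apply; rewrite !inE eqxx !orbT.
- by apply: H; rewrite !inE eqxx !orbT.
- by apply: H; rewrite !inE eqxx !orbT.
Qed.

Lemma near_edge_half_turn e : near_edge S e -> near_edge (half_turn S) e.
Proof.
move=> [e0 e1 H]; split => // a; have [h1 h2 h3 h4] := H a; split => //=; rewrite ?subr_gt0 ?gtrBl //.
- by move=> l0; have := h1 l0; clear; lra.
- by move: h3; clear; lra.
Qed.

(* Ascending to the ceiling and descending again is a monotone map on the arcs reaching the floor; it has a fixed
   point. *)
Lemma exists_trap (a0 : I) : exists a p q, trap S a p q.
Proof.
have [e ne] := exists_near_edge; have [e0 e1 He] := ne.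
have [K HK] := fin_all_exists (floor_reached S).
have [M HM] := fin_all_exists (floor_reached (half_turn S)).
pose U a := iter (M a) (up S) a; pose D c := iter (K c) (dn S) c.
have U1 a : hi S (U a) = 1 by have [_ /=] := HM a; move/subr0_eq/esym.
have Uc a : chain S a (M a) by apply/half_turn_dchain; case: (HM a).
have D0 c : lo S (D c) = 0 by case: (HK c).
have fal a : lo S a = 0 -> alive S a e.
  by move=> l0; have [_ _ h _] := He a; rewrite /alive l0 e0.
pose F a := D (U a).
have inj a b : lo S a = 0 -> lo S b = 0 -> pos S a e = pos S b e -> a = b.
  move=> la lb E; apply/eqP/negPn/negP => ab.
  by apply: (alive_neq ab (fal _ la) (fal _ lb)).
have mono a b : lo S a = 0 -> lo S b = 0 -> pos S a e <= pos S b e -> pos S (F a) e <= pos S (F b) e.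
  move=> la lb; rewrite le_eqVlt => /predU1P[/inj-> //|lt].
  have : pos S (U a) (1 - e) <= pos S (U b) (1 - e).
    have := @floor_monotone _ _ (half_turn S) M e (near_edge_half_turn ne) HM b a.
    rewrite !pos_half_turn /= !subKr lerN2; apply; rewrite ?la ?lb ?subr0 //.
    by rewrite ltrN2.
  rewrite le_eqVlt => /predU1P[E|lt2]; last exact: (floor_monotone ne HK).
  rewrite /F (_ : U a = U b) //; apply/eqP/negPn/negP => ab.
  have al c : hi S c = 1 -> alive S c (1 - e).
    by move=> hc; have [_ _ _ h] := He c; rewrite /alive hc; move: h e0; clear; lra.
  by apply: (alive_neq ab (al _ (U1 a)) (al _ (U1 b))).
(* A monotone self-map of a finite chain: the rightmost arc among those that are not moved to the
   left is fixed. *)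
pose P a := (lo S a == 0) && (pos S a e <= pos S (F a) e).
have [a1 Pa1] : exists a1, P a1.
  have l0 : lo S (D a0) == 0 by rewrite D0.
  case: (@arg_minP _ _ _ _ (fun a => lo S a == 0) (pos S ^~ e) l0) => a1 /eqP la1 mn.
  by exists a1; rewrite /P la1 eqxx /=; apply: mn; rewrite D0 eqxx.
case: (arg_maxP (pos S ^~ e) Pa1) => a /andP[/eqP la aF] mx.
have PF : P (F a) by rewrite /P D0 eqxx /=; apply: mono; rewrite ?D0.
have FE : F a = a by apply: inj; rewrite ?D0 //; apply/eqP; rewrite eq_le aF andbT; apply: mx.
(* The arc [a] reaches the floor, hence not the ceiling; so neither the ascent nor the descent is
   empty. *)
have ha : hi S a < 1 by case: (nospan S a); rewrite // la ltxx.
exists a, (M a), (K (U a)); split => //.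
- by case E: (M a) => [|m] //; have := U1 a; rewrite /U E /= => h; move: ha; rewrite h ltxx.
- case E: (K (U a)) => [|m] //; have := D0 (U a); rewrite /D E /= => h.
  by move: FE ha; rewrite /F /D E /= => <-; rewrite U1 ltxx.
- by case: (HK (U a)).
Qed.

Theorem strip_swirl (a0 : I) :
  exists dir ps s, [/\ s <> [::], uniq s & cycle (swirl_step S dir ps) s].
Proof.
by have [a [p [q /mintrap_swirl]]] := exists_mintrap (exists_trap a0).
Qed.
End Existence.

(** * Coordinates adapted to the poles *)

Lemma sum_sqr_gt0 (R : realFieldType) (a b : R) : (a, b) <> (0, 0) -> 0 < a ^+ 2 + b ^+ 2.
Proof.
move=> ab; rewrite lt_def addr_ge0 ?sqr_ge0 // andbT paddr_eq0 ?sqr_ge0 // !sqrf_eq0.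
by apply/negP => /andP[/eqP a0 /eqP b0]; apply: ab; rewrite a0 b0.
Qed.

Section Coordinates.
Variable R : realType.
Implicit Types (u v w x e : vec R) (f h g z : vec R -> R).

Definition idx2 : 'I_3 := @Ordinal 3 2 isT.
Definition cx u : R := u 0 0.
Definition cy u : R := u 0 1.
Definition cz u : R := u 0 idx2.
Definition v3 (a b c : R) : vec R :=
  \row_(j < 3) (if j == 0 then a else if j == 1 then b else c).

Lemma cxE a b c : cx (v3 a b c) = a. Proof. by rewrite /cx mxE. Qed.
Lemma cyE a b c : cy (v3 a b c) = b. Proof. by rewrite /cy mxE. Qed.
Lemma czE a b c : cz (v3 a b c) = c. Proof. by rewrite /cz mxE. Qed.

Lemma vecP u v : cx u = cx v -> cy u = cy v -> cz u = cz v -> u = v.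
Proof.
move=> h1 h2 h3; apply/rowP => -[[|[|[|//]]] H].
- by rewrite (_ : Ordinal H = 0) //; apply: val_inj.
- by rewrite (_ : Ordinal H = 1) //; apply: val_inj.
- by rewrite (_ : Ordinal H = idx2) //; apply: val_inj.
Qed.

Lemma sum3 (F : 'I_3 -> R) : \sum_(j < 3) F j = F 0 + F 1 + F idx2.
Proof.
rewrite !big_ord_recl big_ord0 addr0 addrA.
by congr (_ + F _ + F _); apply: val_inj.
Qed.

Lemma dotE u v : dot u v = cx u * cx v + cy u * cy v + cz u * cz v.
Proof. by rewrite /dot mxE sum3 !mxE. Qed.

Lemma det33 (M : 'M[R]_3) : \det M =
  M 0 0 * (M 1 1 * M idx2 idx2 - M idx2 1 * M 1 idx2) - M 1 0 * (M 0 1 * M idx2 idx2 - M idx2 1 * M 0 idx2)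
  + M idx2 0 * (M 0 1 * M 1 idx2 - M 1 1 * M 0 idx2).
Proof.
rewrite (expand_det_col _ 0) sum3 /cofactor !(expand_det_col _ 0) !big_ord_recl !big_ord0.
rewrite /cofactor !det_mx11 !mxE.
have L1 : lift (0 : 'I_3) 0 = 1 by apply: val_inj.
have L2 : lift (0 : 'I_3) 1 = idx2 by apply: val_inj.
have L3 : lift (1 : 'I_3) 0 = 0 by apply: val_inj.
have L4 : lift (1 : 'I_3) 1 = idx2 by apply: val_inj.
have L5 : lift (idx2 : 'I_3) 0 = 0 by apply: val_inj.
have L6 : lift (idx2 : 'I_3) 1 = 1 by apply: val_inj.
have L7 : lift (0 : 'I_2) 0 = 1 by apply: val_inj.
have L8 : lift (1 : 'I_2) 0 = 0 by apply: val_inj.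
rewrite (_ : @lift 2 ord0 ord0 = 1 :> 'I_2) ?L7 ?L8 ?L1 ?L2 ?L3 ?L4 ?L5 ?L6 ?expr0 /=; last exact: val_inj.
ring.
Qed.

Lemma det3E u v w : det3 u v w =
  cx u * (cy v * cz w - cy w * cz v) - cx v * (cy u * cz w - cy w * cz u)
  + cx w * (cy u * cz v - cy v * cz u).
Proof.
rewrite /det3 det33; pose M : 'M[R]_3 := @col_mx R 1 2 3 u (@col_mx R 1 1 3 v w); rewrite -/M.
have E0 j : M 0 j = u 0 j.
  by rewrite -(col_mxEu u (col_mx v w)); congr (M _ _); apply: val_inj.
have E1 j : M 1 j = v 0 j.
  by rewrite -(col_mxEu v w) -(col_mxEd u (col_mx v w)); congr (M _ _); apply: val_inj.
have E2 j : M idx2 j = w 0 j.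
  by rewrite -(col_mxEd v w) -(col_mxEd u (col_mx v w)); congr (M _ _); apply: val_inj.
by rewrite !E0 !E1 !E2.
Qed.

Definition lin f := forall a b u v, f (a *: u + b *: v) = a * f u + b * f v.

Lemma lin_cx : lin cx. Proof. by move=> a b u v; rewrite /cx !mxE. Qed.
Lemma lin_cy : lin cy. Proof. by move=> a b u v; rewrite /cy !mxE. Qed.
Lemma lin_cz : lin cz. Proof. by move=> a b u v; rewrite /cz !mxE. Qed.

Lemma lin0 f : lin f -> f 0 = 0.
Proof. by move=> l; have := l 0 0 0 0; rewrite !scale0r addr0 !mul0r addr0. Qed.
Lemma linZ f a u : lin f -> f (a *: u) = a * f u.
Proof. by move=> l; have := l a 0 u 0; rewrite scale0r addr0 mul0r addr0. Qed.
Lemma linD f u v : lin f -> f (u + v) = f u + f v.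
Proof. by move=> l; have := l 1 1 u v; rewrite !scale1r !mul1r. Qed.
Lemma linN f u : lin f -> f (- u) = - f u.
Proof. by move=> l; rewrite -scaleN1r (linZ _ _ l) mulN1r. Qed.

Definition form_det h g z u v w : R :=
  h u * (g v * z w - g w * z v) - h v * (g u * z w - g w * z u) + h w * (g u * z v - g v * z u).

Definition coords h g z := [/\ lin h, lin g, lin z &
  exists2 k : R, k != 0 & forall u v w, form_det h g z u v w = k * det3 u v w].

Lemma coords_inj h g z x : coords h g z -> h x = 0 -> g x = 0 -> z x = 0 -> x = 0.
Proof.
move=> [_ _ _ [k k0 H]] hx gx zx.
have D u v : det3 x u v = 0.
  apply: (mulfI k0); rewrite -H /form_det hx gx zx; ring.
apply: vecP.
- by have := D (v3 0 1 0) (v3 0 0 1); rewrite det3E !(cxE, cyE, czE) /cx !mxE => <-; ring.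
- by have := D (v3 0 0 1) (v3 1 0 0); rewrite det3E !(cxE, cyE, czE) /cy !mxE => <-; ring.
- by have := D (v3 1 0 0) (v3 0 1 0); rewrite det3E !(cxE, cyE, czE) /cz !mxE => <-; ring.
Qed.

Lemma coords_cyc h g z : coords h g z -> coords g z h.
Proof.
move=> [l1 l2 l3 [k k0 H]]; split => //; exists k => // u v w.
by rewrite -H /form_det; ring.
Qed.

Lemma coords_eq h g z x y : coords h g z -> h x = h y -> g x = g y -> z x = z y -> x = y.
Proof.
move=> C hx gx zx; have [l1 l2 l3 _] := C.
apply/eqP; rewrite -subr_eq0; apply/eqP; apply: (coords_inj C);
  by rewrite linD // linN // ?hx ?gx ?zx subrr.
Qed.

Definition indep u v := forall a b : R, a *: u + b *: v = 0 -> a = 0 /\ b = 0.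

(** Cramer's rule in the coordinates [h] and [g]; the vanishing determinant takes care of [z]. *)
Lemma span_minor h g z u v w : coords h g z -> h u * g v - h v * g u != 0 ->
  form_det h g z u v w = 0 -> exists a b : R, w = a *: u + b *: v.
Proof.
move=> C m0 d0; have [l1 l2 l3 _] := C.
set m := h u * g v - h v * g u in m0.
exists ((h w * g v - h v * g w) / m), ((h u * g w - h w * g u) / m).
apply: (coords_eq C); rewrite ?l1 ?l2 ?l3.
- by rewrite /m; move: m0; rewrite /m => m0; field.
- by rewrite /m; move: m0; rewrite /m => m0; field.
- apply: (mulfI m0).
  set n1 := _ - _; set n2 := _ - _.
  have -> : m * (n1 / m * z u + n2 / m * z v) = n1 * z u + n2 * z v by field.
  by apply/eqP; rewrite -subr_eq0 -d0 /form_det /m /n1 /n2; apply/eqP; ring.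
Qed.

Lemma indep_minor h g z u v : coords h g z -> indep u v ->
  [\/ h u * g v - h v * g u != 0, g u * z v - g v * z u != 0 | z u * h v - z v * h u != 0].
Proof.
move=> C ind; have [l1 l2 l3 _] := C.
have [m1|] := eqVneq (h u * g v - h v * g u) 0; last by constructor 1.
have [m2|] := eqVneq (g u * z v - g v * z u) 0; last by constructor 2.
have [m3|] := eqVneq (z u * h v - z v * h u) 0; last by constructor 3.
(* If all minors vanish, then [f v *: u - f u *: v = 0] for every coordinate [f]. *)
have E f : f = h \/ f = g \/ f = z -> f v = 0 /\ - f u = 0.
  move=> fE; apply: ind; apply: (coords_inj C); rewrite ?l1 ?l2 ?l3.
  - by case: fE => [->|[->|->]]; [ring|rewrite -m1; ring|apply/eqP; rewrite -oppr_eq0 -m3; apply/eqP; ring].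
  - by case: fE => [->|[->|->]]; [apply/eqP; rewrite -oppr_eq0 -m1; apply/eqP; ring|ring|rewrite -m2; ring].
  - by case: fE => [->|[->|->]]; [rewrite -m3; ring|apply/eqP; rewrite -oppr_eq0 -m2; apply/eqP; ring|ring].
have [hv _] := E h (or_introl erefl).
have [gv _] := E g (or_intror (or_introl erefl)).
have [zv _] := E z (or_intror (or_intror erefl)).
have v0 : v = 0 by apply: (coords_inj C).
have [|_ /eqP] := ind 0 1; first by rewrite v0 scaler0 scale0r addr0.
by rewrite oner_eq0.
Qed.

Lemma form_det_span h g z u v w : coords h g z -> indep u v -> form_det h g z u v w = 0 ->
  exists a b : R, w = a *: u + b *: v.
Proof.
move=> C ind d0; have [m|m|m] := indep_minor C ind.
- exact: span_minor C m d0.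
- by apply: (span_minor (coords_cyc C) m); rewrite -d0 /form_det; ring.
- apply: (span_minor (coords_cyc (coords_cyc C)) m); by rewrite -d0 /form_det; ring.
Qed.

Lemma form_det_eq0 h g z (p q r : R) u v w : (p, q, r) <> (0, 0, 0) ->
  p * h u + q * g u + r * z u = 0 -> p * h v + q * g v + r * z v = 0 ->
  p * h w + q * g w + r * z w = 0 -> form_det h g z u v w = 0.
Proof.
move=> nz fu fv fw.
have Ep : p * form_det h g z u v w = 0.
  rewrite (_ : p * _ = (p * h u + q * g u + r * z u) * (g v * z w - g w * z v)
    - (p * h v + q * g v + r * z v) * (g u * z w - g w * z u)
    + (p * h w + q * g w + r * z w) * (g u * z v - g v * z u)); last by rewrite /form_det; ring.
  by rewrite fu fv fw; ring.
have Eq : q * form_det h g z u v w = 0.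
  rewrite (_ : q * _ = (p * h u + q * g u + r * z u) * (z v * h w - z w * h v)
    - (p * h v + q * g v + r * z v) * (z u * h w - z w * h u)
    + (p * h w + q * g w + r * z w) * (z u * h v - z v * h u)); last by rewrite /form_det; ring.
  by rewrite fu fv fw; ring.
have Er : r * form_det h g z u v w = 0.
  rewrite (_ : r * _ = (p * h u + q * g u + r * z u) * (h v * g w - h w * g v)
    - (p * h v + q * g v + r * z v) * (h u * g w - h w * g u)
    + (p * h w + q * g w + r * z w) * (h u * g v - h v * g u)); last by rewrite /form_det; ring.
  by rewrite fu fv fw; ring.
apply/eqP; apply: contraT => d0; case: nz.
have K (y : R) : y * form_det h g z u v w = 0 -> y = 0.
  by move/eqP; rewrite mulf_eq0 (negbTE d0) orbF => /eqP.
by rewrite (K _ Ep) (K _ Eq) (K _ Er).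
Qed.

(** Up to a positive factor this is a rotation about the axis [h = g = 0], so any half-space bounded
    by a plane through this axis can be written as [h > 0]. *)
Lemma coords_rot h g z (A B : R) : (A, B) <> (0, 0) -> coords h g z ->
  coords (fun x => A * h x + B * g x) (fun x => A * g x - B * h x) z.
Proof.
move=> AB [l1 l2 l3 [k k0 H]]; split => //.
- by move=> a b u v; rewrite l1 l2; ring.
- by move=> a b u v; rewrite l1 l2; ring.
exists ((A ^+ 2 + B ^+ 2) * k); last by move=> u v w; rewrite -mulrA -H /form_det; ring.
by rewrite mulf_neq0 // lt0r_neq0 // sum_sqr_gt0.
Qed.

Lemma coords_flip h g z : coords h g z -> coords h g (fun x => - z x).
Proof.
move=> [l1 l2 l3 [k k0 H]]; split => //.
- by move=> a b u v; rewrite l3; ring.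
by exists (- k); rewrite ?oppr_eq0 // => u v w; rewrite mulNr -H /form_det; ring.
Qed.
End Coordinates.

(** * Diagrams in linear coordinates *)

Section Diagram.
Variable R : realType.
Local Notation vec := (vec R).

(** The values of [(h, g)] at the two ends lie on one open ray, so the arc is on a meridian and
    avoids the axis [h = g = 0]. *)
Definition vertical (h g : vec -> R) u v :=
  h u * g v - h v * g u = 0 /\ 0 < h u * h v + g u * g v.
Definition slanted (z : vec -> R) (pl : seq vec) u v :=
  [/\ 0 < z u, 0 < z v & exists2 q, q \in pl & exists a b : R, q = a *: u + b *: v].
(** The open cone over an arc; the length of its points is forgotten. *)
Definition inner (u v x : vec) := exists a b : R, [/\ 0 < a, 0 < b & x = a *: u + b *: v].

(* Coordinates of a diagram whose poles are the common zero of [h] and [g], and the points [pl] of the plane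
   [z = 0]. *)
Record cdiag n (E : 'I_n -> bool -> vec) (pl : seq vec) (h g z : vec -> R) := CDiag {
  cd_coords : coords h g z;
  cd_nonempty : (0 < n)%N;
  cd_indep : forall a, indep (E a false) (E a true);
  cd_disj : forall a b x, a != b -> inner (E a false) (E a true) x ->
     inner (E b false) (E b true) x -> False;
  cd_block : forall a t, exists b, inner (E b false) (E b true) (E a t);
  cd_type : forall a, [\/ vertical h g (E a false) (E a true),
     slanted z pl (E a false) (E a true),
     slanted (fun x => - z x) pl (E a false) (E a true) |
     z (E a false) = 0 /\ z (E a true) = 0];
  cd_poles : forall q, q \in pl -> z q = 0 /\ (h q, g q) <> (0, 0) }.

Lemma cdiag_rot n (E : 'I_n -> bool -> vec) pl h g z (A B : R) : (A, B) <> (0, 0) ->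
  cdiag E pl h g z -> cdiag E pl (fun x => A * h x + B * g x) (fun x => A * g x - B * h x) z.
Proof.
move=> AB C; have AB2 := sum_sqr_gt0 AB.
split.
- exact: coords_rot (cd_coords C).
- exact: cd_nonempty C.
- exact: cd_indep C.
- exact: cd_disj C.
- exact: cd_block C.
- move=> a; have [[v1 v2]|s|s|e] := cd_type C a; [constructor 1|constructor 2|constructor 3|constructor 4] => //.
  split.
    set u := E a false in v1 v2 *; set v := E a true in v1 v2 *.
    rewrite (_ : _ - _ = (A ^+ 2 + B ^+ 2) * (h u * g v - h v * g u)); last by ring.
    by rewrite v1 mulr0.
  set u := E a false in v1 v2 *; set v := E a true in v1 v2 *.
  rewrite (_ : _ + _ = (A ^+ 2 + B ^+ 2) * (h u * h v + g u * g v)); last by ring.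
  exact: mulr_gt0.
- move=> q /(cd_poles C)[zq nq]; split => // -[e1 e2]; apply: nq.
  have Eh : (A ^+ 2 + B ^+ 2) * h q = 0.
    rewrite (_ : _ * _ = A * (A * h q + B * g q) - B * (A * g q - B * h q)); last by ring.
    by rewrite e1 e2; ring.
  have Eg : (A ^+ 2 + B ^+ 2) * g q = 0.
    rewrite (_ : _ * _ = B * (A * h q + B * g q) + A * (A * g q - B * h q)); last by ring.
    by rewrite e1 e2; ring.
  by move/eqP: Eh; move/eqP: Eg; rewrite !mulf_eq0 gt_eqF //= => /eqP -> /eqP ->.
Qed.

Lemma cdiag_flip n (E : 'I_n -> bool -> vec) pl h g z :
  cdiag E pl h g z -> cdiag E pl h g (fun x => - z x).
Proof.
move=> C; split.
- exact: coords_flip (cd_coords C).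
- exact: cd_nonempty C.
- exact: cd_indep C.
- exact: cd_disj C.
- exact: cd_block C.
- move=> a; have [v|s|s|[e1 e2]] := cd_type C a; [constructor 1|constructor 3|constructor 2|constructor 4] => //.
    by case: s => ? ? ?; split; rewrite ?opprK.
  by rewrite e1 e2 oppr0.
- by move=> q /(cd_poles C)[-> nq]; rewrite oppr0.
Qed.
End Diagram.

Lemma small_shift (R : realFieldType) (p q p' q' : R) : 0 < p -> 0 < q ->
  exists d, [/\ 0 < d, 0 < p + d * p' & 0 < q + d * q'].
Proof.
move=> p0 q0; pose d := Num.min p q / (1 + `|p'| + `|q'|).
have m0 : 0 < Num.min p q by rewrite lt_min p0.
have D0 : 0 < 1 + `|p'| + `|q'| by rewrite -addrA ltr_pwDl // addr_ge0.
have d0 : 0 < d by rewrite divr_gt0.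
have dE : d * (1 + `|p'| + `|q'|) = Num.min p q by rewrite divfK // gt_eqF.
have mp : Num.min p q <= p by rewrite ge_min lexx.
have mq : Num.min p q <= q by rewrite ge_min lexx orbT.
have np : - `|p'| <= p' by rewrite lerNl -normrN ler_norm.
have nq : - `|q'| <= q' by rewrite lerNl -normrN ler_norm.
have g1 : 0 <= `|p'| by []. have g2 : 0 <= `|q'| by [].
exists d; split => //.
- move: mp dE d0 np g1 g2; move: (`|p'|) (`|q'|) => P Q; clear; nra.
- move: mq dE d0 nq g1 g2; move: (`|p'|) (`|q'|) => P Q; clear; nra.
Qed.

Section DiagramLemmas.
Variable R : realType.
Local Notation vec := (vec R).
Variables (n : nat) (E : 'I_n -> bool -> vec) (pl : seq vec) (h g z : vec -> R).
Hypothesis C : cdiag E pl h g z.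
Implicit Types (a b c : 'I_n) (t s : bool) (e x y : vec).

Let co : coords h g z. Proof. exact: cd_coords C. Qed.
Let lh : lin h. Proof. by case: co. Qed.
Let lg : lin g. Proof. by case: co. Qed.
Let lz : lin z. Proof. by case: co. Qed.

Definition on_arc b x := inner (E b false) (E b true) x.
Definition bracket (u v : vec) := h u * g v - h v * g u.
Definition vert b := vertical h g (E b false) (E b true).
Definition north b := slanted z pl (E b false) (E b true).

Lemma on_arcP b t x : on_arc b x -> inner (E b t) (E b (~~ t)) x.
Proof.
case: t => //= -[p [q [p0 q0 ->]]]; exists q, p; split => //; exact: addrC.
Qed.

Lemma inner_on_arc b t x : inner (E b t) (E b (~~ t)) x -> on_arc b x.
Proof.
case: t => //= -[p [q [p0 q0 ->]]]; exists q, p; split => //; exact: addrC.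
Qed.

Lemma indep_end b t : indep (E b t) (E b (~~ t)).
Proof.
case: t => /=; last exact: (cd_indep C).
by move=> p q; rewrite addrC => /(cd_indep C)[].
Qed.

(** If [a] ended inside [b] and lay in the plane of [b], the points of [a] near this end would be
    inside [b] as well. *)
Lemma no_span_hit a b t : on_arc b (E a t) ->
  (exists p q : R, E a (~~ t) = p *: E b false + q *: E b true) -> False.
Proof.
move=> [p [q [p0 q0 Ee]]] [p' [q' Ew]].
have [ab|ab] := eqVneq a b.
  rewrite -{}ab in Ee; case: t Ee {Ew} => Ee.
    have [|/eqP] := @cd_indep _ _ _ _ _ _ _ C a p (q - 1); last by rewrite gt_eqF.
    by rewrite scalerBl scale1r addrA -Ee subrr.
  have [|_ /eqP] := @cd_indep _ _ _ _ _ _ _ C a (p - 1) q; last by rewrite gt_eqF.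
  by rewrite scalerBl scale1r addrAC -Ee subrr.
have [d [d0 d1 d2]] := small_shift p' q' p0 q0.
apply: (cd_disj C ab (x := E a t + d *: E a (~~ t))).
  by apply: (@inner_on_arc _ t); exists 1, d; rewrite scale1r.
exists (p + d * p'), (q + d * q'); split => //.
by rewrite Ew Ee !scalerDr !scalerDl !scalerA addrACA.
Qed.

Lemma plane_hit a b t (A B G : R) : on_arc b (E a t) -> (A, B, G) <> (0, 0, 0) ->
  (forall s, A * h (E b s) + B * g (E b s) + G * z (E b s) = 0) ->
  A * h (E a (~~ t)) + B * g (E a (~~ t)) + G * z (E a (~~ t)) = 0 -> False.
Proof.
move=> on nz fb fa; apply: (no_span_hit on).
apply: (form_det_span co (cd_indep C (a:=b))).
by apply: (form_det_eq0 nz).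
Qed.
Lemma pos_block b e : on_arc b e -> 0 < z e -> vert b \/ north b.
Proof.
move=> [p [q [p0 q0 ->]]]; rewrite lz => ze.
have [v|s|[s1 s2 _]|[e1 e2]] := cd_type C b; [by left|by right|exfalso|exfalso].
  move: s1 s2; rewrite !oppr_gt0 => s1 s2; move: ze.
  by rewrite ltNge ltW // -[ltRHS]addr0 ltrD // pmulr_rlt0.
by move: ze; rewrite e1 e2 !mulr0 addr0 ltxx.
Qed.

Lemma lexmax (P : pred ('I_n * bool)) (F G : 'I_n * bool -> R) : (exists i, P i) ->
  exists2 i, P i & forall j, P j -> F j < F i \/ (F j = F i /\ G j <= G i).
Proof.
move=> [i0 Pi0]; case: (@arg_maxP _ _ _ i0 P F Pi0) => i1 Pi1 mx1.
pose P2 i := P i && (F i == F i1).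
have P2i1 : P2 i1 by rewrite /P2 Pi1 eqxx.
case: (@arg_maxP _ _ _ i1 P2 G P2i1) => i /andP[Pi /eqP Fi] mx2.
exists i => // j Pj; rewrite Fi.
have : F j <= F i1 by exact: mx1.
rewrite le_eqVlt => /predU1P[E1|lt]; last by left.
by right; split => //; apply: mx2; rewrite /P2 Pj E1 eqxx.
Qed.

(* A lexicographic maximum in the chart [z = 1] is an extreme point of the convex hull. *)
Lemma lexmax_not_inner (b : 'I_n) e (f : vec -> R) : lin f ->
  (forall x, f x = 0 -> h x = 0 -> z x = 0 -> x = 0) -> on_arc b e ->
  0 < z (E b false) -> 0 < z (E b true) ->
  (forall s, let v := E b s in
     h v / z v < h e / z e \/ (h v / z v = h e / z e /\ f v / z v <= f e / z e)) -> False.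
Proof.
move=> lf inj [p [q [p0 q0 Ee]]] zu zv mx.
have ze : 0 < z e by rewrite Ee lz addr_gt0 // mulr_gt0.
have key (k : vec -> R) : lin k -> (forall s, k (E b s) / z (E b s) <= k e / z e) ->
    forall s, k (E b s) / z (E b s) = k e / z e.
  move=> lk le; have [r rE] : exists r, r = k e / z e by exists (k e / z e).
  rewrite -rE in le *.
  have dk s : k (E b s) - r * z (E b s) <= 0.
    by rewrite subr_le0 -ler_pdivrMr ?le //; case: (s).
  have : p * (k (E b false) - r * z (E b false)) + q * (k (E b true) - r * z (E b true)) = 0.
    apply: (@eq_trans _ _ (k e - r * z e)); first by rewrite Ee lk lz; ring.
    by rewrite rE divfK ?gt_eqF // subrr.
  have d1 := dk false; have d2 := dk true.
  move=> sum0.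
  have e1 : k (E b false) - r * z (E b false) = 0.
    apply/eqP; rewrite eq_le d1 /= leNgt; apply/negP => lt.
    have : p * (k (E b false) - r * z (E b false)) + q * (k (E b true) - r * z (E b true)) < 0.
      by rewrite ltr_nwDl // ?pmulr_rlt0 // pmulr_rle0.
    by rewrite sum0 ltxx.
  move: sum0; rewrite e1 mulr0 add0r => /eqP; rewrite mulf_eq0 gt_eqF //= => /eqP e2.
  by case; apply/(canLR (mulfK _)); rewrite ?gt_eqF //; apply: subr0_eq.
have hE : forall s, h (E b s) / z (E b s) = h e / z e.
  by apply: key => // s; case: (mx s) => [/ltW|[->]].
have fE : forall s, f (E b s) / z (E b s) = f e / z e.
  by apply: key => // s; case: (mx s) => [|[]//]; rewrite hE ltxx.
have eqr (k : vec -> R) : (forall s, k (E b s) / z (E b s) = k e / z e) ->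
    k (E b false) * z (E b true) = k (E b true) * z (E b false).
  by move=> kE; apply/eqP; rewrite -eqr_div ?lt0r_neq0 // !kE.
have [|/eqP] := @cd_indep _ _ _ _ _ _ _ C b (z (E b true)) (- z (E b false)); last by rewrite gt_eqF.
apply: inj; rewrite ?lh ?lf ?lz.
- by apply: (@eq_trans _ _ (f (E b false) * z (E b true) - f (E b true) * z (E b false))); [ring|rewrite eqr ?subrr].
- by apply: (@eq_trans _ _ (h (E b false) * z (E b true) - h (E b true) * z (E b false))); [ring|rewrite eqr ?subrr].
- ring.
Qed.

End DiagramLemmas.

Section DiagramPositions.
Variable R : realType.
Local Notation vec := (vec R).
Variables (n : nat) (E : 'I_n -> bool -> vec) (pl : seq vec) (h g z : vec -> R).
Hypothesis C : cdiag E pl h g z.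
Implicit Types (a b c : 'I_n) (t s : bool) (e x y : vec).
Local Notation on_arc := (on_arc E).
Local Notation bracket := (bracket h g).
Local Notation vert := (vert E h g).
Local Notation north := (north E pl z).

Let co : coords h g z. Proof. exact: cd_coords C. Qed.
Let lh : lin h. Proof. by case: co. Qed.
Let lg : lin g. Proof. by case: co. Qed.
Let lz : lin z. Proof. by case: co. Qed.

Let chart_inj x : g x = 0 -> h x = 0 -> z x = 0 -> x = 0.
Proof. by move=> ? ? ?; apply: (coords_inj co). Qed.

Lemma vert_dir b e : vert b -> on_arc b e ->
  forall s, exists2 k, 0 < k & h (E b s) = k * h e /\ g (E b s) = k * g e.
Proof.
move=> [v0 vp] [p [q [p0 q0 ->]]] s.
set u := E b false in v0 vp *; set v := E b true in v0 vp *.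
have N0 : 0 < h u ^+ 2 + g u ^+ 2.
  by apply: sum_sqr_gt0 => -[a0 b0]; move: vp; rewrite a0 b0 !mul0r addr0 ltxx.
pose l := (h u * h v + g u * g v) / (h u ^+ 2 + g u ^+ 2).
have l0 : 0 < l by rewrite divr_gt0.
have hv : h v = l * h u.
  apply: (mulIf (lt0r_neq0 N0)); rewrite mulrAC /l divfK ?gt_eqF //.
  apply/eqP; rewrite -subr_eq0; apply/eqP.
  rewrite (_ : _ - _ = - g u * (h u * g v - h v * g u)); last by ring.
  by rewrite v0 mulr0.
have gv : g v = l * g u.
  apply: (mulIf (lt0r_neq0 N0)); rewrite mulrAC /l divfK ?gt_eqF //.
  apply/eqP; rewrite -subr_eq0; apply/eqP.
  rewrite (_ : _ - _ = h u * (h u * g v - h v * g u)); last by ring.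
  by rewrite v0 mulr0.
clearbody l.
have pl0 : 0 < p + q * l by rewrite addr_gt0 // mulr_gt0.
have hk f : lin f -> f v = l * f u -> f (p *: u + q *: v) = (p + q * l) * f u.
  by move=> lf fv; rewrite lf fv; ring.
case: s; [exists (l / (p + q * l))|exists (p + q * l)^-1].
- exact: divr_gt0.
- by rewrite (hk h lh hv) (hk g lg gv) -/v hv gv !mulrA divfK ?lt0r_neq0.
- by rewrite invr_gt0.
- by rewrite (hk h lh hv) (hk g lg gv) !mulrA mulVf ?lt0r_neq0 // !mul1r.
Qed.

Lemma vert_nz b e : vert b -> on_arc b e -> (h e, g e) <> (0, 0).
Proof.
move=> vb on [he ge]; have [k _ [hk _]] := vert_dir vb on false.
have [k' _ [_ gk]] := vert_dir vb on false.
by case: vb => _; rewrite hk gk he ge !mulr0 !mul0r addr0 ltxx.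
Qed.

(** The end [E b t] is the one towards increasing [z], nearer to the pole on the side [z > 0]: once
    scaled to a common value of [(h, g)], it has a larger [z] than [e], and the other end a smaller
    one. *)
Lemma vert_ends b e : vert b -> on_arc b e -> exists t k k',
  [/\ 0 < k, h (E b t) = k * h e, g (E b t) = k * g e & k * z e < z (E b t)] /\
  [/\ 0 < k', h (E b (~~ t)) = k' * h e, g (E b (~~ t)) = k' * g e & z (E b (~~ t)) < k' * z e].
Proof.
move=> vb on; have [k0 k00 [h0 g0]] := vert_dir vb on false.
have [k1 k10 [h1 g1]] := vert_dir vb on true.
have [p [q [p0 q0 Ee]]] := on.
set u := E b false in h0 g0 Ee *; set v := E b true in h1 g1 Ee *.
have nz := vert_nz vb on.
have pq : p * k0 + q * k1 = 1.
  have H f : lin f -> f u = k0 * f e -> f v = k1 * f e -> (p * k0 + q * k1 - 1) * f e = 0.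
    by move=> lf fu fv; rewrite mulrBl mul1r mulrDl -!mulrA -fu -fv -lf -Ee subrr.
  apply/eqP; rewrite -subr_eq0; apply/negPn/negP => ne; apply: nz.
  have /eqP := H h lh h0 h1; have /eqP := H g lg g0 g1.
  by rewrite !mulf_eq0 (negbTE ne) /= => /eqP -> /eqP ->.
have zz : p * (z u - k0 * z e) + q * (z v - k1 * z e) = 0.
  rewrite !mulrBr addrACA -lz -Ee -opprD !mulrA -mulrDl pq mul1r; exact: subrr.
have [lt|gt|eq] := ltgtP (z u) (k0 * z e).
- have : 0 < z v - k1 * z e.
    rewrite -(pmulr_rgt0 _ q0) -[ltRHS](addKr (p * (z u - k0 * z e))) zz addr0.
    by rewrite oppr_gt0 pmulr_rlt0 // subr_lt0.
  by rewrite subr_gt0 => gt; exists true, k1, k0.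
- have : z v - k1 * z e < 0.
    rewrite -(pmulr_rlt0 _ q0) -[ltLHS](addKr (p * (z u - k0 * z e))) zz addr0.
    by rewrite oppr_lt0 pmulr_rgt0 // subr_gt0.
  by rewrite subr_lt0 => lt; exists false, k0, k1.
exfalso; move: zz; rewrite eq subrr mulr0 add0r => /eqP; rewrite mulf_eq0 gt_eqF //= subr_eq0 => /eqP zv.
have [|/eqP] := @cd_indep _ _ _ _ _ _ _ C b k1 (- k0); last by rewrite gt_eqF.
apply: chart_inj; rewrite ?lh ?lg ?lz -/u -/v ?h0 ?h1 ?g0 ?g1 ?eq ?zv; ring.
Qed.

Lemma blocked a t : exists b, on_arc b (E a t).
Proof. exact: cd_block C a t. Qed.

(** Otherwise all ends lie in [z <= 0]. An end on the equator would be inside an equatorial arc,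
    which would itself end inside an equatorial arc, in its own plane. So all ends lie in [z < 0],
    where an extreme one cannot be blocked. *)
Lemma ex_pos : exists i : 'I_n * bool, 0 < z (E i.1 i.2).
Proof.
apply: contrapT => no.
have neg a t : z (E a t) <= 0.
  by rewrite leNgt; apply/negP => ?; apply: no; exists (a, t).
have both b e : on_arc b e -> z e = 0 -> forall s, z (E b s) = 0.
  move=> [p [q [p0 q0 ->]]]; rewrite lz => ze.
  have u0 : z (E b false) = 0.
    apply/eqP; rewrite eq_le neg /= leNgt; apply/negP => lt.
    have : p * z (E b false) + q * z (E b true) < 0 by rewrite ltr_nwDl ?pmulr_rlt0 ?pmulr_rle0.
    by rewrite ze ltxx.
  move: ze; rewrite u0 mulr0 add0r => /eqP; rewrite mulf_eq0 gt_eqF //= => /eqP v0.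
  by case.
have sneg a t : 0 < - z (E a t).
  rewrite oppr_gt0 lt_neqAle neg andbT; apply/eqP => z0.
  have [b on] := blocked a t; have zb := both _ _ on z0.
  have [c onc] := blocked b false; have zc := both _ _ onc (zb _).
  apply: (plane_hit C (A := 0) (B := 0) (G := 1) onc); first by case=> /eqP; rewrite oner_eq0.
    by move=> s; rewrite zc; ring.
  by rewrite zb; ring.
have [i0 _ mx] := lexmax (P := predT) (fun i => h (E i.1 i.2) / - z (E i.1 i.2))
  (fun i => g (E i.1 i.2) / - z (E i.1 i.2)) (ex_intro _ (Ordinal (cd_nonempty C), true) isT).
have [b on] := blocked i0.1 i0.2.
apply: (lexmax_not_inner (cdiag_flip C) lg _ on (sneg _ _) (sneg _ _)).
  by move=> x gx hx /eqP; rewrite oppr_eq0 => /eqP; apply: chart_inj.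
by move=> s; apply: (mx (b, s)).
Qed.
End DiagramPositions.

(** * Number of arcs *)

Lemma neg_ratio_lt (R : realFieldType) (p u v k : R) : 0 < u -> 0 < v -> p < 0 -> k * u < v ->
  p / u < k * p / v.
Proof.
move=> u0 v0 p0 kuv; rewrite ltr_pdivrMr //.
have -> : k * p / v * u = p * (k * u / v) by ring.
have : k * u / v < 1 by rewrite ltr_pdivrMr // mul1r.
by move: (k * u / v) => q q1; rewrite -[ltLHS]mulr1 ltr_nM2l.
Qed.

Section Count.
Variable R : realType.
Local Notation vec := (vec R).
Variables (n : nat) (E : 'I_n -> bool -> vec) (pl : seq vec) (h g z : vec -> R).
Hypothesis C : cdiag E pl h g z.
Implicit Types (a b c : 'I_n) (t s : bool) (e x y : vec).
Local Notation on_arc := (on_arc E).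
Local Notation bracket := (bracket h g).
Local Notation vert := (vert E h g).
Local Notation north := (north E pl z).
Local Notation form_det := (form_det h g z).

Let co : coords h g z. Proof. exact: cd_coords C. Qed.
Let lh : lin h. Proof. by case: co. Qed.
Let lg : lin g. Proof. by case: co. Qed.
Let lz : lin z. Proof. by case: co. Qed.

(** The end [e] with the largest [h / z] is extreme, so it is inside a vertical arc [b], not a
    slanted one. If [h e < 0], the end of [b] nearer to the pole would have a larger ratio. If
    [h e = 0], that end would be inside an arc of the plane [h = 0], which also contains [b]. *)
Lemma exists_vert : exists b e, [/\ vert b, on_arc b e, 0 < z e & 0 < h e].
Proof.
have [i zi mx] := lexmax (fun i => h (E i.1 i.2) / z (E i.1 i.2))
  (fun i => g (E i.1 i.2) / z (E i.1 i.2)) (ex_pos C).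
set e := E i.1 i.2 in zi mx.
have [b on] := blocked C i.1 i.2; rewrite -/e in on.
have [vb|[zu zv _]] := pos_block C on zi; last first.
  exfalso; apply: (lexmax_not_inner C lg _ on zu zv).
    by move=> x *; apply: (coords_inj co).
  by move=> s; apply: (mx (b, s)); case: s.
exists b, e; split => //.
have [t [k [k' [[k0 hy gy zy] [k'0 hy' gy' zy']]]]] := vert_ends C vb on.
have zy0 : 0 < z (E b t) by apply: lt_trans zy; apply: mulr_gt0.
have [he|he|he] := ltgtP (h e) 0 => //.
  have : h e / z e < h (E b t) / z (E b t).
    by rewrite hy; apply: neg_ratio_lt.
  by move=> lt; have /= := mx (b, t) zy0 => -[gt|[E1 _]]; move: lt; rewrite ?E1 ?ltxx // ltNge ltW.
have hy0 : h (E b t) = 0 by rewrite hy he mulr0.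
have [c onc] := blocked C b t.
suff hc s : h (E c s) = 0.
  exfalso; apply: (plane_hit C (A := 1) (B := 0) (G := 0) onc).
  - by case=> /eqP; rewrite oner_eq0.
  - by move=> s; rewrite hc; ring.
  - by rewrite hy' he; ring.
have [vc|[zu zv _]] := pos_block C onc zy0.
  by have [l _ [-> _]] := vert_dir C vc onc s; rewrite hy0 mulr0.
have le0 s' : h (E c s') <= 0.
  have zs : 0 < z (E c s') by case: s'.
  rewrite -[leLHS](divfK (lt0r_neq0 zs)) pmulr_lle0 //.
  by have := mx (c, s') zs; rewrite he mul0r /= => -[/ltW|[->]].
have [p [q [p0 q0 Ey]]] := onc; move: hy0; rewrite Ey lh => sum0.
have P u v (w w' : R) : 0 < u -> 0 < v -> w <= 0 -> w' <= 0 -> u * w + v * w' = 0 -> w = 0.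
  move=> u0 v0 w0 w'0 S0; apply/eqP; rewrite eq_le w0 /= leNgt; apply/negP => lt.
  have : u * w + v * w' < 0 by rewrite ltr_nwDl // ?pmulr_rlt0 // pmulr_rle0.
  by rewrite S0 ltxx.
case: s; [apply: (P q p _ (h (E c false)))|apply: (P p q _ (h (E c true)))] => //.
by rewrite addrC.
Qed.

Lemma vert_ray b e e' : vert b -> on_arc b e -> on_arc b e' ->
  exists2 k, 0 < k & h e' = k * h e /\ g e' = k * g e.
Proof.
move=> vb on on'; have [k k0 [h1 g1]] := vert_dir C vb on false.
have [k' k'0 [h2 g2]] := vert_dir C vb on' false.
exists (k / k'); first exact: divr_gt0.
have k'n := lt0r_neq0 k'0.
by split; apply: (mulfI k'n); rewrite mulrA [k' * (k / k')]mulrC divfK // -?h2 -?g2 ?h1 ?g1.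
Qed.

Lemma bracket_anti x y : bracket x y = - bracket y x.
Proof. by rewrite /bracket; ring. Qed.
Lemma bracket_xx x : bracket x x = 0.
Proof. by rewrite /bracket; ring. Qed.
Lemma bracket_scale x y w k : h y = k * h x -> g y = k * g x -> bracket w y = k * bracket w x.
Proof. by rewrite /bracket => -> ->; ring. Qed.
Lemma bracket_linr x y w (p q : R) : bracket w (p *: x + q *: y) = p * bracket w x + q * bracket w y.
Proof. by rewrite /bracket lh lg; ring. Qed.
Lemma bracket_linl x y w (p q : R) : bracket (p *: x + q *: y) w = p * bracket x w + q * bracket y w.
Proof. by rewrite /bracket lh lg; ring. Qed.

(** Seen from the pole, such an arc turns by an angle strictly between 0 and pi; a slanted arc on a
    meridian circle does not. *)
Definition nondeg c := north c /\ bracket (E c false) (E c true) != 0.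
Definition ccw c := 0 < bracket (E c false) (E c true).
Definition cw_end c := E c (~~ ccw c).
Definition ccw_end c := E c (ccw c).
Definition crosses c x := exists y k, [/\ on_arc c y, 0 < k, h y = k * h x & g y = k * g x].

Lemma ends_gt0 c : nondeg c -> 0 < bracket (cw_end c) (ccw_end c).
Proof.
move=> [_ nz]; rewrite /cw_end /ccw_end; case: (boolP (ccw c)) => [//|].
by rewrite /= bracket_anti oppr_gt0 /ccw -leNgt le_eqVlt (negbTE nz).
Qed.

Lemma on_arc_ends c x : on_arc c x -> inner (cw_end c) (ccw_end c) x.
Proof. by move=> on; have := on_arcP (~~ ccw c) on; rewrite negbK. Qed.

Lemma ends_on_arc c x : inner (cw_end c) (ccw_end c) x -> on_arc c x.
Proof. by move=> on; apply: (@inner_on_arc _ _ _ _ (~~ ccw c)); rewrite negbK. Qed.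

Lemma crosses_gt0 c x : nondeg c -> crosses c x -> 0 < bracket (cw_end c) x /\ 0 < bracket x (ccw_end c).
Proof.
move=> /ends_gt0 nc [y [k [/on_arc_ends[p [q [p0 q0 Ey]]] k0 hy gy]]].
have E1 := bracket_scale (cw_end c) hy gy; have E2 := bracket_scale (ccw_end c) hy gy.
split.
  by rewrite -(pmulr_rgt0 _ k0) -E1 Ey bracket_linr bracket_xx mulr0 add0r pmulr_rgt0.
by rewrite bracket_anti -(pmulr_rgt0 _ k0) mulrN -E2 Ey bracket_linr bracket_xx mulr0 addr0 -mulrN -bracket_anti pmulr_rgt0.
Qed.

(** An arc through [E b t] lying in a plane through the axis would be in the plane of [b], as
    [E b t] is off the axis. *)
Lemma cover b t : bracket (E b false) (E b true) = 0 -> (h (E b t), g (E b t)) <> (0, 0) ->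
  0 < z (E b t) -> exists2 c, nondeg c & on_arc c (E b t).
Proof.
move=> b0 nz zy; have [c on] := blocked C b t; exists c => //.
have cn : bracket (E c false) (E c true) != 0.
  apply/eqP => c0; apply: (plane_hit C (A := g (E b t)) (B := - h (E b t)) (G := 0) on).
  - by case=> e1 /eqP; rewrite oppr_eq0 => /eqP e2; apply: nz; rewrite e1 e2.
  - move=> s; have [p [q [p0 q0 Ey]]] := on.
    apply: (@eq_trans _ _ (bracket (E c s) (E b t))); first by rewrite /bracket; ring.
    rewrite Ey bracket_linr; case: s; rewrite ?bracket_xx ?c0 ?(bracket_anti (E c true)) ?c0; ring.
  - apply: (@eq_trans _ _ (bracket (E b (~~ t)) (E b t))); first by rewrite /bracket; ring.
    by case: (t); rewrite /= ?b0 // bracket_anti b0 oppr0.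
split => //; have [[v0 _]|//] := pos_block C on zy.
by move: cn; rewrite /bracket v0 eqxx.
Qed.

Lemma nondeg_ray c t : nondeg c -> (h (E c t), g (E c t)) <> (0, 0).
Proof.
move=> [_ nz] [h0 g0]; move: nz; rewrite /bracket.
by case: t h0 g0 => -> ->; rewrite !(mul0r, mulr0) subrr eqxx.
Qed.

(* In the second case the end of [a] lies on a vertical arc [b] whose end nearer to the pole lies on [c]. *)
Definition leads_to a t c := on_arc c (E a t) \/ exists b s k k',
  [/\ vert b, on_arc b (E a t) & on_arc c (E b s)] /\
  [/\ 0 < k, h (E b s) = k * h (E a t), g (E b s) = k * g (E a t) & k * z (E a t) < z (E b s)] /\
  [/\ 0 < k', h (E b (~~ s)) = k' * h (E a t), g (E b (~~ s)) = k' * g (E a t)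
    & z (E b (~~ s)) < k' * z (E a t)].

Lemma leads_to_crosses a t c : leads_to a t c -> crosses c (E a t).
Proof.
case=> [on|[b [s [k [k' [[_ _ on] [[k0 hy gy _] _]]]]]]].
  by exists (E a t), 1; rewrite !mul1r.
by exists (E b s), k.
Qed.

Lemma nondeg_north c t : nondeg c -> 0 < z (E c t).
Proof. by case=> [[z0 z1 _] _]; case: t. Qed.

(** The exception is a slanted arc on a meridian circle that is not vertical: it reaches or crosses
    the axis [h = g = 0]. *)
Lemma leads_to_exists a t : nondeg a ->
  (exists2 c, nondeg c & leads_to a t c) \/
  exists b, [/\ north b, ~ vert b, bracket (E b false) (E b true) = 0 & on_arc b (E a t)].
Proof.
move=> na; have zx := nondeg_north t na; have nz := nondeg_ray (t := t) na.
have [b on] := blocked C a t.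
have [vb|nv] := EM (vert b); last first.
  have nb : north b by case: (pos_block C on zx).
  have [b0|b0] := eqVneq (bracket (E b false) (E b true)) 0; first by right; exists b.
  by left; exists b => //; left.
left; have [s [k [k' [[k0 hy gy zy] H2]]]] := vert_ends C vb on.
have [||c nc onc] := @cover b s vb.1.
- rewrite hy gy => -[/eqP e1 /eqP e2]; apply: nz; move: e1 e2.
  by rewrite !mulf_eq0 gt_eqF //= => /eqP -> /eqP ->.
- by apply: lt_trans zy; apply: mulr_gt0.
by exists c => //; right; exists b, s, k, k'.
Qed.

Lemma crosses_exists a t : nondeg a -> exists2 c, nondeg c & crosses c (E a t).
Proof.
move=> na; have [[c nc /leads_to_crosses]|[b [nb _ b0 on]]] := leads_to_exists t na.
  by exists c.
have nz := nondeg_ray (t := t) na.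
have zb s : 0 < z (E b s) by case: nb; case: s.
have [p [q [p0 q0 Ey]]] := on.
have par s : bracket (E b s) (E a t) = 0.
  rewrite Ey bracket_linr; case: s; rewrite ?bracket_xx ?b0 ?(bracket_anti (E b true)) ?b0; ring.
set x := E a t in nz on Ey par *.
pose N := h x ^+ 2 + g x ^+ 2.
have N0 : 0 < N by apply: sum_sqr_gt0.
(* This inner product finds the end of [b] on the same side of the axis as [x]: since [x] is a
   positive combination of the ends, [i] is positive at one of them. That end is on the meridian of
   [x], where [cover] applies. *)
pose i s := h (E b s) * h x + g (E b s) * g x.
have [s si] : exists s, 0 < i s.
  have sum : p * i false + q * i true = N.
    rewrite /i /N; set u := E b false; set v := E b true.
    apply: (@eq_trans _ _ ((p * h u + q * h v) * h x + (p * g u + q * g v) * g x)); first by ring.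
    by rewrite -lh -lg -Ey !expr2.
  case: (ltP 0 (i false)) => i0; first by exists false.
  exists true; rewrite ltNge; apply/negP => i1.
  suff : N <= 0 by rewrite leNgt N0.
  by rewrite -sum -[leRHS]addr0 lerD // pmulr_rle0.
have hs : h (E b s) = i s / N * h x.
  apply: (mulIf (lt0r_neq0 N0)); rewrite mulrAC divfK ?lt0r_neq0 // /i /N.
  apply/eqP; rewrite -subr_eq0; apply/eqP.
  apply: (@eq_trans _ _ (g x * bracket (E b s) x)); first by rewrite /bracket; ring.
  by rewrite par mulr0.
have gs : g (E b s) = i s / N * g x.
  apply: (mulIf (lt0r_neq0 N0)); rewrite mulrAC divfK ?lt0r_neq0 // /i /N.
  apply/eqP; rewrite -subr_eq0; apply/eqP.
  apply: (@eq_trans _ _ (- h x * bracket (E b s) x)); first by rewrite /bracket; ring.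
  by rewrite par mulr0.
have k0 : 0 < i s / N by apply: divr_gt0.
have [|c nc onc] := @cover b s b0 _ (zb s).
  by rewrite hs gs => -[e1 e2]; apply: nz; congr (_, _); apply: (mulfI (lt0r_neq0 k0)); rewrite mulr0.
by exists c => //; exists (E b s), (i s / N).
Qed.

Lemma nondeg_exists : exists c, nondeg c.
Proof.
have [b [e [vb on ze he]]] := exists_vert.
have [s [k [k' [[k0 hy gy zy] _]]]] := vert_ends C vb on.
have [||c nc _] := @cover b s vb.1; last by exists c.
- by rewrite hy => -[/eqP]; rewrite gt_eqF // mulr_gt0.
- by apply: lt_trans zy; apply: mulr_gt0.
Qed.

(** Each step advances the counterclockwise end by an angle strictly between 0 and pi, so neither
    one nor two steps return to the start. *)
Lemma three_nondeg : exists a b c, [/\ nondeg a, nondeg b & nondeg c] /\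
  [/\ crosses b (ccw_end a), crosses c (ccw_end b) & uniq [:: a; b; c]].
Proof.
have [a na] := nondeg_exists.
have [b nb ab] := crosses_exists (ccw a) na.
have [c nc bc] := crosses_exists (ccw b) nb.
exists a, b, c; split => //; split => //=.
have [_ ab2] := crosses_gt0 nb ab; have [_ bc2] := crosses_gt0 nc bc.
rewrite !inE negb_or !andbT -andbA; apply/and3P; split; apply/eqP => X.
- by move: ab2; rewrite X bracket_xx ltxx.
- by move: ab2 bc2; rewrite -/(ccw_end b) -/(ccw_end a) X bracket_anti oppr_gt0 => /lt_trans H /H; rewrite ltxx.
- by move: bc2; rewrite X bracket_xx ltxx.
Qed.
End Count.

(** * Hits from the inside and from the outside *)

Section Occlusion.
Variable R : realType.
Local Notation vec := (vec R).
Variables (n : nat) (E : 'I_n -> bool -> vec) (pl : seq vec) (h g z : vec -> R).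
Hypothesis C : cdiag E pl h g z.
Implicit Types (a b c : 'I_n) (t s : bool) (e x y : vec).
Local Notation on_arc := (on_arc E).
Local Notation bracket := (bracket h g).
Local Notation vert := (vert E h g).
Local Notation north := (north E pl z).
Local Notation nondeg := (nondeg E pl h g z).
Local Notation crosses := (crosses E h g).
Local Notation leads_to := (leads_to E h g z).
Local Notation ccw := (ccw E h g).
Local Notation cw_end := (cw_end E h g).
Local Notation ccw_end := (ccw_end E h g).

Let co : coords h g z. Proof. exact: cd_coords C. Qed.
Let lh : lin h. Proof. by case: co. Qed.
Let lg : lin g. Proof. by case: co. Qed.
Let lz : lin z. Proof. by case: co. Qed.

Definition same_side := forall c b t b' t', on_arc c (E b t) -> on_arc c (E b' t') ->
  0 < form_det h g z (E c false) (E c true) (E b (~~ t)) * form_det h g z (E c false) (E c true) (E b' (~~ t')).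

(** For a nondegenerate [c] it is positive on the side of the pole, the inside: by [side_shift] it
    grows with [z] over a fixed meridian. *)
Definition side c x := form_det h g z (cw_end c) (ccw_end c) x.
Definition hit_in c := exists b t, on_arc c (E b t) /\ 0 < side c (E b (~~ t)).
Definition hit_out c := exists b t, on_arc c (E b t) /\ side c (E b (~~ t)) < 0.

Lemma same_side_excl c : same_side -> hit_in c -> hit_out c -> False.
Proof.
move=> ss [b [t [on s1]]] [b' [t' [on' s2]]].
have := ss _ _ _ _ _ on on'; move: s1 s2; rewrite /side /cw_end /ccw_end.
case: (ccw c) => /= s1 s2; last first.
  have N x : form_det h g z (E c true) (E c false) x = - form_det h g z (E c false) (E c true) x.
    by rewrite /form_det; ring.
  move: s1 s2; rewrite !N oppr_gt0 oppr_lt0 => s1 s2.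
  by rewrite nmulr_rgt0 // ltNge ltW.
by rewrite pmulr_rgt0 // ltNge ltW.
Qed.

Lemma side_lin c x y (p q : R) : side c (p *: x + q *: y) = p * side c x + q * side c y.
Proof. by rewrite /side /form_det lh lg lz; ring. Qed.

Lemma side_shift c x y k : h y = k * h x -> g y = k * g x ->
  side c y = k * side c x + bracket (cw_end c) (ccw_end c) * (z y - k * z x).
Proof. by rewrite /side /form_det /bracket => -> ->; ring. Qed.

Lemma side_on c x : on_arc c x -> side c x = 0.
Proof.
by move=> /on_arc_ends H; case: (H h g) => p [q [p0 q0 ->]]; rewrite side_lin /side /form_det; ring.
Qed.

(** Both [x] and the other end of [b] are on the meridian of [E b s], farther from the pole, hence
    outside [c]. *)
Lemma via_out c x b s k k' : nondeg c -> on_arc c (E b s) ->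
  [/\ 0 < k, h (E b s) = k * h x, g (E b s) = k * g x & k * z x < z (E b s)] ->
  [/\ 0 < k', h (E b (~~ s)) = k' * h x, g (E b (~~ s)) = k' * g x
    & z (E b (~~ s)) < k' * z x] -> side c x < 0 /\ hit_out c.
Proof.
move=> nc on [k0 hy gy zy] [k'0 hy' gy' zy']; have B0 := ends_gt0 nc.
have sx : side c x < 0.
  rewrite -(pmulr_rlt0 _ k0); have := side_shift c hy gy; rewrite side_on // => /eqP.
  by rewrite eq_sym addr_eq0 => /eqP ->; rewrite oppr_lt0 mulr_gt0 // subr_gt0.
split => //; exists b, s; split => //.
by rewrite (side_shift c hy' gy') -[ltRHS]addr0 ltrD ?pmulr_rlt0 // subr_lt0.
Qed.

(** By Cramer's rule [w] is the point of the plane of [a] on the meridian of [y]. As [y] is on the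
    plane of [c] and outside [a], the point [w] is nearer to the pole than [y], so inside [c]. *)
Lemma cramer_side a c y : nondeg a -> nondeg c -> crosses a y ->
  let x1 := cw_end a in let x2 := ccw_end a in
  side c y = 0 -> side a y < 0 -> 0 < bracket y x2 * side c x1 + bracket x1 y * side c x2.
Proof.
move=> na nc ca x1 x2 scy say; have A0 := ends_gt0 na; have B0 := ends_gt0 nc.
rewrite -/x1 -/x2 in A0.
pose w := bracket y x2 *: x1 + bracket x1 y *: x2.
have hw : h w = bracket x1 x2 * h y by rewrite /w lh /bracket; ring.
have gw : g w = bracket x1 x2 * g y by rewrite /w lg /bracket; ring.
rewrite -side_lin -/w (side_shift c hw gw) scy mulr0 add0r mulr_gt0 //.
have := side_shift a hw gw; rewrite {1}/w side_lin.
have -> : side a x1 = 0 by rewrite /side /form_det -/x1 -/x2; ring.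
have -> : side a x2 = 0 by rewrite /side /form_det -/x1 -/x2; ring.
rewrite !mulr0 addr0 -/x1 -/x2 -mulrDr => /eqP; rewrite eq_sym mulf_eq0 gt_eqF //= addrC addr_eq0.
by move=> /eqP ->; rewrite oppr_gt0.
Qed.

(* On their common range of meridians the two arcs do not cross, so one stays nearer to the pole: the other one
   is reached from inside at one end of the range, and through a vertical arc at the other. *)
Lemma in_out_alternate a c : nondeg a -> nondeg c ->
  leads_to a (ccw a) c -> leads_to c (~~ ccw c) a ->
  (hit_in c /\ hit_out a) \/ (hit_in a /\ hit_out c).
Proof.
move=> na nc ac ca.
have [cx1 cx2] := crosses_gt0 C nc (leads_to_crosses ac).
have [ay1 ay2] := crosses_gt0 C na (leads_to_crosses ca).
have cr1 := leads_to_crosses ac; have cr2 := leads_to_crosses ca.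
have A0 := ends_gt0 na; have B0 := ends_gt0 nc.
rewrite -/(ccw_end a) in cx1 cx2 cr1; rewrite -/(cw_end c) in ay1 ay2 cr2.
set x1 := cw_end a in ay1 A0 *; set x2 := ccw_end a in cx1 cx2 ay2 cr1 A0 *.
set y1 := cw_end c in cx1 ay1 ay2 cr2 B0 *; set y2 := ccw_end c in cx2 B0 *.
have sc1 : side c y1 = 0 by rewrite /side /form_det -/y1; ring.
have sc2 : side c y2 = 0 by rewrite /side /form_det -/y2; ring.
have sa1 : side a x1 = 0 by rewrite /side /form_det -/x1; ring.
have sa2 : side a x2 = 0 by rewrite /side /form_det -/x2; ring.
case: ac => [on|[b [s [k [k' [[_ _ on] [H1 H2]]]]]]];
case: ca => [on'|[b' [s' [l [l' [[_ _ on'] [H1' H2']]]]]]].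
(* Two direct hits would put both arcs in one plane. *)
- exfalso; apply: (no_span_hit C on).
  have [p [q [p0 q0 Ey]]] := on_arc_ends h g on'.
  have [p' [q' [p'0 q'0 Ex]]] := on_arc_ends h g on.
  rewrite -/(cw_end c) -/(ccw_end c) -/y1 -/y2 in Ex; rewrite -/(ccw_end a) -/x2 in Ex.
  rewrite -/(cw_end a) -/(ccw_end a) -/x1 -/x2 -/(cw_end c) -/y1 in Ey.
  have K : exists r r', x1 = r *: y1 + r' *: y2.
    exists (p^-1 * (1 - q * p')), (- (p^-1 * q * q')).
    have pn := lt0r_neq0 p0.
    have KK (f : vec -> R) : lin f -> f x1 = f (p^-1 * (1 - q * p') *: y1 + - (p^-1 * q * q') *: y2).
      move=> lf; have e1 : f y1 = p * f x1 + q * f x2 by rewrite -lf -Ey.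
      have e2 : f x2 = p' * f y1 + q' * f y2 by rewrite -lf -Ex.
      rewrite lf; apply: (mulfI pn).
      have -> : p * (p^-1 * (1 - q * p') * f y1 + - (p^-1 * q * q') * f y2)
        = f y1 - q * (p' * f y1 + q' * f y2) by field.
      by rewrite -e2 e1; ring.
    by apply: (coords_eq co); apply: KK.
  have [r [r' E1]] := K; rewrite -/(cw_end a) -/x1 E1 /y1 /y2 /cw_end /ccw_end.
  by case: (ccw c); [exists r, r'|exists r', r; rewrite addrC].
(* Here [a] itself ends on [c], coming from the inside, and the vertical arc that blocks [c] ends on
   [a], coming from the outside. *)
- left; have [sa oa] := via_out na on' H1' H2'; split => //.
  exists a, (ccw a); split => //; rewrite -/(cw_end a) -/x1.
  have := cramer_side na nc cr2 sc1 sa; rewrite -/x1 -/x2.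
  by rewrite (side_on on) mulr0 addr0 pmulr_rgt0.
- right; have [sc oc] := via_out nc on H1 H2; split => //.
  exists c, (~~ ccw c); split => //; rewrite negbK -/(ccw_end c) -/y2.
  have := cramer_side nc na cr1 sa2 sc; rewrite -/y1 -/y2.
  by rewrite (side_on on') mulr0 add0r pmulr_rgt0.
(* Each arc would be outside the other at one end of the common range, so they would cross. The
   crossing point [r] is the combination of two points of [a] on which [side c] vanishes. *)
- exfalso; have [sa _] := via_out na on' H1' H2'; have [sc _] := via_out nc on H1 H2.
  have S0 := cramer_side na nc cr2 sc1 sa; rewrite -/x1 -/x2 -side_lin in S0.
  set w := _ + _ in S0; rewrite -/(ccw_end a) -/x2 in sc; rewrite -/(cw_end c) -/y1 in sa.
  pose r := side c w *: x2 + (- side c x2) *: w.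
  have r0 : side c r = 0 by rewrite side_lin; ring.
  have ca : a != c.
    by apply/eqP => X; move: sc; rewrite /x2 X sc2 ltxx.
  have inda : on_arc a r.
    apply: (@ends_on_arc _ _ _ h g); exists (- side c x2 * bracket y1 x2), (side c w - side c x2 * bracket x1 y1).
    have N0 : 0 < - side c x2 by rewrite oppr_gt0.
    split; first exact: mulr_gt0.
      by rewrite addr_gt0 // -mulNr mulr_gt0.
    by rewrite -/x1 -/x2; apply: (coords_eq co); rewrite /r ?(lh, lg, lz); ring.
  have [p [q Er]] : exists p q : R, r = p *: y1 + q *: y2.
    apply: (form_det_span co) r0 => p q; rewrite -/(cw_end c) -/(ccw_end c).
    rewrite /cw_end /ccw_end; have := @indep_end _ _ _ _ _ _ _ C c (~~ ccw c) p q.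
    by rewrite negbK.
  have E1 : bracket y1 r = q * bracket y1 y2 by rewrite Er (bracket_linr C) bracket_xx mulr0 add0r.
  have E2 : bracket r y2 = p * bracket y1 y2 by rewrite Er (bracket_linl C) bracket_xx mulr0 addr0.
  have hw : h w = bracket x1 x2 * h y1 by rewrite /w lh /bracket; ring.
  have gw : g w = bracket x1 x2 * g y1 by rewrite /w lg /bracket; ring.
  have ww : bracket y1 w = 0 by rewrite (bracket_scale _ hw gw) bracket_xx mulr0.
  have w2 : 0 < bracket w y2.
    by rewrite bracket_anti (bracket_scale _ hw gw) -mulrN -bracket_anti mulr_gt0.
  apply: (cd_disj C ca inda); apply: (@ends_on_arc _ _ _ h g); exists p, q; split => //.
    rewrite -(pmulr_lgt0 _ B0) -E2 /r (bracket_linl C) addr_gt0 ?mulr_gt0 // oppr_gt0 //.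
  rewrite -(pmulr_lgt0 _ B0) -E1 /r (bracket_linr C) ww mulr0 addr0 mulr_gt0 //.
Qed.
End Occlusion.

Section FourNorth.
Variable R : realType.
Local Notation vec := (vec R).
Variables (n : nat) (E : 'I_n -> bool -> vec) (pl : seq vec) (h g z : vec -> R).
Hypothesis C : cdiag E pl h g z.
Implicit Types (a b c : 'I_n) (t s : bool) (e x y : vec).
Local Notation on_arc := (on_arc E).
Local Notation vert := (vert E h g).
Local Notation north := (north E pl z).
Local Notation nondeg := (nondeg E pl h g z).
Local Notation crosses := (crosses E h g).
Local Notation leads_to := (leads_to E h g z).
Local Notation ccw := (ccw E h g).

Let lh : lin h. Proof. by case: (cd_coords C). Qed.
Let lg : lin g. Proof. by case: (cd_coords C). Qed.

Lemma nondeg_not_vert a : nondeg a -> ~ vert a.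
Proof. by move=> [_ nz] [v0 _]; rewrite /bracket v0 eqxx in nz. Qed.

Lemma crosses_asym a c t s : nondeg a -> nondeg c -> t = ccw a -> s = ccw c ->
  crosses c (E a t) -> crosses a (E c s) -> False.
Proof.
move=> na nc -> -> ac ca.
have [_ X] := crosses_gt0 C nc ac; have [_ Y] := crosses_gt0 C na ca.
by move: X; rewrite bracket_anti oppr_gt0 => X; have := lt_trans X Y; rewrite ltxx.
Qed.

Lemma crosses_asym_cw a c : nondeg a -> nondeg c ->
  crosses c (E a (~~ ccw a)) -> crosses a (E c (~~ ccw c)) -> False.
Proof.
move=> na nc ac ca.
have [X _] := crosses_gt0 C nc ac; have [Y _] := crosses_gt0 C na ca.
by move: X; rewrite bracket_anti oppr_gt0 => X; have := lt_trans X Y; rewrite ltxx.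
Qed.

Lemma crosses_irr a t : nondeg a -> ~ crosses a (E a t).
Proof.
move=> na hz_det; have [X Y] := crosses_gt0 C na hz_det.
have [E1|E1] := eqVneq t (ccw a).
  by move: Y; rewrite E1 bracket_xx ltxx.
have {}E1 : t = ~~ ccw a by move: E1; case: (t); case: (ccw a).
by move: X; rewrite E1 bracket_xx ltxx.
Qed.

Lemma crosses_trans b c x : (forall t, crosses c (E b t)) -> crosses b x -> crosses c x.
Proof.
move=> cb [y [k [[p [q [p0 q0 Ey]]] k0 hy gy]]].
have [y1 [k1 [[p1 [q1 [p10 q10 Ey1]]] k10 hy1 gy1]]] := cb false.
have [y2 [k2 [[p2 [q2 [p20 q20 Ey2]]] k20 hy2 gy2]]] := cb true.
have [k1n k2n] := (lt0r_neq0 k10, lt0r_neq0 k20).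
exists ((p / k1) *: y1 + (q / k2) *: y2), k; split => //.
- exists (p / k1 * p1 + q / k2 * p2), (p / k1 * q1 + q / k2 * q2); split.
  + by rewrite addr_gt0 // mulr_gt0 // divr_gt0.
  + by rewrite addr_gt0 // mulr_gt0 // divr_gt0.
  by rewrite Ey1 Ey2 !scalerDr !scalerDl !scalerA addrACA.
- by rewrite -hy Ey !lh hy1 hy2 !mulrA !divfK.
- by rewrite -gy Ey !lg gy1 gy2 !mulrA !divfK.
Qed.

(** If there are only three, all are nondegenerate and their counterclockwise ends lead around a
    cycle. The clockwise ends do too: if in the same direction, each arc lies over the range of the
    next one, which is absurd around a cycle; if in the opposite direction, [in_out_alternate]
    applies to the three pairs. *)
Lemma four_north : same_side E h g z ->
  exists s : seq 'I_n, [/\ size s = 4%N, uniq s & forall a, a \in s -> north a /\ ~ vert a].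
Proof.
move=> ss; apply: contrapT => no.
have L (s : seq 'I_n) : size s = 3%N -> uniq s -> (forall a, a \in s -> nondeg a) ->
    forall d, north d -> ~ vert d -> d \in s.
  move=> s3 us ns d nd vd; apply: contrapT => /negP ds; apply: no; exists (d :: s).
  rewrite /= s3 ds us; split => // a; rewrite inE => /predU1P[->//|/ns na].
  by split; [case: na|apply: nondeg_not_vert].
have leads (s : seq 'I_n) t d : size s = 3%N -> uniq s -> (forall a, a \in s -> nondeg a) ->
    nondeg d -> exists c, [/\ c \in s, nondeg c & leads_to d t c].
  move=> s3 us ns nd; have H := L s s3 us ns.
  have [[c nc dc]|[b [nb vb b0 _]]] := leads_to_exists C t nd.
    by exists c; split => //; apply: H; [case: nc|apply: nondeg_not_vert].
  by have := ns _ (H _ nb vb) => -[_]; rewrite b0 eqxx.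
have [a [b0 [c0 [[na0 nb0 nc0] [_ _ u0]]]]] := three_nondeg C.
have ns0 : forall d, d \in [:: a; b0; c0] -> nondeg d.
  by move=> d; rewrite !inE => /or3P[] /eqP ->.
have next d : nondeg d -> exists2 c, nondeg c & leads_to d (ccw d) c.
  by move=> nd; have [c [_ ? ?]] := leads [:: a; b0; c0] (ccw d) d erefl u0 ns0 nd; exists c.
have [b nb lab] := next _ na0; have [c nc lbc] := next _ nb.
have neq d (e : 'I_n) : nondeg e -> leads_to d (ccw d) e -> d != e.
  by move=> ne le; apply/eqP => X; apply: (crosses_irr (t := ccw d) ne); rewrite -{1}X;
     have := leads_to_crosses le; rewrite X.
have ab := neq _ _ nb lab; have bc := neq _ _ nc lbc.
have ac : a != c.
  apply/eqP => X; rewrite -X in lbc.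
  by apply: (crosses_asym nb na0 erefl erefl (leads_to_crosses lbc) (leads_to_crosses lab)).
have u : uniq [:: a; b; c] by rewrite /= !inE negb_or ab ac bc.
have ns : forall d, d \in [:: a; b; c] -> nondeg d.
  by move=> d; rewrite !inE => /or3P[] /eqP ->.
have lca : leads_to c (ccw c) a.
  have [d [ds nd lcd]] := leads [:: a; b; c] (ccw c) c erefl u ns nc.
  move: ds; rewrite !inE => /or3P[] /eqP X; rewrite {}X in lcd nd; first by [].
    case: (crosses_asym nc nb erefl erefl (leads_to_crosses lcd) (leads_to_crosses lbc)).
  by have := neq _ _ nd lcd; rewrite eqxx.
have tau d : nondeg d -> exists e : 'I_n, [/\ e \in [:: a; b; c], e != d & leads_to d (~~ ccw d) e].
  move=> nd; have [e [es ne le]] := leads [:: a; b; c] (~~ ccw d) d erefl u ns nd.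
  exists e; split => //; apply/eqP => X; apply: (crosses_irr (t := ~~ ccw d) nd).
  by have := leads_to_crosses le; rewrite X.
have [ta [ta1 ta2 la]] := tau a na0.
have [tb [tb1 tb2 lb]] := tau b nb.
have [tc [tc1 tc2 lc]] := tau c nc.
have X := leads_to_crosses la; have Y := leads_to_crosses lb; have Z := leads_to_crosses lc.
have cab := leads_to_crosses lab; have cbc := leads_to_crosses lbc; have cca := leads_to_crosses lca.
have alt := in_out_alternate C; have ex := same_side_excl ss.
move: ta1 ta2; rewrite !inE => /or3P[] /eqP Ea ta2; rewrite Ea ?eqxx // in ta2 X la.
  move: tb1 tb2; rewrite !inE => /or3P[] /eqP Eb tb2; rewrite Eb ?eqxx // in tb2 Y lb.
    exact: (crosses_asym_cw na0 nb X Y).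
  move: tc1 tc2; rewrite !inE => /or3P[] /eqP Ec tc2; rewrite Ec ?eqxx // in tc2 Z lc; last first.
    exact: (crosses_asym_cw nb nc Y Z).
  have both d (e : 'I_n) : crosses e (E d (ccw d)) -> crosses e (E d (~~ ccw d)) -> forall t, crosses e (E d t).
    by case: (ccw d) => /= H1 H2 [].
  have c1 := both _ _ cab X; have c2 := both _ _ cbc Y; have c3 := both _ _ cca Z.
  apply: (crosses_irr (t := true) na0).
  by apply: (crosses_trans c3); apply: (crosses_trans c2); exact: c1.
move: tc1 tc2; rewrite !inE => /or3P[] /eqP Ec tc2; rewrite Ec ?eqxx // in tc2 Z lc.
  exact: (crosses_asym_cw na0 nc X Z).
move: tb1 tb2; rewrite !inE => /or3P[] /eqP Eb tb2; rewrite Eb ?eqxx // in tb2 Y lb; last first.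
  exact: (crosses_asym_cw nb nc Y Z).
by case: (alt _ _ na0 nb lab lb) => -[i1 o1]; case: (alt _ _ nb nc lbc lc) => -[idx2 o2];
  case: (alt _ _ nc na0 lca la) => -[i3 o3];
  first [exact: (ex _ i1 o2)|exact: (ex _ idx2 o1)|exact: (ex _ idx2 o3)|exact: (ex _ i3 o2)
        |exact: (ex _ i3 o1)|exact: (ex _ i1 o3)].
Qed.
End FourNorth.

Section Counting.
Variable R : realType.
Local Notation vec := (vec R).

Lemma vert_rot n (E : 'I_n -> bool -> vec) (h g : vec -> R) (A B : R) b : (A, B) <> (0, 0) ->
  vert E (fun x => A * h x + B * g x) (fun x => A * g x - B * h x) b -> vert E h g b.
Proof.
move=> AB; have AB2 := sum_sqr_gt0 AB.
rewrite /vert /vertical; set u := E b false; set v := E b true; move=> /= [v0 v1]; split.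
  have E0 : (A ^+ 2 + B ^+ 2) * (h u * g v - h v * g u) = 0 by rewrite -[RHS]v0; ring.
  by apply: (mulfI (lt0r_neq0 AB2)); rewrite E0 mulr0.
have E1 : (A ^+ 2 + B ^+ 2) * (h u * h v + g u * g v) =
  (A * h u + B * g u) * (A * h v + B * g v) + (A * g u - B * h u) * (A * g v - B * h v) by ring.
by rewrite -(pmulr_rgt0 _ AB2) E1.
Qed.

(** The second and third half-spaces are the two sides of the meridian plane of a point [x] of the
    first arc, so the three arcs are distinct. *)
Lemma three_vert n (E : 'I_n -> bool -> vec) pl (h g z : vec -> R) : cdiag E pl h g z ->
  exists s : seq 'I_n, [/\ size s = 3%N, uniq s & forall a, a \in s -> vert E h g a].
Proof.
move=> C; have [a [x [va ona _ hx]]] := exists_vert C.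
have nz1 : (- g x, h x) <> (0, 0) by case=> _ /eqP; rewrite gt_eqF.
have nz2 : (g x, - h x) <> (0, 0) by case=> _ /eqP; rewrite oppr_eq0 gt_eqF.
have [b [y [vb onb _ hy]]] := exists_vert (cdiag_rot nz1 C).
have [c [w [vc onc _ hw]]] := exists_vert (cdiag_rot nz2 C).
have {}vb := vert_rot nz1 vb; have {}vc := vert_rot nz2 vc.
exists [:: a; b; c]; split => //; last first.
  by move=> d; rewrite !inE => /or3P[] /eqP ->.
rewrite /= !inE negb_or !andbT -andbA; apply/and3P; split; apply/eqP => X.
- rewrite -X in onb; have [k _ [h1 g1]] := vert_ray C va ona onb.
  by move: hy; rewrite h1 g1 (_ : _ + _ = 0) ?ltxx //; ring.
- rewrite -X in onc; have [k _ [h1 g1]] := vert_ray C va ona onc.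
  by move: hw; rewrite h1 g1 (_ : _ + _ = 0) ?ltxx //; ring.
- rewrite -X in onc; have [k k0 [h1 g1]] := vert_ray C vb onb onc.
  move: hw; rewrite h1 g1 (_ : _ + _ = - (k * (- g x * h y + h x * g y))); last by ring.
  by rewrite oppr_gt0 pmulr_rlt0 // ltNge ltW.
Qed.

Lemma uniq_size_ord n (s : seq 'I_n) : uniq s -> (size s <= n)%N.
Proof. by move=> /card_uniqP <-; rewrite -[leqRHS]card_ord max_card. Qed.

Lemma count_arcs n (E : 'I_n -> bool -> vec) pl (h g z : vec -> R) (s1 s2 : seq 'I_n) :
  cdiag E pl h g z -> uniq s1 -> uniq s2 ->
  (forall a, a \in s1 -> north E pl z a /\ ~ vert E h g a) ->
  (forall a, a \in s2 -> north E pl (fun x => - z x) a /\ ~ vert E h g a) ->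
  (3 + size s1 + size s2 <= n)%N.
Proof.
move=> C u1 u2 n1 n2; have [s0 [<- u0 n0]] := three_vert C.
rewrite -!size_cat -catA; apply: uniq_size_ord; rewrite !cat_uniq u0 u1 u2 /= andbT.
apply/andP; split; apply/hasPn => a.
  rewrite mem_cat => /orP[/n1[_ nv]|/n2[_ nv]]; apply/negP => /n0; exact: nv.
move=> /n2[[z0 _ _] _]; apply/negP => /n1[[z1 _ _] _].
by move: z0; rewrite oppr_gt0 => /lt_trans/(_ z1); rewrite ltxx.
Qed.

Lemma nine_arcs n (E : 'I_n -> bool -> vec) pl (h g z : vec -> R) :
  cdiag E pl h g z -> (9 <= n)%N.
Proof.
move=> C; have [a [b [c [[na nb nc] [_ _ u]]]]] := three_nondeg C.
have [a' [b' [c' [[na' nb' nc'] [_ _ u']]]]] := three_nondeg (cdiag_flip C).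
apply: (count_arcs C u u') => d; rewrite !inE => /or3P[] /eqP ->; split;
  by [apply: nondeg_not_vert; eassumption | case: na | case: nb | case: nc | case: na' | case: nb' | case: nc'].
Qed.

Lemma eleven_arcs n (E : 'I_n -> bool -> vec) pl (h g z : vec -> R) :
  cdiag E pl h g z -> same_side E h g z -> (11 <= n)%N.
Proof.
move=> C ss; have [s [sz u ns]] := four_north C ss.
have ss' : same_side E h g (fun x => - z x).
  move=> c b t b' t' on on'; have := ss c b t b' t' on on'.
  have N u0 v w : form_det h g (fun x => - z x) u0 v w = - form_det h g z u0 v w by rewrite /form_det; ring.
  by rewrite !N mulrNN.
have [s' [sz' u' ns']] := four_north (cdiag_flip C) ss'.
by have := count_arcs C u u' ns ns'; rewrite sz sz'.
Qed.
End Counting.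

(** * Swirls in a wedge *)

(** In the plane, the sector from [u] to [v] meets the open quadrant. A direction [(1 - r, r)] is in
    the sector once it is on the right side of those among [u] and [v] that are in the quadrant. *)
Lemma sector_quadrant (R : realFieldType) (hu zu hv zv h0 z0 r : R) :
  0 < hu * zv - hv * zu -> 0 < h0 -> 0 < z0 -> 0 < hu * z0 - h0 * zu -> 0 < h0 * zv - hv * z0 ->
  0 < r -> r < 1 ->
  (0 < hu -> 0 < zu -> zu < r * (hu + zu)) -> (0 < hv -> 0 < zv -> r * (hv + zv) < zv) ->
  0 < hu * r - (1 - r) * zu /\ 0 < (1 - r) * zv - hv * r.
Proof.
move=> D h00 z00 A B r0 r1 Hu Hv.
have s0 : 0 < 1 - r by rewrite subr_gt0.
have Cu : (0 < hu /\ 0 < zu) \/ (hu <= 0 /\ zu < 0) \/ (0 < hu /\ zu <= 0).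
  case: (ltrP 0 hu) => hu0; case: (ltrP 0 zu) => zu0; [by left| by right; right| |right; left].
    by exfalso; move: A; clear -h00 z00 hu0 zu0; nra.
  by split=> //; clear -A h00 z00 hu0 zu0; nra.
have Cv : (0 < hv /\ 0 < zv) \/ (hv < 0 /\ zv <= 0) \/ (hv <= 0 /\ 0 < zv).
  case: (ltrP 0 zv) => zv0; case: (ltrP 0 hv) => hv0; [by left| by right; right| |right; left].
    by exfalso; move: B; clear -h00 z00 hv0 zv0; nra.
  by split=> //; clear -B h00 z00 hv0 zv0; nra.
have Eh : (hu * zv - hv * zu) * h0 = hu * (h0 * zv - hv * z0) + hv * (hu * z0 - h0 * zu) by ring.
have Ez : (hu * zv - hv * zu) * z0 = zu * (h0 * zv - hv * z0) + zv * (hu * z0 - h0 * zu) by ring.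
have Dh := mulr_gt0 D h00; have Dz := mulr_gt0 D z00.
set be := hu * r - (1 - r) * zu; set al := (1 - r) * zv - hv * r.
have E1 : hu * al = (1 - r) * (hu * zv - hv * zu) - hv * be by rewrite /al /be; ring.
have E2 : zv * be = r * (hu * zv - hv * zu) - zu * al by rewrite /al /be; ring.
have be0 : 0 < hu -> 0 < zu -> 0 < be by move=> u0 u1; have := Hu u0 u1; rewrite /be; clear; lra.
have al0 : 0 < hv -> 0 < zv -> 0 < al by move=> u0 u1; have := Hv u0 u1; rewrite /al; clear; lra.
have bad (x y p q : R) : x <= 0 -> y <= 0 -> 0 < p -> 0 < q -> 0 < x * p + y * q -> False.
  move=> x0 y0 p0 q0; rewrite ltNge => /negP; apply.
  by rewrite -[leRHS]addr0 lerD // pmulr_lle0.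
have be1 : 0 < hu -> zu <= 0 -> 0 < be.
  by move=> u0 u1; rewrite /be ltr_pwDl ?mulr_gt0 // oppr_ge0 pmulr_rle0.
have al1 : 0 < zv -> hv <= 0 -> 0 < al.
  by move=> u0 u1; rewrite /al ltr_pwDl ?mulr_gt0 // oppr_ge0 pmulr_lle0.
case: Cu => [[hu0 zu0]|[[hu0 zu0]|[hu0 zu0]]]; case: Cv => [[hv0 zv0]|[[hv0 zv0]|[hv0 zv0]]];
  try by split; auto.
- have b0 := be0 hu0 zu0; split => //.
  by rewrite -(pmulr_rgt0 _ hu0) E1 ltr_wpDr ?mulr_gt0 // oppr_ge0 pmulr_lle0 // ltW.
- have a0 := al0 hv0 zv0; split => //.
  by rewrite -(pmulr_rgt0 _ zv0) E2 ltr_wpDr ?mulr_gt0 // oppr_ge0 pmulr_lle0 // ltW.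
- by exfalso; rewrite Eh in Dh; apply: (bad _ _ _ _ _ _ B A Dh) => //; apply: ltW.
- by exfalso; rewrite Eh in Dh; apply: (bad _ _ _ _ _ _ B A Dh).
- by exfalso; rewrite Ez in Dz; apply: (bad _ _ _ _ _ _ B A Dz).
Qed.

Lemma chart_lt (R : realFieldType) (hu zu hv zv : R) : 0 < hu + zu -> 0 < hv + zv ->
  (zu / (hu + zu) < zv / (hv + zv)) = (0 < hu * zv - hv * zu).
Proof.
move=> u0 v0; rewrite ltr_pdivrMr // mulrAC ltr_pdivlMr // -subr_gt0.
by congr (0 < _); ring.
Qed.

Section Wedge.
Variable R : realType.
Local Notation vec := (vec R).
Variables (n : nat) (E : 'I_n -> bool -> vec) (pl : seq vec) (h g z : vec -> R).
Hypothesis C : cdiag E pl h g z.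
Hypothesis hpl : forall q, q \in pl -> h q != 0.
Implicit Types (a b c : 'I_n) (t s : bool) (e x y : vec).
Local Notation on_arc := (on_arc E).

Let co : coords h g z. Proof. exact: cd_coords C. Qed.
Let lh : lin h. Proof. by case: co. Qed.
Let lg : lin g. Proof. by case: co. Qed.
Let lz : lin z. Proof. by case: co. Qed.

Definition hz_det (u v : vec) : R := h u * z v - h v * z u.
Definition meets a := exists x, [/\ on_arc a x, 0 < h x & 0 < z x].

Lemma meets_type a : meets a -> (forall s, 0 < h (E a s)) /\ vert E h g a \/ north E pl z a.
Proof.
move=> [x [on hx zx]]; have [va|na] := pos_block C on zx; [left|by right].
by split => // s; have [k k0 [-> _]] := vert_dir C va on s; apply: mulr_gt0.
Qed.

(** So the arc is a graph over the height in the chart. A slanted arc of constant height would have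
    its pole at [h = z = 0], against [hpl]. *)
Lemma hz_det_neq0 a : meets a -> hz_det (E a false) (E a true) != 0.
Proof.
move=> ma; apply/eqP => D0; have [[hp [v0 _]]|[z0 z1 [q ql [p [p' Eq]]]]] := meets_type ma.
  have [|/eqP] := @cd_indep _ _ _ _ _ _ _ C a (h (E a true)) (- h (E a false)); last by rewrite gt_eqF.
  apply: (coords_inj co); rewrite ?lh ?lg ?lz.
  - by ring.
  - by rewrite -[RHS]oppr0 -v0; ring.
  - by rewrite -[RHS]oppr0 -D0 /hz_det; ring.
have zq : p * z (E a false) + p' * z (E a true) = 0 by rewrite -lz -Eq; case: (cd_poles C ql).
have := hpl ql; rewrite Eq lh; apply/negP/negPn.
have -> : (p * h (E a false) + p' * h (E a true) == 0) =
  ((p * h (E a false) + p' * h (E a true)) * z (E a true) == 0).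
  by rewrite mulf_eq0 (gt_eqF z1) orbF.
rewrite (_ : _ * _ = h (E a true) * (p * z (E a false) + p' * z (E a true)) + p * hz_det (E a false) (E a true)).
  by rewrite zq D0 !mulr0 addr0.
by rewrite /hz_det; ring.
Qed.

Definition upper_side a := 0 < hz_det (E a false) (E a true).
Definition upper_end a := E a (upper_side a).
Definition lower_end a := E a (~~ upper_side a).

Lemma hz_det_ends a : meets a -> 0 < hz_det (lower_end a) (upper_end a).
Proof.
move=> /hz_det_neq0 nz; rewrite /lower_end /upper_end; case: (boolP (upper_side a)) => //=.
by rewrite /upper_side -leNgt le_eqVlt (negbTE nz) /= /hz_det => lt0; rewrite -oppr_lt0 opprB.
Qed.

Lemma on_arc_lt a x : on_arc a x -> inner (lower_end a) (upper_end a) x.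
Proof. by move=> on; have := on_arcP (~~ upper_side a) on; rewrite negbK. Qed.

Lemma lt_on_arc a x : inner (lower_end a) (upper_end a) x -> on_arc a x.
Proof. by move=> on; apply: (@inner_on_arc _ _ _ _ (~~ upper_side a)); rewrite negbK. Qed.

Definition in_wedge x := (0 < h x) && (0 < z x).
Definition chart_x x := z x / (h x + z x).
(** If the lower end is outside the wedge, the arc comes in through the floor, whence the value [0];
    likewise [1] for the ceiling. *)
Definition chart_lo a := if in_wedge (lower_end a) then chart_x (lower_end a) else 0.
Definition chart_hi a := if in_wedge (upper_end a) then chart_x (upper_end a) else 1.
(** Cramer's rule for the equation of the plane of [a] in [plane_eq]; at [h = 1 - x], [z = x] it
    reads [g = icp + slp * x]. *)
Definition chart_icp a := (g (lower_end a) * z (upper_end a) - g (upper_end a) * z (lower_end a)) / hz_det (lower_end a) (upper_end a).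
Definition chart_slp a := (h (lower_end a) * g (upper_end a) - h (upper_end a) * g (lower_end a)) / hz_det (lower_end a) (upper_end a) - chart_icp a.

Lemma plane_eq a (p q : R) x : meets a -> x = p *: lower_end a + q *: upper_end a ->
  g x = chart_icp a * h x + (chart_icp a + chart_slp a) * z x.
Proof.
move=> /hz_det_ends/lt0r_neq0 c0 ->; rewrite lh lg lz /chart_slp addrCA subrr addr0 /chart_icp.
by move: c0; rewrite /hz_det => c0; field.
Qed.

Lemma in_wedge_sum x : in_wedge x -> 0 < h x + z x.
Proof. by move=> /andP[hx zx]; apply: addr_gt0. Qed.

Lemma chart_x_bounds x : in_wedge x -> 0 < chart_x x < 1.
Proof.
move=> Qx; have s0 := in_wedge_sum Qx; case/andP: Qx => hx zx.
by rewrite divr_gt0 //= ltr_pdivrMr // mul1r ltrDr.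
Qed.

Lemma chart_pos a (p q : R) x : meets a -> x = p *: lower_end a + q *: upper_end a -> in_wedge x ->
  chart_icp a + chart_slp a * chart_x x = g x / (h x + z x).
Proof.
move=> ma Ex Qx; rewrite (plane_eq ma Ex) /chart_x; have := lt0r_neq0 (in_wedge_sum Qx) => s0.
by field.
Qed.

Lemma on_arc_hz_det a x : meets a -> on_arc a x -> 0 < hz_det (lower_end a) x /\ 0 < hz_det x (upper_end a).
Proof.
move=> ma /on_arc_lt[p [q [p0 q0 Ex]]]; have c0 := hz_det_ends ma.
have -> : hz_det (lower_end a) x = q * hz_det (lower_end a) (upper_end a) by rewrite Ex /hz_det lh lz; ring.
have -> : hz_det x (upper_end a) = p * hz_det (lower_end a) (upper_end a) by rewrite Ex /hz_det lh lz; ring.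
by rewrite !mulr_gt0.
Qed.

Lemma alive_on_arc a x : on_arc a x -> in_wedge x -> chart_lo a < chart_x x < chart_hi a.
Proof.
move=> on Qx; have /andP[r0 r1] := chart_x_bounds Qx.
have ma : meets a by case/andP: Qx => hx zx; exists x.
have [c1 c2] := on_arc_hz_det ma on; have sx := in_wedge_sum Qx.
apply/andP; split.
  by rewrite /chart_lo; case: ifP => // Ql; rewrite /chart_x chart_lt // in_wedge_sum.
by rewrite /chart_hi; case: ifP => // Ql; rewrite /chart_x chart_lt // in_wedge_sum.
Qed.

Lemma chart_lo_ge0 a : 0 <= chart_lo a.
Proof. by rewrite /chart_lo; case: ifP => // /chart_x_bounds/andP[/ltW]. Qed.
Lemma chart_hi_le1 a : chart_hi a <= 1.
Proof. by rewrite /chart_hi; case: ifP => // /chart_x_bounds/andP[_ /ltW]. Qed.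

Lemma on_arc_alive a r : meets a -> chart_lo a < r < chart_hi a ->
  exists x, [/\ on_arc a x, h x = 1 - r, z x = r & g x = chart_icp a + chart_slp a * r].
Proof.
move=> ma /andP[rl rh]; have [x0 [on0 hx0 zx0]] := ma.
have [c1 c2] := on_arc_hz_det ma on0; have c0 := hz_det_ends ma.
have r0 : 0 < r by apply: le_lt_trans rl; apply: chart_lo_ge0.
have r1 : r < 1 by apply: lt_le_trans rh _; apply: chart_hi_le1.
have [] := @sector_quadrant _ (h (lower_end a)) (z (lower_end a)) (h (upper_end a)) (z (upper_end a)) (h x0) (z x0) r c0 hx0 zx0 c1 c2 r0 r1.
- move=> u0 u1; move: rl; rewrite /chart_lo /in_wedge u0 u1 /chart_x ltr_pdivrMr //; exact: addr_gt0.
- move=> u0 u1; move: rh; rewrite /chart_hi /in_wedge u0 u1 /chart_x ltr_pdivlMr //; exact: addr_gt0.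
set be := _ - _; set al := _ - _; move=> b0 a0.
have c0n := lt0r_neq0 c0.
pose x := (al / hz_det (lower_end a) (upper_end a)) *: lower_end a + (be / hz_det (lower_end a) (upper_end a)) *: upper_end a.
have hx : h x = 1 - r by rewrite /x lh /al /be; move: c0n; rewrite /hz_det => c0n; field.
have zx : z x = r by rewrite /x lz /al /be; move: c0n; rewrite /hz_det => c0n; field.
exists x; split => //.
- by apply: lt_on_arc; exists (al / hz_det (lower_end a) (upper_end a)), (be / hz_det (lower_end a) (upper_end a)); rewrite !divr_gt0.
- by rewrite (plane_eq ma (erefl : x = _)) hx zx; ring.
Qed.

Lemma chart_lo_lt_hi a : meets a -> chart_lo a < chart_hi a.
Proof.
move=> [x [on hx zx]]; have /andP[l1 l2] : chart_lo a < chart_x x < chart_hi a.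
  by apply: alive_on_arc; rewrite // /in_wedge hx zx.
exact: lt_trans l2.
Qed.

Lemma wedge_noncross a b r : a != b -> meets a -> meets b -> chart_lo a < r < chart_hi a -> chart_lo b < r < chart_hi b ->
  chart_icp a + chart_slp a * r <> chart_icp b + chart_slp b * r.
Proof.
move=> ab ma mb /(on_arc_alive ma)[x [onx hx zx gx]] /(on_arc_alive mb)[y [ony hy zy gy]].
rewrite -gx -gy => gxy; apply: (cd_disj C ab onx).
by rewrite (@coords_eq _ h g z x y co) // ?hx ?hy ?zx ?zy.
Qed.

(** A vertical arc stays in [h > 0] and cannot reach the ceiling [h = 0]; a slanted one stays in
    [z > 0] and cannot reach the floor. *)
Lemma wedge_nospan a : meets a -> 0 < chart_lo a \/ chart_hi a < 1.
Proof.
move=> ma; have c0 := hz_det_ends ma; have [x [on hx zx]] := ma.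
have [p [q [p0 q0 Ex]]] := on_arc_lt on.
have inQ_lo : in_wedge (lower_end a) -> 0 < chart_lo a.
  by move=> Q; rewrite /chart_lo Q; case/andP: (chart_x_bounds Q).
have inQ_hi : in_wedge (upper_end a) -> chart_hi a < 1.
  by move=> Q; rewrite /chart_hi Q; case/andP: (chart_x_bounds Q).
have [[hp _]|[z0 z1 _]] := meets_type ma.
  right; apply: inQ_hi; rewrite /in_wedge hp /= ltNge; apply/negP => zt.
  have hl : 0 < h (lower_end a) by apply: hp. have ht : 0 < h (upper_end a) by apply: hp.
  have zl : z (lower_end a) <= 0.
    rewrite leNgt; apply/negP => zl; move: c0; rewrite /hz_det ltNge => /negP; apply.
    by rewrite subr_le0 (le_trans (y := 0)) ?pmulr_rle0 // mulr_ge0 // ltW.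
  by move: zx; rewrite Ex lz ltNge -[leRHS]addr0 lerD // pmulr_rle0.
left; apply: inQ_lo; rewrite /in_wedge ltNge.
have zl : 0 < z (lower_end a) by rewrite /lower_end; case: (~~ _).
have zt : 0 < z (upper_end a) by rewrite /upper_end; case: (upper_side _).
rewrite zl andbT; apply/negP => hl.
have ht : h (upper_end a) <= 0.
  rewrite leNgt; apply/negP => ht; move: c0; rewrite /hz_det ltNge => /negP; apply.
  by rewrite subr_le0 (le_trans (y := 0)) ?pmulr_lle0 // mulr_ge0 // ltW.
by move: hx; rewrite Ex lh ltNge -[leRHS]addr0 lerD // pmulr_rle0.
Qed.

Lemma wedge_up a : meets a -> in_wedge (upper_end a) -> exists b, [/\ meets b, on_arc b (upper_end a),
  chart_lo b < chart_hi a < chart_hi b & chart_icp b + chart_slp b * chart_hi a = chart_icp a + chart_slp a * chart_hi a].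
Proof.
move=> ma Q; have [b on] := blocked C a (upper_side a); rewrite -/(upper_end a) in on.
have mb : meets b by case/andP: Q => hx zx; exists (upper_end a).
have [p [q [_ _ Ex]]] := on_arc_lt on.
have al := alive_on_arc on Q.
exists b; split; rewrite /chart_hi ?Q //.
rewrite (chart_pos mb Ex Q) (@chart_pos a 0 1) //.
by rewrite scale0r scale1r add0r.
Qed.

Lemma wedge_dn a : meets a -> in_wedge (lower_end a) -> exists b, [/\ meets b, on_arc b (lower_end a),
  chart_lo b < chart_lo a < chart_hi b & chart_icp b + chart_slp b * chart_lo a = chart_icp a + chart_slp a * chart_lo a].
Proof.
move=> ma Q; have [b on] := blocked C a (~~ upper_side a); rewrite -/(lower_end a) in on.
have mb : meets b by case/andP: Q => hx zx; exists (lower_end a).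
have [p [q [_ _ Ex]]] := on_arc_lt on.
have al := alive_on_arc on Q.
exists b; split; rewrite /chart_lo ?Q //.
rewrite (chart_pos mb Ex Q) (@chart_pos a 1 0) //.
by rewrite scale0r scale1r addr0.
Qed.
End Wedge.

Section WedgeSwirl.
Variable R : realType.
Local Notation vec := (vec R).
Variables (n : nat) (E : 'I_n -> bool -> vec) (pl : seq vec) (h g z : vec -> R).
Hypothesis C : cdiag E pl h g z.
Hypothesis hpl : forall q, q \in pl -> h q != 0.
Local Notation on_arc := (on_arc E).
Local Notation meets := (meets E h z).
Local Notation lower_end := (lower_end E h z).
Local Notation upper_end := (upper_end E h z).
Local Notation upper_side := (upper_side E h z).
Local Notation chart_lo := (chart_lo E h z).
Local Notation chart_hi := (chart_hi E h z).
Local Notation chart_icp := (chart_icp E h g z).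
Local Notation chart_slp := (chart_slp E h g z).
Local Notation in_wedge := (in_wedge h z).

Let co : coords h g z. Proof. exact: cd_coords C. Qed.
Let lh : lin h. Proof. by case: co. Qed.
Let lg : lin g. Proof. by case: co. Qed.
Let lz : lin z. Proof. by case: co. Qed.

Let I : finType := {a : 'I_n | `[< meets a >]}.
Let meetsI (a : I) : meets (val a). Proof. exact/asboolP/(valP a). Qed.

Lemma wedge_strip : exists S : strip R I, forall a,
  [/\ lo S a = chart_lo (val a), hi S a = chart_hi (val a), slp S a = chart_slp (val a),
      hi S a < 1 -> in_wedge (upper_end (val a)) /\ on_arc (val (up S a)) (upper_end (val a)) &
      0 < lo S a -> in_wedge (lower_end (val a)) /\ on_arc (val (dn S a)) (lower_end (val a))].
Proof.
have ex_up (a : I) : exists b : I, chart_hi (val a) < 1 -> [/\ in_wedge (upper_end (val a)), on_arc (val b) (upper_end (val a)),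
    chart_lo (val b) < chart_hi (val a) < chart_hi (val b) &
    chart_icp (val b) + chart_slp (val b) * chart_hi (val a) = chart_icp (val a) + chart_slp (val a) * chart_hi (val a)].
  case: (boolP (in_wedge (upper_end (val a)))) => Q; last by exists a; rewrite /chart_hi (negbTE Q) ltxx.
  have [b [mb on w e]] := wedge_up C hpl (meetsI a) Q.
  have mb' : `[< meets b >] by apply/asboolP.
  by exists (exist _ b mb').
have ex_dn (a : I) : exists b : I, 0 < chart_lo (val a) -> [/\ in_wedge (lower_end (val a)), on_arc (val b) (lower_end (val a)),
    chart_lo (val b) < chart_lo (val a) < chart_hi (val b) &
    chart_icp (val b) + chart_slp (val b) * chart_lo (val a) = chart_icp (val a) + chart_slp (val a) * chart_lo (val a)].
  case: (boolP (in_wedge (lower_end (val a)))) => Q; last by exists a; rewrite /chart_lo (negbTE Q) ltxx.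
  have [b [mb on w e]] := wedge_dn C hpl (meetsI a) Q.
  have mb' : `[< meets b >] by apply/asboolP.
  by exists (exist _ b mb').
have [u uP] := fin_all_exists ex_up; have [d dP] := fin_all_exists ex_dn.
have nc (a b : I) r : a != b -> chart_lo (val a) < r < chart_hi (val a) -> chart_lo (val b) < r < chart_hi (val b) ->
    chart_icp (val a) + chart_slp (val a) * r <> chart_icp (val b) + chart_slp (val b) * r.
  by move=> ab; apply: (wedge_noncross C hpl).
pose S := @Strip R I (fun a => chart_lo (val a)) (fun a => chart_hi (val a)) (fun a => chart_icp (val a))
  (fun a => chart_slp (val a)) u d (fun a => chart_lo_ge0 _ _ _ _) (fun a => chart_hi_le1 _ _ _ _)
  (fun a => chart_lo_lt_hi C hpl (meetsI a)).
have up_ok (a : I) : chart_hi (val a) < 1 -> chart_lo (val (u a)) < chart_hi (val a) < chart_hi (val (u a)) /\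
    chart_icp (val (u a)) + chart_slp (val (u a)) * chart_hi (val a) = chart_icp (val a) + chart_slp (val a) * chart_hi (val a).
  by move/uP => [].
have dn_ok (a : I) : 0 < chart_lo (val a) -> chart_lo (val (d a)) < chart_lo (val a) < chart_hi (val (d a)) /\
    chart_icp (val (d a)) + chart_slp (val (d a)) * chart_lo (val a) = chart_icp (val a) + chart_slp (val a) * chart_lo (val a).
  by move/dP => [].
exists (S up_ok dn_ok nc (fun a => wedge_nospan C hpl (meetsI a))) => a.
by split => //= H; [have [] := uP a H|have [] := dP a H].
Qed.

(** The end at which an arc is left when it is traversed upwards ([d] true) or downwards. *)
Definition eidx (d : bool) a := if d then upper_side a else ~~ upper_side a.

Lemma hz_det_anti u v : hz_det h z u v = - hz_det h z v u.
Proof. by rewrite /hz_det; ring. Qed.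

(** Both planes contain the hit [e]. Hence, as [key] shows, the determinant is the difference of the
    slopes times two factors whose signs record the directions of traversal. *)
Lemma wedge_turn a b (da db : bool) : meets a -> meets b ->
  on_arc b (E a (eidx da a)) -> in_wedge (E a (eidx da a)) ->
  (0 < form_det h g z (E a (~~ eidx da a)) (E a (eidx da a)) (E b (eidx db b))) =
    (if da == db then chart_slp b < chart_slp a else chart_slp a < chart_slp b) /\
  (form_det h g z (E a (~~ eidx da a)) (E a (eidx da a)) (E b (eidx db b)) < 0) =
    (if da == db then chart_slp a < chart_slp b else chart_slp b < chart_slp a).
Proof.
move=> ma mb on Q.
set w := E a (~~ _); set e := E a _ in on Q *; set f := E b _.
have ge : g e = chart_icp a * h e + (chart_icp a + chart_slp a) * z e.
  have [p [q Ee]] : exists p q : R, e = p *: lower_end a + q *: upper_end a.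
    by rewrite /e /eidx; case: da {w e on Q}; [exists 0, 1|exists 1, 0]; rewrite scale0r scale1r ?add0r ?addr0.
  exact: (plane_eq C hpl ma Ee).
have gw : g w = chart_icp a * h w + (chart_icp a + chart_slp a) * z w.
  have [p [q Ee]] : exists p q : R, w = p *: lower_end a + q *: upper_end a.
    by rewrite /w /eidx; case: da {w e on Q ge}; [exists 1, 0|exists 0, 1]; rewrite ?negbK scale0r scale1r ?add0r ?addr0.
  exact: (plane_eq C hpl ma Ee).
have gf : g f = chart_icp b * h f + (chart_icp b + chart_slp b) * z f.
  have [p [q Ee]] : exists p q : R, f = p *: lower_end b + q *: upper_end b.
    by rewrite /f /eidx; case: db {f}; [exists 0, 1|exists 1, 0]; rewrite scale0r scale1r ?add0r ?addr0.
  exact: (plane_eq C hpl mb Ee).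
have gb : g e = chart_icp b * h e + (chart_icp b + chart_slp b) * z e.
  by have [p [q [_ _ Ee]]] := on_arc_lt h z on; apply: (plane_eq C hpl mb Ee).
have s0 : 0 < h e + z e by apply: in_wedge_sum.
have key : (h e + z e) * form_det h g z w e f = (chart_slp a - chart_slp b) * (hz_det h z w e * hz_det h z e f).
  have D0 : (chart_icp a * h e + (chart_icp a + chart_slp a) * z e) - (chart_icp b * h e + (chart_icp b + chart_slp b) * z e) = 0.
    by rewrite -ge -gb subrr.
  apply: (@eq_trans _ _ ((chart_slp a - chart_slp b) * (hz_det h z w e * hz_det h z e f) +
      ((chart_icp a * h e + (chart_icp a + chart_slp a) * z e) - (chart_icp b * h e + (chart_icp b + chart_slp b) * z e)) *
      (- (h w + z w) * hz_det h z e f + (h e + z e) * hz_det h z w f))).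
    by rewrite /form_det gw ge gf /hz_det; ring.
  by rewrite D0 mul0r addr0.
have [cb1 cb2] := on_arc_hz_det C hpl mb on; have c0 := hz_det_ends C hpl ma.
have cwe : if da then 0 < hz_det h z w e else hz_det h z w e < 0.
  by rewrite /w /e /eidx; case: (da); rewrite ?negbK // hz_det_anti oppr_lt0.
have cef : if db then 0 < hz_det h z e f else hz_det h z e f < 0.
  by rewrite /f /eidx; case: (db) => //; rewrite hz_det_anti oppr_lt0.
have P0 : if da == db then 0 < hz_det h z w e * hz_det h z e f else hz_det h z w e * hz_det h z e f < 0.
  by move: cwe cef; case: (da); case: (db) => /= u v;
    [rewrite pmulr_rgt0|rewrite pmulr_rlt0|rewrite nmulr_rlt0|rewrite nmulr_rgt0].
rewrite -(pmulr_rgt0 _ s0) -(pmulr_rlt0 _ s0) key.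
case: ifP P0 => _ P0.
  by rewrite (pmulr_lgt0 _ P0) (pmulr_llt0 _ P0) subr_gt0 subr_lt0.
by rewrite (nmulr_lgt0 _ P0) (nmulr_llt0 _ P0) subr_gt0 subr_lt0.
Qed.

Lemma wedge_swirl : exists (s : seq 'I_n) (ps : bool), [/\ s <> [::], uniq s &
  forall a, a \in s -> let b := next s a in let c := next s b in
    exists t t', [/\ on_arc b (E a t), on_arc c (E b t'), in_wedge (E a t) &
      if ps then 0 < form_det h g z (E a (~~ t)) (E a t) (E b t')
            else form_det h g z (E a (~~ t)) (E a t) (E b t') < 0]].
Proof.
have [S SP] := wedge_strip.
have [b0 [x0 [_ on0 z0 h0]]] := exists_vert C.
have mb0 : `[< meets b0 >] by apply/asboolP; exists x0.
have [dir [ps [s [s0 us cs]]]] := strip_swirl S (exist _ b0 mb0).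
exists (map val s), ps; split.
- by case: s s0 {us cs}.
- by rewrite map_inj_uniq //; apply: val_inj.
move=> _ /mapP[a as_ ->];
have nm x : next [seq val i | i <- s] (val x) = val (next s x) by rewrite (next_map val_inj).
rewrite /= !nm.
set b := next s a; set c := next s b.
have bs : b \in s by rewrite mem_next.
have st x : x \in s -> on_arc (val (next s x)) (E (val x) (eidx (dir x) (val x))) /\
    in_wedge (E (val x) (eidx (dir x) (val x))).
  move=> xs; have := next_cycle cs xs; rewrite /swirl_step => /andP[+ _].
  have [_ _ _ Su Sd] := SP x; rewrite /eidx; case: (dir x) => /andP[h1 /eqP ->].
    by have [] := Su h1.
  by have [] := Sd h1.
have [on1 Q1] := st _ as_; have [on2 _] := st _ bs.
exists (eidx (dir a) (val a)), (eidx (dir b) (val b)); split => //.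
have [T1 T2] := wedge_turn (dir b) (meetsI a) (meetsI b) on1 Q1.
have := next_cycle cs as_; rewrite /swirl_step -/b => /andP[_].
have [_ _ -> _ _] := SP a; have [_ _ -> _ _] := SP b; rewrite T1 T2.
by case: (ps); case: eqP.
Qed.
End WedgeSwirl.

(** * Three distinct swirls on each side of the equator *)

Section ThreeSwirls.
Variable R : realType.
Local Notation vec := (vec R).
Variables (n : nat) (E : 'I_n -> bool -> vec) (pl : seq vec).
Implicit Types (f h g z : vec -> R) (s : seq 'I_n).
Local Notation on_arc := (on_arc E).

Definition turns s (ps : bool) := forall a, a \in s -> exists t t',
  [/\ on_arc (next s a) (E a t), on_arc (next s (next s a)) (E (next s a) t') &
      if ps then 0 < det3 (E a (~~ t)) (E a t) (E (next s a) t')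
            else det3 (E a (~~ t)) (E a t) (E (next s a) t') < 0].
Definition hits_in f s := forall a, a \in s -> exists t, on_arc (next s a) (E a t) /\ 0 < f (E a t).
Definition swirl_in f s := [/\ s <> [::], uniq s, exists ps, turns s ps & hits_in f s].

Lemma hit_uniq h g z a b t t' : cdiag E pl h g z -> on_arc b (E a t) -> on_arc b (E a t') -> t = t'.
Proof.
move=> C on [p [q [_ _ on']]]; apply/eqP; apply: contraT => ne; exfalso.
have tE : t' = ~~ t by move: ne; case: (t); case: (t').
by apply: (no_span_hit C on); exists p, q; rewrite -on' tE.
Qed.

Lemma wedge_swirl_in h g z : cdiag E pl h g z -> (forall q, q \in pl -> h q != 0) ->
  exists s, swirl_in h s /\ swirl_in z s.
Proof.
move=> C hpl; have [s [ps [s0 us H]]] := wedge_swirl C hpl; exists s.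
have [_ _ _ [k k0 kE]] := cd_coords C.
have T : exists ps', turns s ps'.
  exists (if 0 < k then ps else ~~ ps) => a /H[t [t' [h1 h2 _ h4]]]; exists t, t'; split => //.
  move: h4; rewrite !kE; case: (ltrP 0 k) => k1.
    by case: ps {H}; rewrite ?pmulr_rgt0 ?pmulr_rlt0.
  have {}k1 : k < 0 by rewrite lt_neqAle k0.
  by case: ps {H}; rewrite ?nmulr_rgt0 ?nmulr_rlt0.
by split; split => // a /H[t [t' [h1 _ /andP[h2 h3] _]]]; exists t.
Qed.

(** This tells swirls apart: an arc hits its successor with only one end, so equal cycles have the
    same vertices, which must lie in both half-spaces. *)
Lemma sameCycle_hits h g z f f' s s' : cdiag E pl h g z -> uniq s -> sameCycle s s' ->
  hits_in f s -> hits_in f' s' -> forall a t, a \in s -> on_arc (next s a) (E a t) ->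
  0 < f (E a t) /\ 0 < f' (E a t).
Proof.
move=> C us [r ->] H H' a t as_ on.
have [t1 [on1 f1]] := H a as_.
have [|t2 [on2 f2]] := H' a; first by rewrite mem_rot.
rewrite next_rot // in on2.
by split; [rewrite (hit_uniq C on on1)|rewrite (hit_uniq C on on2)].
Qed.

Lemma sameCycle_sym s s' : sameCycle s s' -> sameCycle s' s.
Proof.
move=> [r ->]; have [lt|ge] := leqP r (size s).
  exists (size s - r)%N; rewrite -{1}(size_rot r s); exact/esym/rotK.
by exists 0%N; rewrite rot0 rot_oversize // ltnW.
Qed.

(** Otherwise all vertices are in the meridian plane of [y]. Two consecutive arcs of the swirl, each
    containing two vertices, would then lie in this plane. *)
Lemma swirl_two_rays h g z s y : cdiag E pl h g z -> swirl_in h s -> (h y, g y) <> (0, 0) ->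
  exists a t, [/\ a \in s, on_arc (next s a) (E a t) & bracket h g (E a t) y != 0].
Proof.
move=> C [s0 us _ H] nz; apply: contrapT => no.
have par a t : a \in s -> on_arc (next s a) (E a t) -> bracket h g (E a t) y = 0.
  by move=> as_ on; apply/eqP/negPn/negP => ne; apply: no; exists a, t.
have [a as_] : exists a, a \in s by case: s s0 {us H no par} => // a s _; exists a; rewrite inE eqxx.
have nx x : x \in s -> next s x \in s by rewrite mem_next.
have [t [on ft]] := H a as_; have [t1 [on1 ft1]] := H _ (nx _ as_).
have [t2 [on2 ft2]] := H _ (nx _ (nx _ as_)).
have P0 := par _ _ as_ on; have P1 := par _ _ (nx _ as_) on1.
have P2 := par _ _ (nx _ (nx _ as_)) on2.
have other (b : 'I_n) e u : on_arc b e -> bracket h g e y = 0 -> bracket h g (E b u) y = 0 ->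
    forall v, bracket h g (E b v) y = 0.
  move=> onb e0 u0 v; have [->//|vu] := eqVneq v u.
  have -> : v = ~~ u by move: vu; case: (u); case: (v).
  have [p [q [p0 q0 Ee]]] := on_arcP u onb.
  move: e0; rewrite Ee (bracket_linl C) u0 mulr0 add0r => /eqP.
  by rewrite mulf_eq0 gt_eqF //= => /eqP.
have B1 := other _ _ _ on P0 P1; have B2 := other _ _ _ on1 P1 P2.
apply: (plane_hit C (A := g y) (B := - h y) (G := 0) on1).
- by case=> e1 /eqP; rewrite oppr_eq0 => /eqP e2; apply: nz; rewrite e1 e2.
- by move=> u; rewrite -[RHS](B2 u) /bracket; ring.
- by rewrite -[RHS](B1 (~~ t1)) /bracket; ring.
Qed.

Lemma avoid_roots (I : eqType) (l : seq I) (a b : I -> R) :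
  (forall q, q \in l -> (a q, b q) <> (0, 0)) ->
  exists2 k : R, 0 < k & forall q, q \in l -> a q + k * b q != 0.
Proof.
(* Larger than every root [- a q / b q]. *)
move=> nz; pose k := 1 + \sum_(q <- l) `|a q / b q|.
have k0 : 0 < k by rewrite ltr_pwDl // sumr_ge0.
exists k => // q ql; apply/eqP => E0.
have [b0|b0] := eqVneq (b q) 0.
  by move: E0; rewrite b0 mulr0 addr0 => a0; case: (nz q ql); rewrite a0 b0.
have kE : a q / b q = - k.
  by apply: (mulIf b0); rewrite divfK // mulNr; apply/eqP; rewrite -addr_eq0 E0.
have : k <= \sum_(q <- l) `|a q / b q|.
  rewrite (big_rem q ql) /= -[leLHS]addr0 lerD ?sumr_ge0 //.
  by rewrite kE normrN ler_norm.
by rewrite /k leNgt ltr_pwDl.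
Qed.

Lemma three_swirls h g z : cdiag E pl h g z -> exists s1 s2 s3,
  [/\ swirl_in z s1, swirl_in z s2 & swirl_in z s3] /\
  [/\ ~ sameCycle s1 s2, ~ sameCycle s1 s3 & ~ sameCycle s2 s3].
Proof.
move=> C0.
have [k k0 hk] := avoid_roots (fun q ql => (cd_poles C0 ql).2).
have nz0 : (1, k) <> (0, 0) :> R * R by case=> /eqP; rewrite oner_eq0.
have C := cdiag_rot nz0 C0.
set h1 := (fun x => 1 * h x + k * g x) in C; set g1 := (fun x => 1 * g x - k * h x) in C.
have hpl q : q \in pl -> h1 q != 0 by move=> /hk; rewrite /h1 mul1r.
have nz1 : (-1, 0) <> (0, 0) :> R * R by case=> /eqP; rewrite oppr_eq0 oner_eq0.
have C' := cdiag_rot nz1 C.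
have hpl' q : q \in pl -> -1 * h1 q + 0 * g1 q != 0.
  by move=> /hpl; rewrite mulN1r mul0r addr0 oppr_eq0.
have [s1 [W1 Z1]] := wedge_swirl_in C hpl.
have [s2 [W2 Z2]] := wedge_swirl_in C' hpl'.
have [ne2 us2 _ H2] := W2; have [ne1 us1 _ H1] := W1.
have [b bs2] : exists b, b \in s2 by case: (s2) ne2 => // b s _; exists b; rewrite inE eqxx.
have [t2 [on2 h2]] := H2 b bs2; set y := E b t2 in on2 h2.
rewrite mulN1r mul0r addr0 oppr_gt0 in h2.
have nzy : (h1 y, g1 y) <> (0, 0) by case=> y0; rewrite y0 ltxx in h2.
have [a [t1 [as1 on1 ne]]] := swirl_two_rays C W1 nzy.
set x := E a t1 in on1 ne.
have [_ _ _ [kk kk0 _]] := cd_coords C.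
have nzp q : q \in pl -> (bracket h1 g1 q y, bracket h1 g1 x q) <> (0, 0).
  move=> ql [e1 e2]; have [_ nq] := cd_poles C ql; apply: nq; congr (_, _); apply: (mulfI ne); rewrite mulr0.
    apply: (@eq_trans _ _ (h1 x * bracket h1 g1 q y + h1 y * bracket h1 g1 x q)); first by rewrite /bracket; ring.
    by rewrite e1 e2 !mulr0 addr0.
  apply: (@eq_trans _ _ (g1 x * bracket h1 g1 q y + g1 y * bracket h1 g1 x q)); first by rewrite /bracket; ring.
  by rewrite e1 e2 !mulr0 addr0.
have [m m0 hm] := avoid_roots nzp.
(* By Cramer's rule, the third form takes the values [-1] at the vertex [x] of [s1] and [- m] at the
   vertex [y] of [s2]; the choice of [m] keeps it nonzero at the poles. *)
pose B := bracket h1 g1 x y.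
pose A1 := - (g1 y - m * g1 x) / B; pose B1 := - (m * h1 x - h1 y) / B.
have fE w : A1 * h1 w + B1 * g1 w = - (bracket h1 g1 w y + m * bracket h1 g1 x w) / B.
  by rewrite /A1 /B1 /bracket; ring.
have fx : A1 * h1 x + B1 * g1 x = -1.
  by rewrite fE bracket_xx mulr0 addr0 mulNr divff.
have fy : A1 * h1 y + B1 * g1 y = - m.
  by rewrite fE bracket_xx add0r mulNr mulfK.
have nz2 : (A1, B1) <> (0, 0).
  by case=> a0 b0; move: fx; rewrite a0 b0 !mul0r addr0 => /eqP; rewrite eq_sym oppr_eq0 oner_eq0.
have C3 := cdiag_rot nz2 C.
have hpl3 q : q \in pl -> A1 * h1 q + B1 * g1 q != 0.
  by move=> /hm ql; rewrite fE mulf_neq0 ?oppr_eq0 // invr_eq0.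
have [s3 [W3 Z3]] := wedge_swirl_in C3 hpl3.
have [ne3 us3 _ H3] := W3.
exists s1, s2, s3; split => //; split.
- move=> sc; have [p0 /=] := sameCycle_hits C us1 sc H1 H2 as1 on1.
  by rewrite mulN1r mul0r addr0 oppr_gt0 => /(lt_trans p0); rewrite ltxx.
- by move=> sc; have [_ /=] := sameCycle_hits C us1 sc H1 H3 as1 on1; rewrite -/x fx ltr0N1.
- move=> sc; have [_ /=] := sameCycle_hits C us2 sc H2 H3 bs2 on2.
  by rewrite -/y fy oppr_gt0 ltNge ltW.
Qed.

Lemma six_swirls h g z : cdiag E pl h g z -> exists l : seq (seq 'I_n),
  [/\ size l = 6%N, forall s, s \in l -> [/\ s <> [::], uniq s & exists ps, turns s ps]
  & forall i j, (i < j < 6)%N -> ~ sameCycle (nth [::] l i) (nth [::] l j)].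
Proof.
move=> C.
have [s1 [s2 [s3 [[Z1 Z2 Z3] [n12 n13 n23]]]]] := three_swirls C.
have [s4 [s5 [s6 [[Z4 Z5 Z6] [n45 n46 n56]]]]] := three_swirls (cdiag_flip C).
have ns s s' : swirl_in z s -> swirl_in (fun x => - z x) s' -> ~ sameCycle s s'.
  move=> [s0 us _ H] [_ _ _ H'] sc.
  have [a as_] : exists a, a \in s by case: (s) s0 => // a w _; exists a; rewrite inE eqxx.
  have [t [on _]] := H a as_.
  have [z1 z2] := sameCycle_hits C us sc H H' as_ on.
  by move: z2; rewrite oppr_gt0 => /(lt_trans z1); rewrite ltxx.
exists [:: s1; s2; s3; s4; s5; s6]; split => //.
  have W f s : swirl_in f s -> [/\ s <> [::], uniq s & exists ps, turns s ps] by case.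
  by move=> s /(nthP [::])[[|[|[|[|[|[|i]]]]]] //= _ <-]; apply: W; eassumption.
case=> [|[|[|[|[|[|i]]]]]] [|[|[|[|[|[|j]]]]]] //= H;
  first [assumption|apply: ns; assumption|by case/andP: H].
Qed.
End ThreeSwirls.

(** * From spherical diagrams to coordinates *)

Section PoleGeometry.
Variable R : realType.
Local Notation vec := (vec R).
Implicit Types (u v w x q nv : vec).

(** These are the coordinates in the basis [q1], [q2], [q3], multiplied by its determinant; the
    matrix is an adjugate, whence the square. *)
Lemma det3_coords q1 q2 q3 : det3 q1 q2 q3 != 0 ->
  coords (fun x => det3 x q2 q3) (fun x => det3 q1 x q3) (fun x => det3 q1 q2 x).
Proof.
move=> d0; split.
- by move=> a b u v; rewrite !det3E !(lin_cx, lin_cy, lin_cz); ring.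
- by move=> a b u v; rewrite !det3E !(lin_cx, lin_cy, lin_cz); ring.
- by move=> a b u v; rewrite !det3E !(lin_cx, lin_cy, lin_cz); ring.
exists (det3 q1 q2 q3 ^+ 2); first by rewrite expf_neq0.
move=> u v w; rewrite /form_det !det3E.
move: (cx u) (cy u) (cz u) (cx v) (cy v) (cz v) (cx w) (cy w) (cz w) => *.
move: (cx q1) (cy q1) (cz q1) (cx q2) (cy q2) (cz q2) (cx q3) (cy q3) (cz q3) => *.
ring.
Qed.

Lemma xyz_coords : coords (@cx R) (@cy R) (@cz R).
Proof.
split; [exact: lin_cx|exact: lin_cy|exact: lin_cz|exists 1; first exact: oner_neq0].
by move=> u v w; rewrite mul1r det3E.
Qed.

Lemma dot_lin nv : lin (dot nv).
Proof. by move=> a b u v; rewrite !dotE !(lin_cx, lin_cy, lin_cz); ring. Qed.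

Lemma dotC u v : dot u v = dot v u.
Proof. by rewrite !dotE; ring. Qed.

Lemma dot_eq0 u : dot u u = 0 -> u = 0.
Proof.
rewrite dotE -!expr2 => /eqP; rewrite !paddr_eq0 ?addr_ge0 ?sqr_ge0 // !sqrf_eq0.
by move=> /andP[/andP[/eqP h1 /eqP h2] /eqP h3]; apply: (coords_inj xyz_coords).
Qed.

Lemma dot_gt0 u : u != 0 -> 0 < dot u u.
Proof.
move=> u0; rewrite lt_def; apply/andP; split; first by apply: contra u0 => /eqP/dot_eq0/eqP.
by rewrite dotE -!expr2 !addr_ge0 ?sqr_ge0.
Qed.

Lemma sphere_indep u v : onSphere u -> onSphere v -> u <> v -> u <> - v -> indep u v.
Proof.
rewrite /onSphere => su sv n1 n2 a b E0.
have [lx ly lz _] := xyz_coords.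
have Eu : a *: u = (- b) *: v by apply/eqP; rewrite scaleNr -addr_eq0 E0.
have E2 : a ^+ 2 = b ^+ 2.
  have : dot (a *: u) (a *: u) = dot ((- b) *: v) ((- b) *: v) by rewrite Eu.
  rewrite !(linZ _ _ (dot_lin _)) ![dot (_ *: _) _]dotC !(linZ _ _ (dot_lin _)) su sv.
  by rewrite !mulr1 mulrNN !expr2.
have [a0|a0] := eqVneq a 0.
  by move/eqP: E2; rewrite a0 expr0n /= eq_sym sqrf_eq0 => /eqP.
exfalso; move/eqP: E2; rewrite eqf_sqr => /orP[] /eqP ab.
  by apply: n2; apply: (scalerI a0); rewrite Eu ab scalerN scaleNr.
by apply: n1; apply: (scalerI a0); rewrite Eu ab.
Qed.

Lemma normal_det nv u v w : nv != 0 -> dot nv u = 0 -> dot nv v = 0 -> dot nv w = 0 -> det3 u v w = 0.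
Proof.
move=> n0; rewrite !dotE => h1 h2 h3.
have := @form_det_eq0 R (@cx R) (@cy R) (@cz R) (cx nv) (cy nv) (cz nv) u v w.
rewrite /form_det -det3E; apply => // -[e1 e2 e3].
by case/eqP: n0; apply: (coords_inj xyz_coords).
Qed.

Definition cross u v : vec :=
  v3 (cy u * cz v - cz u * cy v) (cz u * cx v - cx u * cz v) (cx u * cy v - cy u * cx v).

Lemma dot_cross u v w : dot (cross u v) w = det3 u v w.
Proof. by rewrite dotE det3E cxE cyE czE; ring. Qed.

Lemma det3_uu u v : det3 u v u = 0. Proof. by rewrite det3E; ring. Qed.
Lemma det3_vv u v : det3 u v v = 0. Proof. by rewrite det3E; ring. Qed.

Lemma cross_neq0 u v : indep u v -> cross u v != 0.
Proof.
move=> ind; apply/eqP => c0.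
have D w : det3 u v w = 0 by rewrite -dot_cross c0 dotE /cx /cy /cz !mxE; ring.
have [ ] := indep_minor xyz_coords ind.
- by have := D (v3 0 0 1); rewrite det3E cxE cyE czE => <-; apply/negP/negPn/eqP; ring.
- by have := D (v3 1 0 0); rewrite det3E cxE cyE czE => <-; apply/negP/negPn/eqP; ring.
- by have := D (v3 0 1 0); rewrite det3E cxE cyE czE => <-; apply/negP/negPn/eqP; ring.
Qed.

Lemma normal_cross nv u v : dot nv u = 0 -> dot nv v = 0 ->
  dot (cross u v) (cross u v) *: nv = dot nv (cross u v) *: cross u v.
Proof.
move=> h1 h2; apply: (coords_eq xyz_coords); rewrite ?(linZ _ _ (@lin_cx R)) ?(linZ _ _ (@lin_cy R)) ?(linZ _ _ (@lin_cz R));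
 apply/eqP; rewrite -subr_eq0; apply/eqP.
- apply: (@eq_trans _ _ (cy (cross u v) * (cz u * dot nv v - cz v * dot nv u)
    - cz (cross u v) * (cy u * dot nv v - cy v * dot nv u))).
    by rewrite !dotE !(cxE, cyE, czE); ring.
  by rewrite h1 h2; ring.
- apply: (@eq_trans _ _ (cz (cross u v) * (cx u * dot nv v - cx v * dot nv u)
    - cx (cross u v) * (cz u * dot nv v - cz v * dot nv u))).
    by rewrite !dotE !(cxE, cyE, czE); ring.
  by rewrite h1 h2; ring.
- apply: (@eq_trans _ _ (cx (cross u v) * (cy u * dot nv v - cy v * dot nv u)
    - cy (cross u v) * (cx u * dot nv v - cx v * dot nv u))).
    by rewrite !dotE !(cxE, cyE, czE); ring.
  by rewrite h1 h2; ring.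
Qed.

Lemma sameSet_normals nv nv' u v : indep u v -> nv != 0 -> nv' != 0 ->
  dot nv u = 0 -> dot nv v = 0 -> dot nv' u = 0 -> dot nv' v = 0 ->
  sameSet (greatCircle nv) (greatCircle nv').
Proof.
move=> ind n0 n0' h1 h2 h3 h4.
pose w := cross u v; have w0 := cross_neq0 ind.
have ww : dot w w != 0 by rewrite lt0r_neq0 // dot_gt0.
have key m : m != 0 -> dot m u = 0 -> dot m v = 0 -> forall x, dot m x = 0 <-> dot w x = 0.
  move=> m0 k1 k2 x; have E := normal_cross k1 k2; rewrite -/w in E.
  have mw : dot m w != 0.
    by apply/eqP => e; move: E; rewrite e scale0r => /eqP; rewrite scaler_eq0 (negbTE ww) (negbTE m0).
  have E2 : dot w w * dot m x = dot m w * dot w x.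
    by rewrite ![dot _ x]dotC -!(linZ _ _ (dot_lin _)) E.
  split=> e; move/eqP: E2; rewrite e mulr0.
    by rewrite eq_sym mulf_eq0 (negbTE mw) => /eqP.
  by rewrite mulf_eq0 (negbTE ww) => /eqP.
move=> x; split=> -[sx e]; split => //.
  exact: (key _ n0' h3 h4 x).2 ((key _ n0 h1 h2 x).1 e).
exact: (key _ n0 h1 h2 x).2 ((key _ n0' h3 h4 x).1 e).
Qed.

(** Choosing a second pole on each of the [k.-1] circles through [p i0] is injective, hence onto the
    other poles; so no two of these share a circle with [p i0]. *)
Lemma pole_triples k (p : 'I_k -> vec) i0 :
  (forall i, onSphere (p i)) -> injective p -> (forall i j, p i <> - p j) ->
  numCircles p i0 k.-1 -> forall i j, i != i0 -> j != i0 -> i != j -> det3 (p i0) (p i) (p j) != 0.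
Proof.
move=> sp ip ap [ns [n0 [nd [thr _]]]].
have ind i j : i != j -> indep (p i) (p j).
  by move=> ij; apply: sphere_indep => // /ip/eqP; apply/negP.
have [f fP] := fin_all_exists (fun t => (thr t).2).
have finj : injective f.
  move=> t t' E; apply/eqP; apply: contraT => tt; exfalso.
  have [fi [_ e1]] := fP t; have [_ [_ e2]] := fP t'; rewrite -E in e2.
  apply: (nd t t' tt); apply: (sameSet_normals (ind _ _ fi)) => //.
    by case: (thr t) => -[_].
  by case: (thr t') => -[_].
have surj i : i != i0 -> exists t, f t = i.
  move=> ii; have : i \in codom f; last by move/codomP => [t ->]; exists t.
  suff -> : codom f =i predC1 i0 by [].
  have sub : codom f \subset predC1 i0.
    by apply/subsetP => _ /codomP[t ->]; case: (fP t).
  apply/subset_cardP => //.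
  by rewrite card_codom // card_ord cardC1 card_ord.
move=> i j ii ji ij; apply/eqP => d0.
have [t ti] := surj i ii; have [t' tj] := surj j ji.
have tt : t != t' by apply/eqP => E; case/eqP: ij; rewrite -ti -tj E.
have [[_ a1] _] := thr t; have [[_ a2] _] := thr t'.
have [_ [_ b1]] := fP t; have [_ [_ b2]] := fP t'; rewrite ti in b1; rewrite tj in b2.
have [a [b E]] : exists a b : R, p j = a *: p i0 + b *: p i.
  by apply: (form_det_span xyz_coords); [apply: ind; rewrite eq_sym|rewrite /form_det -det3E].
apply: (nd t t' tt); apply: (sameSet_normals (u := p i0) (v := p j)) => //.
  by apply: ind; rewrite eq_sym.
by rewrite E dot_lin a1 b1 !mulr0 addr0.
Qed.

(** One of the two circles through [p i] passes through [p i0], and by [pole_triples] through no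
    third pole; all remaining poles are on the other circle. *)
Lemma poles_coplanar k (p : 'I_k -> vec) i0 :
  (forall i, onSphere (p i)) -> injective p -> (forall i j, p i <> - p j) ->
  numCircles p i0 k.-1 -> (forall j, j != i0 -> numCircles p j 2) ->
  forall i j l, i != i0 -> j != i0 -> l != i0 -> i != j -> det3 (p i) (p j) (p l) = 0.
Proof.
move=> sp ip ap nc0 nc2 i j l ii ji li ij.
have [->|lj] := eqVneq l j; first exact: det3_vv.
have [->|lne] := eqVneq l i; first exact: det3_uu.
have tri := pole_triples sp ip ap nc0.
have ind a b : a != b -> indep (p a) (p b).
  by move=> ab; apply: sphere_indep => // /ip/eqP; apply/negP.
have [ns [_ [_ [_ all]]]] := nc2 i ii.
have cl m : m != i -> exists t, sameSet (greatCircle (cross (p i) (p m))) (greatCircle (ns t)).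
  move=> mi; apply: all; first by apply: cross_neq0; apply: ind; rewrite eq_sym.
    by split => //; rewrite dot_cross det3_uu.
  by exists m; split => //; split => //; rewrite dot_cross det3_vv.
have same a b t : sameSet (greatCircle (cross (p i) (p a))) (greatCircle (ns t)) ->
    sameSet (greatCircle (cross (p i) (p b))) (greatCircle (ns t)) -> det3 (p i) (p a) (p b) = 0.
  move=> Ha Hb; rewrite -dot_cross.
  have /Hb/Ha[] // : greatCircle (cross (p i) (p b)) (p b).
  by split => //; rewrite dot_cross det3_vv.
have [t0 H0] : exists t, sameSet (greatCircle (cross (p i) (p i0))) (greatCircle (ns t)).
  by apply: cl; rewrite eq_sym.
have [t1 H1] : exists t, sameSet (greatCircle (cross (p i) (p j))) (greatCircle (ns t)).
  by apply: cl; rewrite eq_sym.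
have [t2 H2] := cl l lne.
have swap a : det3 (p i) (p i0) (p a) = - det3 (p i0) (p i) (p a) by rewrite !det3E; ring.
have n01 : t0 != t1.
  apply/eqP => E; rewrite E in H0; have /eqP := same _ _ _ H0 H1.
  by rewrite swap oppr_eq0; apply/negP; apply: tri.
have n02 : t0 != t2.
  apply/eqP => E; rewrite E in H0; have /eqP := same _ _ _ H0 H2.
  by rewrite swap oppr_eq0; apply/negP; apply: tri; rewrite // eq_sym.
suff t12 : t1 = t2 by rewrite t12 in H1; apply: same H1 H2.
by move: n01 n02; case: t0 {H0} => [[|[|//]] ?]; case: t1 {H1} => [[|[|//]] ?];
  case: t2 {H2} => [[|[|//]] ?] //= _ _; apply: val_inj.
Qed.

(** * Coordinates of a given spherical diagram *)

Section FromSD.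
Variables (n : nat) (D : 'I_n -> garc R).
Hypothesis sd : isSD D.

Definition arc_end (a : 'I_n) (t : bool) : vec := if t then (D a).2 else (D a).1.

Lemma arc_end_sphere a t : onSphere (arc_end a t).
Proof. by have [_ [/(_ a)[? [? _]] _]] := sd; case: t. Qed.

Lemma arc_end_indep a : indep (arc_end a false) (arc_end a true).
Proof. by have [_ [/(_ a)[? [? [? ?]]] _]] := sd; apply: sphere_indep. Qed.

Lemma relInt_on_arc a x : relInt (D a) x <-> onSphere x /\ on_arc arc_end a x.
Proof.
split=> [[sx [p [q [p0 [q0 E]]]]]|[sx [p [q [p0 q0 E]]]]]; first by split => //; exists p, q.
by split => //; exists p, q.
Qed.

Lemma on_arc_relInt a b t : on_arc arc_end b (arc_end a t) <-> relInt (D b) (arc_end a t).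
Proof. by rewrite relInt_on_arc; split=> [?|[]//]; split => //; apply: arc_end_sphere. Qed.

Lemma arc_end_disj a b x : a != b -> on_arc arc_end a x -> on_arc arc_end b x -> False.
Proof.
have [_ [_ [dj _]]] := sd; move=> ab [p [q [p0 q0 Ex]]] [p' [q' [p'0 q'0 Ex']]].
have x0 : x != 0.
  apply/eqP => x0; have [|/eqP] := @arc_end_indep a p q; first by rewrite -Ex.
  by rewrite gt_eqF.
have xx := dot_gt0 x0.
pose c := (Num.sqrt (dot x x))^-1.
have c0 : 0 < c by rewrite invr_gt0 sqrtr_gt0.
have sc : onSphere (c *: x).
  rewrite /onSphere !(linZ _ _ (dot_lin _)) dotC !(linZ _ _ (dot_lin _)) mulrA -expr2 /c exprVn sqr_sqrtr ?ltW //.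
  by rewrite mulVf // gt_eqF.
apply: (dj a b ab (c *: x)); split; apply/relInt_on_arc; split => //.
  by exists (c * p), (c * q); rewrite !mulr_gt0 // Ex scalerDr !scalerA.
by exists (c * p'), (c * q'); rewrite !mulr_gt0 // Ex' scalerDr !scalerA.
Qed.

(** Coefficients that are both nonnegative or both nonpositive would put [q] or its antipode on the
    arc. *)
Lemma arc_pole_combo a q : onSphere q -> arcOnCircleThrough (D a) q -> ~ arcContains (D a) q ->
  ~ arcContains (D a) (- q) ->
  exists al be : R, al * be < 0 /\ q = al *: arc_end a false + be *: arc_end a true.
Proof.
move=> sq [nv [n0 [on nq]]] nc1 nc2.
have end_on t : arcContains (D a) (arc_end a t).
  split; first exact: arc_end_sphere.
  by case: t; [exists 0, 1|exists 1, 0]; rewrite lexx ler01 scale0r scale1r ?add0r ?addr0.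
have [_ h1] := on _ (end_on false); have [_ h2] := on _ (end_on true).
have d0 := normal_det n0 h1 h2 nq.2.
have [|al [be E]] := form_det_span xyz_coords (arc_end_indep (a := a)) (w := q).
  by rewrite /form_det -det3E.
exists al, be; split => //; rewrite ltNge; apply/negP => ab.
have sNq : onSphere (- q).
  by rewrite /onSphere -scaleN1r (linZ _ _ (dot_lin _)) dotC (linZ _ _ (dot_lin _)) sq mulr1 mulrNN mulr1.
case: (ltrP al 0) => a0.
  have b0 : be <= 0 by rewrite -(nmulr_rge0 _ a0).
  apply: nc2; split => //; exists (- al), (- be); rewrite !oppr_ge0 ltW // b0; split => //; split => //.
  by rewrite E opprD !scaleNr.
case: (ltrP be 0) => b0.
  have a0' : al <= 0 by rewrite -(nmulr_lge0 _ b0).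
  apply: nc2; split => //; exists (- al), (- be); rewrite !oppr_ge0 a0' ltW //; split => //; split => //.
  by rewrite E opprD !scaleNr.
by apply: nc1; split => //; exists al, be.
Qed.

Lemma cdiag_of_SD k : (4 <= k)%N -> kOrientedAlign2 k D ->
  exists pl h g z, cdiag arc_end pl h g z.
Proof.
move=> hk [p [sp [ip [ap [[f fP] [i0 [nc0 nc2]]]]]]].
have tri := pole_triples sp ip ap nc0.
have cop := poles_coplanar sp ip ap nc0 nc2.
have two : exists i j, [/\ i != i0, j != i0 & i != j].
  have : (1 < #|predC1 i0|)%N by rewrite cardC1 card_ord; clear -hk; case: k hk => [|[|[|]]].
  by move/card_gt1P => [i [j [hi hj ij]]]; exists i, j.
have [i [j [ii ji ij]]] := two.
pose q1 := p i; pose q2 := p j; pose P0 := p i0.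
have d0 : det3 q1 q2 P0 != 0.
  by have := tri i j ii ji ij; rewrite (_ : det3 (p i0) _ _ = det3 q1 q2 P0) // !det3E; ring.
have co := det3_coords d0; have [lh lg lz _] := co.
pose h x := det3 x q2 P0; pose g x := det3 q1 x P0; pose z x := det3 q1 q2 x.
exists [seq p l | l <- enum 'I_k & l != i0], h, g, z.
have zq l : l != i0 -> z (p l) = 0 by move=> li; apply: cop.
have plP q : q \in [seq p l | l <- enum 'I_k & l != i0] -> exists2 l, l != i0 & q = p l.
  by move/mapP => [l]; rewrite mem_filter => /andP[li _] ->; exists l.
have dp u : dot u u = 1 -> u <> 0.
  by move=> su v0; move: su; rewrite v0 dotE /cx /cy /cz !mxE !mulr0 !addr0 => /eqP; rewrite eq_sym oner_eq0.
split => //.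
- by case: sd.
- exact: arc_end_indep.
- exact: arc_end_disj.
- move=> a t; have [_ [_ [_ bl]]] := sd; have [[b1 h1] [b2 h2]] := bl a.
  by case: t; [exists b2; apply/(on_arc_relInt a b2 true)|exists b1; apply/(on_arc_relInt a b1 false)].
- move=> a; have [on [nc1 nc3]] := fP a.
  have [al [be [ab E]]] := arc_pole_combo (sp _) on nc1 nc3.
  have bn : be != 0 by apply/eqP => b0; move: ab; rewrite b0 mulr0 ltxx.
  have an : al != 0 by apply/eqP => b0; move: ab; rewrite b0 mul0r ltxx.
  set u := arc_end a false in E *; set v := arc_end a true in E *.
  (* A linear form that vanishes at the pole of [a] has proportional values at the ends of [a], with
     the positive factor [r]. This is applied to [h] and [g] if the pole is [P], and to [z]
     otherwise. *)
  pose r := - be / al.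
  have r0 : 0 < r.
    rewrite /r; case: (ltrP al 0) => a0.
      have b0 : 0 < be by rewrite -(nmulr_rlt0 _ a0).
      by rewrite mulNr oppr_gt0 pmulr_rlt0 ?invr_lt0.
    have {}a0 : 0 < al by rewrite lt_def an.
    have b0 : be < 0 by rewrite -(pmulr_rlt0 _ a0).
    by rewrite divr_gt0 // oppr_gt0.
  have ratio (k0 : vec -> R) : lin k0 -> k0 (p (f a)) = 0 -> k0 u = r * k0 v.
    move=> lk; rewrite E lk => e; apply: (mulfI an).
    have -> : al * (r * k0 v) = - (be * k0 v) by rewrite /r; field.
    by apply/eqP; rewrite -addr_eq0 e.
  clearbody r.
  have [fa|fa] := eqVneq (f a) i0.
    constructor 1; have hu : h u = r * h v by apply: ratio => //; rewrite fa /h det3E; ring.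
    have gu : g u = r * g v by apply: ratio => //; rewrite fa /g det3E; ring.
    split; first by rewrite hu gu; ring.
    rewrite hu gu -!mulrA -mulrDr pmulr_rgt0 //.
    rewrite -!expr2; apply: sum_sqr_gt0 => -[hv gv].
    have v0 : (- z v) *: u + z u *: v = 0.
      by apply: (coords_inj co); rewrite ?lh ?lg ?lz -?/(h _) -?/(g _) -?/(z _) ?hu ?gu ?hv ?gv; ring.
    have [zv zu] := arc_end_indep v0.
    by apply: (dp v) => //; [apply: arc_end_sphere|apply: (coords_inj co) => //; apply/eqP; rewrite -oppr_eq0; apply/eqP].
  have zu : z u = r * z v by apply: ratio => //; apply: zq.
  have qin : p (f a) \in [seq p l | l <- enum 'I_k & l != i0].
    by apply/mapP; exists (f a) => //; rewrite mem_filter fa mem_enum.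
  case: (ltrgtP (z v) 0) => zv.
  + constructor 3; split; rewrite ?zu ?oppr_gt0 ?pmulr_rlt0 //.
    by exists (p (f a)) => //; exists al, be.
  + constructor 2; split; rewrite ?zu ?pmulr_rgt0 //.
    by exists (p (f a)) => //; exists al, be.
  + by constructor 4; rewrite zu zv mulr0.
- move=> q /plP[l li ->]; split; first exact: zq.
  case=> hq gq; apply: (dp (p l)) => //; first exact: sp.
  by apply: (coords_inj co) => //; apply: zq.
Qed.

Lemma same_side_of_SOD pl h g z : isSOD D -> cdiag arc_end pl h g z -> same_side arc_end h g z.
Proof.
move=> [_ sod] C c b t b' t' on on'.
have [_ _ _ [k k0 kE]] := cd_coords C.
rewrite !kE mulrACA -expr2 mulr_gt0 ?exprn_even_gt0 //.
have ends a s : endpts (D a) (arc_end a s) (arc_end a (~~ s)).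
  by rewrite /endpts /arc_end; case: s; case: (D a); [right|left].
by apply: (sod c b b' _ _ _ _ (ends b t) _ (ends b' t')); apply/on_arc_relInt.
Qed.

Lemma swirl_of_turns s ps : s <> [::] -> uniq s -> turns arc_end s ps -> isSwirl D s.
Proof.
move=> s0 us T; split => //; split => //; exists ps => a /T[t [t' [h1 h2 h3]]].
have ends b r : endpts (D b) (arc_end b r) (arc_end b (~~ r)).
  by rewrite /endpts /arc_end; case: r; case: (D b); [right|left].
exists (arc_end a t), (arc_end a (~~ t)), (arc_end (next s a) t'), (arc_end (next s a) (~~ t')).
split; first exact: ends.
split; first by apply/on_arc_relInt.
split; first exact: ends.
by split; first by apply/on_arc_relInt.
Qed.

Theorem lower_bounds k : (4 <= k)%N -> kOrientedAlign2 k D ->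
  atLeastSwirls D 6 /\ (9 <= n)%N /\ (isSOD D -> (11 <= n)%N).
Proof.
move=> hk /(cdiag_of_SD hk)[pl [h [g [z C]]]]; split; last first.
  split; first exact: nine_arcs C.
  by move=> /same_side_of_SOD/(_ C); apply: eleven_arcs C.
have [l [sl lP ln]] := six_swirls C.
exists (fun i : 'I_6 => nth [::] l i); split.
  move=> i; have [|s0 us [ps T]] := lP (nth [::] l i); first by rewrite mem_nth // sl.
  exact: swirl_of_turns T.
move=> i j; rewrite neq_ltn => /orP[] lt; first by apply: ln; rewrite lt ltn_ord.
by move/sameCycle_sym; apply: ln; rewrite lt ltn_ord.
Qed.
End FromSD.
End PoleGeometry.

(** * Examples *)

(** The examples have integer vertices up to scaling, so their properties become signs of integers,
    to be computed. *)
Definition ivec : Type := (int * int * int)%type.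
Definition idot (u v : ivec) : int := u.1.1 * v.1.1 + u.1.2 * v.1.2 + u.2 * v.2.
Definition icross (u v : ivec) : ivec :=
  (u.1.2 * v.2 - u.2 * v.1.2, u.2 * v.1.1 - u.1.1 * v.2, u.1.1 * v.1.2 - u.1.2 * v.1.1).
Definition idet (u v w : ivec) : int := idot (icross u v) w.

Section IntegerVectors.
Variable R : realType.
Local Notation vec := (vec R).

Definition iv (u : ivec) : vec := v3 u.1.1%:~R u.1.2%:~R u.2%:~R.

Lemma dot_iv u v : dot (iv u) (iv v) = (idot u v)%:~R.
Proof. by rewrite dotE !(cxE, cyE, czE) /idot !rmorphD !rmorphM. Qed.

Lemma cross_iv u v : cross (iv u) (iv v) = iv (icross u v).
Proof. by rewrite /cross /iv !(cxE, cyE, czE) /= !rmorphB !rmorphM. Qed.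

Lemma det3_iv u v w : det3 (iv u) (iv v) (iv w) = (idet u v w)%:~R.
Proof. by rewrite -dot_cross cross_iv dot_iv. Qed.

Lemma iv_eq0 u : iv u = 0 -> u = (0, 0, 0).
Proof.
case: u => [[a b] c] E0.
have /eqP := congr1 (@cx R) E0; rewrite cxE /cx mxE intr_eq0 => /eqP /= ->.
have /eqP := congr1 (@cy R) E0; rewrite cyE /cy mxE intr_eq0 => /eqP /= ->.
by have /eqP := congr1 (@cz R) E0; rewrite czE /cz mxE intr_eq0 => /eqP /= ->.
Qed.

Lemma indep_cross (x y : vec) : cross x y != 0 -> indep x y.
Proof.
move=> nz a b E0.
have H (f : vec -> R) : lin f -> a * f x + b * f y = 0.
  by move=> lf; rewrite -lf E0 lin0.
have Hx := H _ (@lin_cx R); have Hy := H _ (@lin_cy R); have Hz := H _ (@lin_cz R).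
have C0 (c : R) : c *: cross x y = 0 -> c = 0.
  move=> e; apply/eqP; apply: contraT => c0; case/eqP: nz.
  by move/eqP: e; rewrite scaler_eq0 (negbTE c0) /= => /eqP.
split; apply: C0; apply: (coords_inj (xyz_coords R));
  rewrite ?(linZ _ _ (@lin_cx R)) ?(linZ _ _ (@lin_cy R)) ?(linZ _ _ (@lin_cz R)) !(cxE, cyE, czE).
- apply: (@eq_trans _ _ ((a * cy x + b * cy y) * cz y - (a * cz x + b * cz y) * cy y)); first by ring.
  by rewrite Hy Hz; ring.
- apply: (@eq_trans _ _ ((a * cz x + b * cz y) * cx y - (a * cx x + b * cx y) * cz y)); first by ring.
  by rewrite Hx Hz; ring.
- apply: (@eq_trans _ _ ((a * cx x + b * cx y) * cy y - (a * cy x + b * cy y) * cx y)); first by ring.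
  by rewrite Hx Hy; ring.
- apply: (@eq_trans _ _ ((a * cz x + b * cz y) * cy x - (a * cy x + b * cy y) * cz x)); first by ring.
  by rewrite Hy Hz; ring.
- apply: (@eq_trans _ _ ((a * cx x + b * cx y) * cz x - (a * cz x + b * cz y) * cx x)); first by ring.
  by rewrite Hx Hz; ring.
- apply: (@eq_trans _ _ ((a * cy x + b * cy y) * cx x - (a * cx x + b * cx y) * cy x)); first by ring.
  by rewrite Hx Hy; ring.
Qed.

Lemma indep_iv u v : icross u v != (0, 0, 0) -> indep (iv u) (iv v).
Proof.
by move=> nz; apply: indep_cross; rewrite cross_iv; apply: contra nz => /eqP/iv_eq0 ->.
Qed.

(* The coefficients of [x] in the basis [u, v] of its plane, up to the factor |u x v|^2. *)
Lemma combo_iv u v x : icross u v != (0, 0, 0) -> idet u v x = 0 ->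
  exists a b : R, [/\ iv x = a *: iv u + b *: iv v,
    (0 < a) = (0 < idot (icross x v) (icross u v)), (0 < b) = (0 < idot (icross u x) (icross u v)) &
    (a * b < 0) = (idot (icross x v) (icross u v) * idot (icross u x) (icross u v) < 0)].
Proof.
move=> nz d0; have ind := indep_iv nz.
have [|a [b E]] := form_det_span (xyz_coords R) ind (w := iv x).
  by rewrite /form_det -det3E det3_iv d0.
pose w := cross (iv u) (iv v).
have ww : 0 < dot w w by apply/dot_gt0/cross_neq0.
have ea : a * dot w w = (idot (icross x v) (icross u v))%:~R.
  rewrite -dot_iv -!cross_iv E /w !dotE /cross !(cxE, cyE, czE, lin_cx, lin_cy, lin_cz); ring.
have eb : b * dot w w = (idot (icross u x) (icross u v))%:~R.
  rewrite -dot_iv -!cross_iv E /w !dotE /cross !(cxE, cyE, czE, lin_cx, lin_cy, lin_cz); ring.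
exists a, b; split => //.
- by rewrite -(pmulr_lgt0 a ww) ea ltr0z.
- by rewrite -(pmulr_lgt0 b ww) eb ltr0z.
- by rewrite -(pmulr_llt0 (a * b) (mulr_gt0 ww ww)) mulrACA ea eb -rmorphM ltrz0.
Qed.

Definition on_open u v x := [&& idet u v x == 0, 0 < idot (icross x v) (icross u v) &
  0 < idot (icross u x) (icross u v)].

Lemma on_open_inner u v x : icross u v != (0, 0, 0) -> on_open u v x -> inner (iv u) (iv v) (iv x).
Proof.
move=> nz /and3P[/eqP d0 h1 h2]; have [a [b [E a0 b0 _]]] := combo_iv nz d0.
by exists a, b; rewrite a0 b0.
Qed.

(** Since the cones are open, weak separation suffices as soon as one of the four ends is off the
    plane. *)
Definition separates w (u v u' v' : ivec) := [&& 0 <= idot w u, 0 <= idot w v, idot w u' <= 0, idot w v' <= 0 &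
  [|| 0 < idot w u, 0 < idot w v, idot w u' < 0 | idot w v' < 0]].

Lemma separates_disj w u v u' v' x : separates w u v u' v' ->
  inner (iv u) (iv v) x -> inner (iv u') (iv v') x -> False.
Proof.
move=> /and5P[h1 h2 h3 h4 h5] [a [b [a0 b0 E]]] [a' [b' [a'0 b'0 E']]].
have e1 : dot (iv w) x = a * (idot w u)%:~R + b * (idot w v)%:~R by rewrite E dot_lin !dot_iv.
have e2 : dot (iv w) x = a' * (idot w u')%:~R + b' * (idot w v')%:~R by rewrite E' dot_lin !dot_iv.
have k1 : 0 <= a * (idot w u)%:~R by rewrite pmulr_rge0 // ler0z.
have k2 : 0 <= b * (idot w v)%:~R by rewrite pmulr_rge0 // ler0z.
have k3 : a' * (idot w u')%:~R <= 0 by rewrite pmulr_rle0 // lerz0.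
have k4 : b' * (idot w v')%:~R <= 0 by rewrite pmulr_rle0 // lerz0.
have k5 : [\/ 0 < a * (idot w u)%:~R, 0 < b * (idot w v)%:~R, a' * (idot w u')%:~R < 0 | b' * (idot w v')%:~R < 0].
  by case/or4P: h5 => h; [constructor 1|constructor 2|constructor 3|constructor 4];
    rewrite ?pmulr_rgt0 ?pmulr_rlt0 ?ltr0z ?ltrz0.
rewrite e1 in e2; move: k1 k2 k3 k4 k5 e2.
move: (a * _) (b * _) (a' * _) (b' * _) => p q r s {h1 h2 h3 h4 h5 E E'} h1 h2 h3 h4 [] h5 e; lra.
Qed.

Definition nrm (x : vec) : vec := (Num.sqrt (dot x x))^-1 *: x.

Lemma nrm_scale x : x != 0 -> exists2 c, 0 < c & nrm x = c *: x.
Proof.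
move=> x0; exists (Num.sqrt (dot x x))^-1 => //.
by rewrite invr_gt0 sqrtr_gt0 dot_gt0.
Qed.

Lemma nrm_sphere x : x != 0 -> onSphere (nrm x).
Proof.
move=> x0; have [c c0 E] := nrm_scale x0.
rewrite /onSphere /nrm !(linZ _ _ (dot_lin _)) dotC !(linZ _ _ (dot_lin _)) mulrA -expr2 exprVn.
have xx := dot_gt0 x0.
by rewrite sqr_sqrtr ?ltW // mulVf // gt_eqF.
Qed.

Lemma det3_scale (a b c : R) x y w : det3 (a *: x) (b *: y) (c *: w) = a * b * c * det3 x y w.
Proof. by rewrite !det3E !(linZ _ _ (@lin_cx R)) !(linZ _ _ (@lin_cy R)) !(linZ _ _ (@lin_cz R)); ring. Qed.

Lemma inner_scale (a b c : R) u v x : 0 < a -> 0 < b -> 0 < c ->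
  inner (a *: u) (b *: v) (c *: x) <-> inner u v x.
Proof.
move=> a0 b0 c0; split=> -[p [q [p0 q0 E]]].
  exists (c^-1 * p * a), (c^-1 * q * b); rewrite !mulr_gt0 ?invr_gt0 //; split => //.
  by rewrite -[x]scale1r -(mulVf (lt0r_neq0 c0)) -scalerA E scalerDr !scalerA ?mulrA.
exists (c * p / a), (c * q / b); rewrite !divr_gt0 ?mulr_gt0 //; split => //.
by rewrite !scalerA !divfK ?lt0r_neq0 // E scalerDr !scalerA.
Qed.
End IntegerVectors.

(** * Poles with the required alignment, for every [k] *)

Section Poles.
Variable R : realType.
Local Notation vec := (vec R).

(** Pole 0 is the apex; the others are on the equator, in pairwise different directions. The arcs of
    the examples use the first four only, so the same diagrams serve for all [k]. *)
Definition pole_vec (j : nat) : ivec :=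
  match j with 0 => (0, 0, 1) | 1 => (0, 1, 0) | j'.+2 => (1, j'%:Z, 0) end.

Lemma pole_cross i j : i != j -> icross (pole_vec i) (pole_vec j) != (0, 0, 0).
Proof.
case: i j => [|[|i]] [|[|j]] //= ij; rewrite /icross /= !xpair_eqE !(mul0r, mulr0, mul1r, mulr1, subr0, sub0r) //=.
- by rewrite oner_eq0 andbF.
- by rewrite oppr_eq0 oner_eq0 andbF.
- by rewrite subr_eq0 eqz_nat eq_sym.
Qed.

Lemma pole_det i j : 0 != i -> 0 != j -> i != j -> idet (pole_vec 0) (pole_vec i) (pole_vec j) != 0.
Proof.
case: i j => [|[|i]] [|[|j]] //= _ _ ij; rewrite /idet /icross /idot /= !(mul0r, mulr0, mul1r, mulr1, subr0, sub0r, addr0, add0r) //=.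
by rewrite addrC subr_eq0 eqz_nat; move: ij; rewrite !eqSS eq_sym.
Qed.

Lemma pole_z j : (0 < j)%N -> (pole_vec j).2 = 0.
Proof. by case: j => [|[|j]]. Qed.

Variable k : nat.
Hypothesis hk : (4 <= k)%N.

Definition pole (i : 'I_k) : vec := nrm (iv R (pole_vec i)).

Lemma pole_neq0 i : iv R (pole_vec i) != 0.
Proof. by apply/eqP => /iv_eq0; case: i => [|[|j]]. Qed.

Lemma pole_scale i : exists2 c, 0 < c & pole i = c *: iv R (pole_vec i).
Proof. exact/nrm_scale/pole_neq0. Qed.

Lemma pole_sphere i : onSphere (pole i).
Proof. exact/nrm_sphere/pole_neq0. Qed.

Lemma dot_pole nv i : (dot nv (pole i) == 0) = (dot nv (iv R (pole_vec i)) == 0).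
Proof.
by have [c c0 ->] := pole_scale i; rewrite (linZ _ _ (dot_lin _)) mulf_eq0 gt_eqF.
Qed.

Lemma pole_indep i j : i != j -> indep (pole i) (pole j).
Proof.
move=> ij; have ind : indep (iv R _) (iv R _) := indep_iv (pole_cross ij).
have [c c0 ->] := pole_scale i; have [d d0 ->] := pole_scale j.
move=> a b; rewrite !scalerA => /ind[/eqP e1 /eqP e2]; move: e1 e2.
by rewrite !mulf_eq0 !(gt_eqF c0) !(gt_eqF d0) !orbF => /eqP -> /eqP ->.
Qed.

Lemma pole_inj : injective pole.
Proof.
move=> i j E; apply/eqP; apply: contraT => ij.
have [|/eqP] := @pole_indep i j ij 1 (- 1); last by rewrite oner_eq0.
by rewrite E scaleN1r scale1r subrr.
Qed.

Lemma pole_antipode i j : pole i <> - pole j.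
Proof.
move=> E; have [ij|ij] := eqVneq i j.
  have /eqP : pole j = 0.
    by apply: (coords_inj (xyz_coords R)); move: E; rewrite ij => E;
      [have := congr1 (@cx R) E; rewrite (linN _ (@lin_cx R))
      |have := congr1 (@cy R) E; rewrite (linN _ (@lin_cy R))
      |have := congr1 (@cz R) E; rewrite (linN _ (@lin_cz R))]; clear; lra.
  have [c c0 ->] := pole_scale j; rewrite scaler_eq0 gt_eqF //=; exact/negP/pole_neq0.
have [|/eqP] := @pole_indep i j ij 1 1; last by rewrite oner_eq0.
by rewrite E !scale1r addNr.
Qed.

Lemma pole_normal i j : i != j -> cross (pole i) (pole j) != 0.
Proof. by move=> ij; apply/cross_neq0/pole_indep. Qed.

Let i0 : 'I_k := Ordinal (leq_trans (isT : 0 < 4)%N hk).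

Lemma circles_apex : numCircles pole i0 k.-1.
Proof.
have ok (t : 'I_k.-1) : (t.+1 < k)%N by rewrite -ltn_predRL.
pose j t : 'I_k := Ordinal (ok t).
have ij t : i0 != j t by [].
exists (fun t => cross (pole i0) (pole (j t))); split; [|split; [|split]].
- by move=> t; apply: pole_normal.
- move=> t t' tt /(_ (pole (j t)))[H _]; have [|_] := H.
    by split; [exact: pole_sphere|rewrite dot_cross det3_vv].
  move/eqP; rewrite dot_pole.
  have [c c0 ->] := pole_scale i0; have [d d0 ->] := pole_scale (j t').
  rewrite dot_cross -[iv R (pole_vec (j t))]scale1r det3_scale mulr1 mulf_eq0 gt_eqF ?mulr_gt0 //=.
  by rewrite det3_iv intr_eq0; apply/negP; apply: (@pole_det t'.+1 t.+1); rewrite // eqSS eq_sym.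
- move=> t; split; first by split; [exact: pole_sphere|rewrite dot_cross det3_uu].
  exists (j t); split; first by rewrite eq_sym.
  by split; [exact: pole_sphere|rewrite dot_cross det3_vv].
- move=> nv n0 [_ h1] [l [li [_ h2]]].
  have l0 : (0 < l)%N by rewrite lt0n; apply: contra li => /eqP e; apply/eqP/val_inj.
  have lk : (l.-1 < k.-1)%N by rewrite ltn_predRL prednK.
  exists (Ordinal lk).
  have E : j (Ordinal lk) = l by apply: val_inj; rewrite /= prednK.
  rewrite E; have il : i0 != l by rewrite eq_sym.
  apply: (sameSet_normals (pole_indep il)) => //; first exact: pole_normal.
    by rewrite dot_cross det3_uu.
  by rewrite dot_cross det3_vv.
Qed.

(** The two circles are the equator and the meridian through the apex. *)
Lemma circles_base i : i != i0 -> numCircles pole i 2.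
Proof.
move=> ii; have ii' : i0 != i by rewrite eq_sym.
have pos_i l : l != i0 -> (0 < l)%N by move=> li; rewrite lt0n; apply: contra li => /eqP e; apply/eqP/val_inj.
pose eqn : vec := iv R (0, 0, 1).
have eqn0 : eqn != 0 by apply/eqP => /iv_eq0.
have on_eq l : l != i0 -> dot eqn (pole l) = 0.
  move=> /pos_i li; apply/eqP; rewrite dot_pole dot_iv /idot /= pole_z // mulr0 !mul0r !addr0 //.
have apex_eq : dot eqn (pole i0) != 0 by rewrite dot_pole dot_iv intr_eq0.
have [l1 [l1i l10]] : exists l1, l1 != i /\ l1 != i0.
  have : (0 < #|~: [set i; i0]|)%N.
    by have := cardsC [set i; i0]; rewrite cards2 ii card_ord; clear -hk; lia.
  by rewrite card_gt0 => /set0Pn[l]; rewrite !inE negb_or => /andP[? ?]; exists l.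
pose ns (t : 'I_2) := if t == 0 then eqn else cross (pole i) (pole i0).
have nsE t : ns t = eqn \/ ns t = cross (pole i) (pole i0) by rewrite /ns; case: ifP; [left|right].
exists ns; split; [|split; [|split]].
- by move=> t; case: (nsE t) => -> //; apply: pole_normal.
- have ne : ~ sameSet (greatCircle eqn) (greatCircle (cross (pole i) (pole i0))).
    move=> /(_ (pole i0))[_ H]; have [|_ /eqP] := H; last by apply/negP.
    by split; [exact: pole_sphere|rewrite dot_cross det3_vv].
  move=> t t' tt; have : (t == 0) != (t' == 0).
    by case: t t' tt => [[|[|//]] ?] [[|[|//]] ?].
  rewrite /ns; case: (t == 0); case: (t' == 0) => // _ H; apply: ne => // x.
  by split=> /H.
- move=> t; case: (nsE t) => ->; split.
  + by split; [exact: pole_sphere|exact: on_eq].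
  + by exists l1; split => //; split; [exact: pole_sphere|exact: on_eq].
  + by split; [exact: pole_sphere|rewrite dot_cross det3_uu].
  + by exists i0; split => //; split; [exact: pole_sphere|rewrite dot_cross det3_vv].
- move=> nv n0 [_ h1] [l [li [_ h2]]]; have il : i != l by rewrite eq_sym.
  have [l0|l0] := eqVneq l i0.
    exists 1; rewrite /ns /=; rewrite l0 in h2.
    apply: (sameSet_normals (pole_indep ii)) => //; first exact: pole_normal.
      by rewrite dot_cross det3_uu.
    by rewrite dot_cross det3_vv.
  by exists 0; rewrite /ns /=; apply: (sameSet_normals (pole_indep il)); rewrite // on_eq.
Qed.

Lemma oriented_by_poles n (D : 'I_n -> garc R) (f : 'I_n -> 'I_k) :
  (forall a, arcOnCircleThrough (D a) (pole (f a)) /\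
        ~ arcContains (D a) (pole (f a)) /\ ~ arcContains (D a) (- pole (f a))) ->
  kOrientedAlign2 k D.
Proof.
move=> fP; exists pole; split; first exact: pole_sphere.
split; first exact: pole_inj.
split; first exact: pole_antipode.
split; first by exists f.
by exists i0; split; [exact: circles_apex|exact: circles_base].
Qed.
End Poles.

(** * Decidable conditions for diagrams with integer vertices *)

Section Example.
Variables (N : nat) (raw : nat -> bool -> ivec) (bl : nat -> bool -> nat) (pl : nat -> nat) (sws : seq (seq nat)).
Local Notation n := N.+1.
Local Notation bools := [:: false; true].
Local Notation all_arcs := (iota 0 n).

Definition chk_arcs := all (fun i => icross (raw i false) (raw i true) != (0, 0, 0)) all_arcs.

(* If two open cones are disjoint, they are separated by a plane through two of the four ends. *)
Definition separators i j :=
  let l := [:: raw i false; raw i true; raw j false; raw j true] in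
  flatten [seq [seq icross x y | y <- l] | x <- l].

Definition chk_disj := all (fun j => all (fun i =>
  has (fun w => separates w (raw i false) (raw i true) (raw j false) (raw j true)) (separators i j))
  (iota 0 j)) all_arcs.

Definition chk_block := all (fun i => (bl i false != bl i true) &&
  all (fun t => (bl i t < n)%N && on_open (raw (bl i t) false) (raw (bl i t) true) (raw i t)) bools) all_arcs.

Definition sgn (pos : bool) (x : int) := if pos then 0 < x else x < 0.
Definition turn_det i t t' := idet (raw i (~~ t)) (raw i t) (raw (bl i t) t').
(** A state is an arc with the end at which it hits. The next end is [false] if this gives the
    required turn, and [true] otherwise; by [chk_turns] no other end is possible. *)
Definition nxt pos (st : nat * bool) :=
  (bl st.1 st.2, ~~ sgn pos (turn_det st.1 st.2 false)).
Definition cyc pos m st := [seq x.1 | x <- traject (nxt pos) st m].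

Definition chk_turns := all (fun i => all (fun t => all (fun pos =>
  ~~ (sgn pos (turn_det i t false) && sgn pos (turn_det i t true))) bools) bools) all_arcs.

(* The end of an arc and the direction of the turn determine the next arc and its end, so swirls are periodic
   orbits of [nxt]. *)
Definition chk_all_swirls := all (fun pos => all (fun i => all (fun t => all (fun m =>
  (iter m (nxt pos) (i, t) == (i, t)) ==> uniq (cyc pos m (i, t)) ==>
  has (fun w => has (fun r => w == rot r (cyc pos m (i, t))) (iota 0 m)) sws)
  (iota 1 n)) bools) all_arcs) bools.

Definition chk_swirls := all (fun w => [&& w != [::], uniq w, all (fun a => (a < n)%N) w &
  has (fun pos => all (fun a => has (fun t => has (fun t' =>
    [&& bl a t == next w a, bl (next w a) t' == next w (next w a) & sgn pos (turn_det a t t')])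
    bools) bools) w) bools]) sws.

(** Rotation preserves the set of arcs, so different sets give different cycles. *)
Definition chk_distinct := (size sws == 6%N) && pairwise (fun w w' => ~~ perm_eq w w') sws.

(** The sign condition says that the coefficients of the pole over the two ends are opposite in
    sign, so neither it nor its antipode is on the arc. *)
Definition chk_poles := all (fun i => let q := pole_vec (pl i) in
  [&& (pl i < 4)%N, idet (raw i false) (raw i true) q == 0 &
   idot (icross q (raw i true)) (icross (raw i false) (raw i true)) *
   idot (icross (raw i false) q) (icross (raw i false) (raw i true)) < 0]) all_arcs.

Definition chk_sides := all (fun i => all (fun t => all (fun i' => all (fun t' =>
  (bl i t == bl i' t') ==>
  (0 < idet (raw (bl i t) false) (raw (bl i t) true) (raw i (~~ t)) *
       idet (raw (bl i t) false) (raw (bl i t) true) (raw i' (~~ t')))) bools) all_arcs) bools) all_arcs.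

Hypothesis arcsP : chk_arcs.
Hypothesis disjP : chk_disj.
Hypothesis blockP : chk_block.

Variable R : realType.
Local Notation vec := (vec R).
Definition rawv (i : nat) t : vec := iv R (raw i t).
Definition diagram (a : 'I_n) : garc R := (nrm (rawv a false), nrm (rawv a true)).
Local Notation D := diagram.

Let mem_arcs (a : 'I_n) : (a : nat) \in all_arcs.
Proof. by rewrite mem_iota /= add0n. Qed.

Let mem_bools (t : bool) : t \in bools.
Proof. by case: t. Qed.

Lemma raw_cross (a : 'I_n) : icross (raw a false) (raw a true) != (0, 0, 0).
Proof. exact: (allP arcsP). Qed.

Lemma rawv_indep (a : 'I_n) : indep (rawv a false) (rawv a true).
Proof. exact/indep_iv/raw_cross. Qed.

Lemma rawv_neq0 (a : 'I_n) t : rawv a t != 0.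
Proof.
have ind := @rawv_indep a; apply/eqP; case: t => e; rewrite e in ind.
  by have [|_ /eqP] := ind 0 1; rewrite ?scale0r ?scaler0 ?addr0 // oner_eq0.
by have [|/eqP] := ind 1 0; rewrite ?scale0r ?scaler0 ?addr0 // oner_eq0.
Qed.

Lemma nrm_rawv (a : 'I_n) t : exists2 c, 0 < c & nrm (rawv a t) = c *: rawv a t.
Proof. exact/nrm_scale/rawv_neq0. Qed.

Lemma arc_endE (a : 'I_n) t : arc_end D a t = nrm (rawv a t).
Proof. by case: t. Qed.

Lemma arc_end_raw (a : 'I_n) x : inner (arc_end D a false) (arc_end D a true) x <->
  inner (rawv a false) (rawv a true) x.
Proof.
rewrite !arc_endE; have [c c0 ->] := nrm_rawv a false; have [d d0 ->] := nrm_rawv a true.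
by rewrite -{1}[x]scale1r; apply: inner_scale.
Qed.

Lemma rawv_disj (a b : 'I_n) x : a != b -> inner (rawv a false) (rawv a true) x ->
  inner (rawv b false) (rawv b true) x -> False.
Proof.
wlog ab : a b / (a < b)%N.
  move=> H; rewrite neq_ltn => /orP[] lt ha hb; [apply: (H a b)|apply: (H b a)] => //; by rewrite neq_ltn lt ?orbT.
move=> _; have ab' : (a : nat) \in iota 0 b by rewrite mem_iota add0n.
have : has (fun w => separates w (raw a false) (raw a true) (raw b false) (raw b true)) (separators a b).
  exact: (allP (allP disjP _ (mem_arcs b)) _ ab').
by move=> /hasP[w _]; apply: separates_disj.
Qed.

Lemma bl_lt (a : 'I_n) t : (bl a t < n)%N.
Proof. by have /andP[_ /allP/(_ t (mem_bools t))/andP[]] := allP blockP _ (mem_arcs a). Qed.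

Lemma bl_neq (a : 'I_n) t t' : bl a t = bl a t' -> t = t'.
Proof.
by have /andP[ne _] := allP blockP _ (mem_arcs a); case: t t' => [] [] // e; move: ne; rewrite e eqxx.
Qed.

Lemma bl_inner (a b : 'I_n) t : (b : nat) = bl a t -> inner (rawv b false) (rawv b true) (rawv a t).
Proof.
move=> e; apply: on_open_inner; first exact: raw_cross.
by rewrite e; have /andP[_ /allP/(_ t (mem_bools t))/andP[]] := allP blockP _ (mem_arcs a).
Qed.

(** The blocker of an end is unique because the interiors of arcs are disjoint; so the table [bl]
    describes all hits. *)
Lemma relInt_bl (a b : 'I_n) t : relInt (D b) (arc_end D a t) <-> (b : nat) = bl a t.
Proof.
have S : onSphere (arc_end D a t) by rewrite arc_endE; apply/nrm_sphere/rawv_neq0.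
have IE c : inner (rawv c false) (rawv c true) (arc_end D a t) <-> inner (rawv c false) (rawv c true) (rawv a t).
  rewrite arc_endE; have [d d0 ->] := nrm_rawv a t.
  by rewrite -{1}[rawv c false]scale1r -{1}[rawv c true]scale1r; apply: inner_scale.
have RI c : relInt (D c) (arc_end D a t) <-> inner (arc_end D c false) (arc_end D c true) (arc_end D a t).
  by split=> [[_ [p [q [p0 [q0 e]]]]]|[p [q [p0 q0 e]]]]; [exists p, q|split => //; exists p, q].
split=> [/RI/arc_end_raw/IE onb|e]; last by apply/RI/arc_end_raw/IE/bl_inner.
pose c : 'I_n := Ordinal (bl_lt a t).
have onc : inner (rawv c false) (rawv c true) (rawv a t) by apply: bl_inner.
have [->//|bc] := eqVneq b c.
by case: (rawv_disj bc onb onc).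
Qed.

Lemma diagram_SD : isSD D.
Proof.
split => //; split; [|split].
- move=> a; have S t : onSphere (nrm (rawv a t)) by apply/nrm_sphere/rawv_neq0.
  split; first exact: S. split; first exact: S.
  have [c c0 E] := nrm_rawv a false; have [d d0 E'] := nrm_rawv a true.
  have ind := @rawv_indep a; split=> /=; rewrite E E' => e.
    have [|/eqP] := ind c (- d); last by rewrite gt_eqF.
    by rewrite scaleNr e subrr.
  have [|/eqP] := ind c d; last by rewrite gt_eqF.
  by rewrite e addNr.
- move=> a b ab x [[_ [p [q [p0 [q0 e]]]]] [_ [p' [q' [p'0 [q'0 e']]]]]].
  apply: (@rawv_disj a b x ab); apply/arc_end_raw; [by exists p, q|by exists p', q'].
- move=> b; split.
    by exists (Ordinal (bl_lt b false)); apply/(@relInt_bl b _ false).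
  by exists (Ordinal (bl_lt b true)); apply/(@relInt_bl b _ true).
Qed.

Lemma endptsP (a : 'I_n) e w : endpts (D a) e w <-> exists t, e = arc_end D a t /\ w = arc_end D a (~~ t).
Proof.
split; last by move=> [[] [-> ->]]; [right|left].
by case=> -[-> ->]; [exists false|exists true].
Qed.

Lemma det3_sign (a b c : 'I_n) t t' t'' pos :
  (if pos then 0 < det3 (arc_end D a t) (arc_end D b t') (arc_end D c t'')
          else det3 (arc_end D a t) (arc_end D b t') (arc_end D c t'') < 0) =
  sgn pos (idet (raw a t) (raw b t') (raw c t'')).
Proof.
rewrite !arc_endE; have [x x0 ->] := nrm_rawv a t; have [y y0 ->] := nrm_rawv b t'.
have [z z0 ->] := nrm_rawv c t''; rewrite det3_scale det3_iv /sgn.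
by rewrite pmulr_rgt0 ?pmulr_rlt0 ?mulr_gt0 // ltr0z ltrz0.
Qed.

Lemma turnSignP (a b c : 'I_n) pos : turnSign D a b c pos <-> exists t t',
  [/\ (b : nat) = bl a t, (c : nat) = bl b t' & sgn pos (turn_det a t t')].
Proof.
split.
  move=> [e [w [f [w' [/endptsP[t [-> ->]] [/relInt_bl e1 [/endptsP[t' [-> _]] [/relInt_bl e2]]]]]]]].
  by rewrite det3_sign => s; exists t, t'; rewrite /turn_det -e1.
move=> [t [t' [e1 e2 s]]].
exists (arc_end D a t), (arc_end D a (~~ t)), (arc_end D b t'), (arc_end D b (~~ t')).
split; first by apply/endptsP; exists t.
split; first exact/relInt_bl.
split; first by apply/endptsP; exists t'.
by split; [exact/relInt_bl|rewrite det3_sign e1].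
Qed.

Hypothesis turnsP : chk_turns.
Hypothesis listedP : chk_all_swirls.
Hypothesis swirlsP : chk_swirls.
Hypothesis distP : chk_distinct.

Lemma traject_next (T : eqType) (x : T) (s : seq T) : uniq (x :: s) ->
  x :: s = traject (next (x :: s)) x (size s).+1 /\ iter (size s).+1 (next (x :: s)) x = x.
Proof.
move=> us; have := cycle_next us; set f := next (x :: s) => /fpathP[m E].
have sm : m = (size s).+1 by rewrite -(size_traject f (f x) m) -E size_rcons.
move: E; rewrite sm trajectSr => /eqP; rewrite eqseq_rcons => /andP[/eqP e1 /eqP e2].
by rewrite iterSr -e2 /= -e1.
Qed.

Lemma turnSign_state (a b c : 'I_n) pos t : turnSign D a b c pos -> (b : nat) = bl a t ->
  exists t', nxt pos (a : nat, t) = (b : nat, t') /\ (c : nat) = bl b t'.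
Proof.
move=> /turnSignP[t1 [t' [e1 e2 s]]] e; have tt : t1 = t by apply: (@bl_neq a); rewrite -e1 -e.
rewrite {}tt in s e1; exists t'; split => //; rewrite /nxt -e; congr (_, _) => /=.
have := allP turnsP _ (mem_arcs a) => /allP/(_ t (mem_bools t))/allP/(_ pos (mem_bools pos)).
by case: t' s {e2} => s; rewrite ?s ?andbT.
Qed.

(** An arc hits its successor with only one end, by [bl_neq]. So a swirl is followed by the iterates
    of [nxt], and after one round the end as well as the arc is the initial one. *)
Lemma swirl_listed (s : seq 'I_n) : isSwirl D s ->
  exists2 w, w \in sws & exists r, w = rot r (map val s).
Proof.
case: s => [|a0 s0] [s_nil [us [pos H]]] //; set s := a0 :: s0 in us H *.
have [sE sI] := traject_next us; rewrite -/s in sE sI.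
set f := next s in sE sI H.
have iter_s i : iter i f a0 \in s.
  by elim: i => [|i IH]; [rewrite inE eqxx|rewrite iterS /f mem_next].
have /turnSignP[t0 [_ [b0 _ _]]] := H a0 (iter_s 0%N).
have st i : exists t, iter i (nxt pos) (a0 : nat, t0) = (iter i f a0 : nat, t) /\
    (iter i.+1 f a0 : nat) = bl (iter i f a0) t.
  elim: i => [|i [t [e1 e2]]]; first by exists t0.
  have [t' [e3 e4]] := turnSign_state (H _ (iter_s i)) e2.
  by exists t'; rewrite iterS e1 e3.
pose m := (size s0).+1.
have cycE : cyc pos m (a0 : nat, t0) = map val s.
  apply: (@eq_from_nth _ 0%N); first by rewrite !size_map size_traject.
  move=> i; rewrite size_map size_traject => im.
  rewrite /cyc (nth_map (a0 : nat, t0)) ?size_traject // nth_traject //.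
  rewrite (nth_map a0) //.
  have -> : nth a0 s i = iter i f a0 by rewrite [in LHS]sE nth_traject.
  by have [t [-> _]] := st i.
have back : iter m (nxt pos) (a0 : nat, t0) = (a0 : nat, t0).
  have [t [-> e2]] := st m; rewrite sI in e2 *; rewrite iterS sI in e2.
  by congr (_, _); apply: (@bl_neq a0); rewrite -e2 -b0.
have mn : (m \in iota 1 n).
  rewrite mem_iota /= add1n ltnS; exact: (uniq_size_ord us).
have Hc : (iter m (nxt pos) (a0 : nat, t0) == (a0 : nat, t0)) ==> uniq (cyc pos m (a0 : nat, t0)) ==>
    has (fun w => has (fun r => w == rot r (cyc pos m (a0 : nat, t0))) (iota 0 m)) sws.
  exact: (allP (allP (allP (allP listedP _ (mem_bools pos)) _ (mem_arcs a0)) _ (mem_bools t0)) _ mn).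
have uc : uniq (cyc pos m (a0 : nat, t0)) by rewrite cycE map_inj_uniq //; exact: val_inj.
move: Hc; rewrite back eqxx uc !implyTb => /hasP[w ws /hasP[r _ /eqP wE]].
by exists w => //; exists r; rewrite wE cycE.
Qed.

Definition ord_seq (w : seq nat) : seq 'I_n := map inord w.

Lemma val_ord_seq w : all (fun a => (a < n)%N) w -> map val (ord_seq w) = w.
Proof. by move=> /allP wn; rewrite -map_comp map_id_in // => a /wn an; rewrite /= inordK. Qed.

Lemma listed_swirl w : w \in sws -> isSwirl D (ord_seq w) /\ map val (ord_seq w) = w.
Proof.
move=> ws; have /and4P[w0 uw wn /hasP[pos _ /allP H]] := allP swirlsP _ ws.
have vE := val_ord_seq wn; split => //.
split; first by move=> e; move: w0; rewrite -vE e.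
split; first by rewrite -(map_inj_uniq val_inj) vE.
exists pos => a as_; apply/turnSignP.
have nx x : next w (val x) = val (next (ord_seq w) x) by rewrite -{1}vE (next_map val_inj) // -(map_inj_uniq val_inj) vE.
have aw : val a \in w by rewrite -vE map_f.
have : has (fun t => has (fun t' => [&& bl (val a) t == next w (val a),
    bl (next w (val a)) t' == next w (next w (val a)) & sgn pos (turn_det (val a) t t')]) bools) bools.
  exact: H.
move=> /hasP[t _ /hasP[t' _ /and3P[/eqP e1 /eqP e2 sg]]].
by exists t, t'; rewrite -!nx e1 e2.
Qed.

Lemma diagram_swirls : exactlySwirls D 6.
Proof.
have /andP[/eqP sz /(pairwiseP [::]) pw] := distP.
have mem i : (i < 6)%N -> nth [::] sws i \in sws by move=> i6; rewrite mem_nth // sz.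
exists (fun i : 'I_6 => ord_seq (nth [::] sws i)); split; [|split].
- by move=> i; case: (listed_swirl (mem i (ltn_ord i))).
- have D0 (i j : 'I_6) : (i < j)%N -> ~ sameCycle (ord_seq (nth [::] sws i)) (ord_seq (nth [::] sws j)).
    move=> ij [r e]; have := pw i j; rewrite !inE sz => /(_ (ltn_ord i) (ltn_ord j) ij)/negP; apply.
    have [_ <-] := listed_swirl (mem j (ltn_ord j)); have [_ E] := listed_swirl (mem i (ltn_ord i)).
    by rewrite e map_rot E perm_sym perm_rot.
  by move=> i j; rewrite neq_ltn => /orP[] lt; [exact: D0|move/sameCycle_sym; exact: D0].
- move=> s /swirl_listed[w ws [r e]].
  have iw : (index w sws < 6)%N by rewrite -sz index_mem.
  exists (Ordinal iw), r; rewrite /= nth_index //; apply: (inj_map val_inj).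
  by rewrite map_rot -e; case: (listed_swirl ws).
Qed.

Hypothesis polesP : chk_poles.

Lemma diagram_oriented k : (4 <= k)%N -> kOrientedAlign2 k D.
Proof.
move=> hk; have pk (a : 'I_n) : (pl a < k)%N.
  by have /and3P[p4 _ _] := allP polesP _ (mem_arcs a); apply: leq_trans hk.
apply: (@oriented_by_poles R k hk _ _ (fun a => Ordinal (pk a))) => a.
have /and3P[_ /eqP d0 ab] := allP polesP _ (mem_arcs a).
set q := pole_vec (pl a) in d0 ab.
have [x [y [E _ _ xy]]] := @combo_iv R _ _ _ (raw_cross a) d0.
rewrite ab in xy.
have [c c0 Ec] := @pole_scale R k (Ordinal (pk a)); rewrite /= -/q in Ec.
have [d1 d10 E1] := nrm_rawv a false; have [d2 d20 E2] := nrm_rawv a true.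
have no (s : R) : s != 0 -> ~ arcContains (D a) (s *: iv R q).
  move=> s0 [_ [p [p' [p0 [p'0 e]]]]]; rewrite /= E1 E2 E scalerDr !scalerA in e.
  have [|e1 e2] := @rawv_indep a (s * x - p * d1) (s * y - p' * d2).
    by rewrite !scalerBl addrACA -opprD -e subrr.
  have : 0 <= (s * x) * (s * y).
    by rewrite (subr0_eq e1) (subr0_eq e2) !mulr_ge0 // ltW.
  rewrite mulrACA -expr2 pmulr_rge0 ?lt_def ?sqr_ge0 ?expf_neq0 // leNgt xy //.
split; [|split].
- exists (cross (rawv a false) (rawv a true)); split; first exact/cross_neq0/rawv_indep.
  split.
    move=> v [sv [p [p' [_ [_ e]]]]]; split => //.
    by rewrite dot_cross e /= E1 E2 !scalerA -dot_cross dot_lin !dot_cross det3_uu det3_vv !mulr0 addr0.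
  by split; [exact: pole_sphere|rewrite Ec (linZ _ _ (dot_lin _)) dot_cross det3_iv d0 mulr0].
- by rewrite Ec; apply: no; rewrite gt_eqF.
- by rewrite Ec -scaleNr; apply: no; rewrite oppr_eq0 gt_eqF.
Qed.

Hypothesis sidesP : chk_sides.

Lemma diagram_SOD : isSOD D.
Proof.
split; first exact: diagram_SD.
move=> a b b' e w e' w' /endptsP[t [-> ->]] /relInt_bl e1 /endptsP[t' [-> ->]] /relInt_bl e2.
have := allP sidesP _ (mem_arcs b) => /allP/(_ t (mem_bools t))/allP/(_ _ (mem_arcs b'))/allP/(_ t' (mem_bools t')).
rewrite -e1 -e2 eqxx /= -!(arc_endE a) => pos.
have sg c s : exists2 k, 0 < k & det3 (D a).1 (D a).2 (arc_end D c s) = k * (idet (raw a false) (raw a true) (raw c s))%:~R.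
  have [x x0 Ex] := nrm_rawv a false; have [y y0 Ey] := nrm_rawv a true.
  have [z z0 Ez] := nrm_rawv c s; exists (x * y * z); first by rewrite !mulr_gt0.
  by rewrite arc_endE /= Ex Ey Ez det3_scale det3_iv.
have [k k0 ->] := sg b (~~ t); have [k' k'0 ->] := sg b' (~~ t').
by rewrite mulrACA -rmorphM mulr_gt0 ?mulr_gt0 // ltr0z.
Qed.
End Example.

Definition table_raw (l : seq (ivec * ivec)) i (t : bool) : ivec :=
  let a := nth ((0, 0, 0), (0, 0, 0)) l i in if t then a.2 else a.1.
Definition table_bl (l : seq (nat * nat)) i (t : bool) : nat :=
  let a := nth (0, 0)%N l i in if t then a.2 else a.1.

(* Both diagrams are symmetric about the equator. In the chart [z = 1] the slanted arcs of the first one are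
   the segments (2,1)(-1,1), (-1,2)(-1,-2) and (-2,-3)(3,2); the second one has the additional
   segment (-3/2,3)(-3/2,-5/2), which intercepts a vertical arc. *)
Definition arcs9 : seq (ivec * ivec) := [::
  ((2, 1, 1), (-1, 1, 1));
  ((-1, 2, 1), (-1, -2, 1));
  ((-2, -3, 1), (3, 2, 1));
  ((2, 1, -1), (-1, 1, -1));
  ((-1, 2, -1), (-1, -2, -1));
  ((-2, -3, -1), (3, 2, -1));
  ((-1, 2, 2), (-1, 2, -2));
  ((-2, -3, 2), (-2, -3, -2));
  ((3, 2, 2), (3, 2, -2))].
Definition blockers9 : seq (nat * nat) := [:: (2, 1); (6, 2); (7, 8); (5, 4); (6, 5); (7, 8); (0, 3); (1, 4); (0, 3)]%N.
Definition poles9 : seq nat := [:: 2; 1; 3; 2; 1; 3; 0; 0; 0]%N.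
Definition swirls9 : seq (seq nat) := [:: [:: 0; 1; 6]; [:: 1; 2; 7]; [:: 3; 5; 8]; [:: 0; 2; 8]; [:: 3; 4; 6]; [:: 4; 5; 7]]%N.

Definition arcs11 : seq (ivec * ivec) := [::
  ((2, 1, 1), (-1, 1, 1));
  ((-1, 2, 1), (-1, -2, 1));
  ((-2, -3, 1), (3, 2, 1));
  ((-3, 6, 2), (-3, -5, 2));
  ((2, 1, -1), (-1, 1, -1));
  ((-1, 2, -1), (-1, -2, -1));
  ((-2, -3, -1), (3, 2, -1));
  ((-3, 6, -2), (-3, -5, -2));
  ((-1, 2, 2), (-1, 2, -2));
  ((-6, -9, 4), (-6, -9, -4));
  ((3, 2, 2), (3, 2, -2))].
Definition blockers11 : seq (nat * nat) := [:: (2, 1); (8, 2); (9, 10); (8, 2); (6, 5); (8, 6); (9, 10); (8, 6); (0, 4); (3, 7); (0, 4)]%N.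
Definition poles11 : seq nat := [:: 2; 1; 3; 1; 2; 1; 3; 1; 0; 0; 0]%N.
Definition swirls11 : seq (seq nat) := [:: [:: 0; 1; 8]; [:: 2; 9; 3]; [:: 4; 6; 10]; [:: 0; 2; 10]; [:: 4; 5; 8]; [:: 6; 9; 7]]%N.

Lemma nine_arc_example (R : realType) k : (4 <= k)%N -> exists D : 'I_9 -> garc R,
  isSD D /\ kOrientedAlign2 k D /\ exactlySwirls D 6.
Proof.
move=> hk; exists (@diagram 8 (table_raw arcs9) R); split; [|split].
- by apply: (@diagram_SD _ _ (table_bl blockers9)); vm_compute.
- by apply: (@diagram_oriented _ _ (nth 0%N poles9)) => //; vm_compute.
- by apply: (@diagram_swirls _ _ (table_bl blockers9) swirls9); vm_compute.
Qed.

Lemma eleven_arc_example (R : realType) k : (4 <= k)%N -> exists D : 'I_11 -> garc R,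
  isSOD D /\ kOrientedAlign2 k D /\ exactlySwirls D 6.
Proof.
move=> hk; exists (@diagram 10 (table_raw arcs11) R); split; [|split].
- by apply: (@diagram_SOD _ _ (table_bl blockers11)); vm_compute.
- by apply: (@diagram_oriented _ _ (nth 0%N poles11)) => //; vm_compute.
- by apply: (@diagram_swirls _ _ (table_bl blockers11) swirls11); vm_compute.
Qed.

Theorem mainTheorem4 (R : realType) (k : nat) (hk : (4 <= k)%N) :
  (forall (n : nat) (D : 'I_n -> garc R),
      isSD D -> kOrientedAlign2 k D ->
      atLeastSwirls D 6 /\ (9 <= n)%N /\ (isSOD D -> (11 <= n)%N)) /\
  (exists D : 'I_9 -> garc R,
      isSD D /\ kOrientedAlign2 k D /\ exactlySwirls D 6) /\
  (exists D : 'I_11 -> garc R,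
      isSOD D /\ kOrientedAlign2 k D /\ exactlySwirls D 6).
Proof.
split; last by split; [exact: nine_arc_example|exact: eleven_arc_example].
by move=> n D sd; apply: lower_bounds.
Qed.
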